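(* Let $\mu>0$, $H\in\mathcal I_\mu$, let $Z=(X,Y)$ be the canonical zero-divergence system with parameters $(\mu,H)$, and let $\gamma_{(\mu,H)}$ be its crossing limit cycle of simple period. For every sufficiently small sidewise $C^1$ perturbation $\widetilde Z=(\widetilde X,\widetilde Y)$ of $Z$ on a compact neighborhood of $\gamma_{(\mu,H)}$, with the switching manifold $\Sigma$ kept fixed, there exists a unique crossing limit cycle $\widetilde\gamma$ of $\widetilde Z$ of simple period near $\gamma_{(\mu,H)}$. Moreover, $\widetilde\gamma$ is hyperbolic and orbitally asymptotically stable.
   Context: Let $f(x,y,z)=z$, $\Sigma=\{z=0\}\subset\mathbb R^3$, $S(x,y,z)=(-y,-x,-z)$. For $\mu>0$ and $H\in(0,1)\cup(1,\infty)$, the canonical zero-divergence system $Z=(X,Y)$ is the piecewise-linear Filippov system equal to $X$ on $\{z\ge0\}$ and to $Y=S\circ X\circ S$ on $\{z<0\}$, where $$X(x,y,z)=\bigl(-2\mu x-H(9\mu^2+1)z+H,\ 2\mu y-(1+\mu^2)z+1,\ y\bigr),$$ $$Y(x,y,z)=\bigl(2\mu x-(1+\mu^2)z-1,\ -2\mu y-H(9\mu^2+1)z-H,\ x\bigr).$$ For a piecewise system $(X,Y)$ the crossing region is $\Sigma^{\rm c}=\{p\in\Sigma: Xf(p)Yf(p)>0\}$, with $Xf=\langle X,\nabla f\rangle$; crossing trajectories follow $X$ in $z>0$, $Y$ in $z<0$, and are concatenated at points of $\Sigma^{\rm c}$. A crossing periodic orbit $\gamma$ is a periodic orbit with $\varnothing\ne\gamma\cap\Sigma\subset\Sigma^{\rm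 c}$; it has simple period if $\gamma\cap\Sigma$ consists of exactly two distinct points; it is a limit cycle if it is isolated among periodic orbits. It is hyperbolic if the derivative of its Poincaré return map on $\Sigma$ at the crossing point has no eigenvalue on the unit circle. Let $t_{\mathrm g}(\mu)\in(\pi,2\pi)$ be the solution of $\frac{\cos t-e^{-\mu t}}{\sin t}=\mu$, $H_{\mathrm g}(\mu)=e^{-2\mu t_{\mathrm g}(\mu)}$, $H_{\mathrm{crit}}(\mu)=\frac1{2\cosh(\pi\mu)-1}$, $\mathcal I_\mu=(H_{\mathrm g}(\mu),H_{\mathrm{crit}}(\mu))$. For $H\in\mathcal I_\mu$ the system $Z$ has exactly one crossing periodic orbit of simple period; it is denoted $\gamma_{(\mu,H)}$. A sidewise $C^1$ perturbation of $Z$ on a compact neighborhood $K$ of $\gamma_{(\mu,H)}$ is a pair of $C^1$ vector fields $(\widetilde X,\widetilde Y)$ on $K$ (used respectively in $z\ge0$ and $z<0$, and treated as independent components); it is small if $\widetilde X-X$ and $\widetilde Y-Y$ are small in the $C^1$ norm on $K$. ''Sufficiently small'' and ''near'' mean: there exist $\varepsilon>0$ and a neighborhood $\mathcal U$ of $\gamma_{(\mu,H)}$ such that, whenever the $C^1$ sizes are less than $\varepsilon$, there is exactly one crossing limit cycle of simple period of $\widetilde Z$ contained in $\mathcal U$. *)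

(* Defs.v *)
(* Points and vectors of R^3 are row vectors, over an arbitrary model R of the
   real numbers. *)
From HB Require Import structures.
From mathcomp Require Import all_boot all_order all_algebra.
From mathcomp Require Import complex.
From mathcomp Require Import all_classical all_reals all_analysis.
From mathcomp Require Import ring.

Set Implicit Arguments.
Unset Strict Implicit.
Unset Printing Implicit Defensive.

Import Order.TTheory GRing.Theory Num.Theory numFieldNormedType.Exports.

Local Open Scope classical_set_scope.
Local Open Scope ring_scope.

Section Coordinates.
Variable R : realType.

Definition vec3 (a b c : R) : 'rV[R]_3 := \row_j [:: a; b; c]`_j.

Definition xc (p : 'rV[R]_3) : R := p ord0 (inord 0).
Definition yc (p : 'rV[R]_3) : R := p ord0 (inord 1).
Definition zc (p : 'rV[R]_3) : R := p ord0 (inord 2).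

Lemma xc_vec3 a b c : xc (vec3 a b c) = a.
Proof. by rewrite /xc mxE inordK. Qed.
Lemma yc_vec3 a b c : yc (vec3 a b c) = b.
Proof. by rewrite /yc mxE inordK. Qed.
Lemma zc_vec3 a b c : zc (vec3 a b c) = c.
Proof. by rewrite /zc mxE inordK. Qed.

Definition Sigma : set 'rV[R]_3 := [set p | zc p = 0].

Definition toSigma (q : 'rV[R]_2) : 'rV[R]_3 :=
  vec3 (q ord0 (inord 0)) (q ord0 (inord 1)) 0.

End Coordinates.
Arguments Sigma {R}.

Section Canonical.
Variable R : realType.
Implicit Types (mu H t : R) (p : 'rV[R]_3).

Definition canonX mu H p : 'rV[R]_3 :=
  vec3 (- 2 * mu * xc p - H * (9 * mu ^+ 2 + 1) * zc p + H)
       (2 * mu * yc p - (1 + mu ^+ 2) * zc p + 1)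
       (yc p).

Definition canonS p : 'rV[R]_3 := vec3 (- yc p) (- xc p) (- zc p).

Definition canonY mu H : 'rV[R]_3 -> 'rV[R]_3 :=
  canonS \o canonX mu H \o canonS.

Lemma canonYE mu H p : canonY mu H p =
  vec3 (2 * mu * xc p - (1 + mu ^+ 2) * zc p - 1)
       (- 2 * mu * yc p - H * (9 * mu ^+ 2 + 1) * zc p - H)
       (xc p).
Proof.
rewrite /canonY /canonS /canonX /= !(xc_vec3, yc_vec3, zc_vec3).
by congr vec3; ring.
Qed.

Definition is_tg mu t : Prop :=
  [/\ pi < t, t < 2 * pi & (cos t - expR (- (mu * t))) / sin t = mu].

(* e^(-2 mu tg); meant for tg with [is_tg mu tg] *)
Definition Hg mu tg : R := expR (- (2 * mu * tg)).

Definition cosh (x : R) : R := (expR x + expR (- x)) / 2.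

Definition Hcrit mu : R := (2 * cosh (pi * mu) - 1)^-1.

End Canonical.

(* Piecewise system (upper, lower) with switching manifold Sigma, on a subset
   [dom] of R^3: orbits have to stay in [dom], and the values of the two fields
   outside [dom] are irrelevant. *)
Record pwsys (R : realType) := PwSys {
  dom : set 'rV[R]_3;
  upper : 'rV[R]_3 -> 'rV[R]_3;
  lower : 'rV[R]_3 -> 'rV[R]_3 }.

Definition canonZ (R : realType) (mu H : R) : pwsys R :=
  PwSys setT (canonX mu H) (canonY mu H).

Section Orbits.
Variable R : realType.
Implicit Types (Z : pwsys R) (p : 'rV[R]_3) (phi : R -> 'rV[R]_3)
  (J : set R) (g : set 'rV[R]_3).

(* X f = <X, grad f> for f(x, y, z) = z *)
Definition lief (X : 'rV[R]_3 -> 'rV[R]_3) p : R := zc (X p).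

Definition crossing Z : set 'rV[R]_3 :=
  [set p | Sigma p /\ 0 < lief (upper Z) p * lief (lower Z) p].

(* Velocity with which a trajectory leaves, resp. reaches, a point p. Off Sigma
   both are the field active at p; at a crossing point of Sigma they are the
   fields of the sides that are entered, resp. left. *)
Definition vel_out Z p : 'rV[R]_3 :=
  if (0 < zc p) || (zc p == 0) && (0 < lief (upper Z) p)
  then upper Z p else lower Z p.

Definition vel_in Z p : 'rV[R]_3 :=
  if (0 < zc p) || (zc p == 0) && (lief (upper Z) p < 0)
  then upper Z p else lower Z p.

Definition right_deriv phi (t : R) (v : 'rV[R]_3) : Prop :=
  h^-1 *: (phi (t + h) - phi t) @[h --> 0^'+] --> v.

Definition left_deriv phi (t : R) (v : 'rV[R]_3) : Prop :=
  h^-1 *: (phi (t + h) - phi t) @[h --> 0^'-] --> v.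

(* Trajectory parametrized by the interval J, meeting Sigma at most in crossing
   points; at an end point of J only the inner one-sided derivative counts.
   The crossing region is relatively open in Sigma, hence near an orbit that
   meets Sigma only there every Filippov trajectory is of this kind. *)
Definition trajectory Z J phi : Prop := forall t, J t ->
  [/\ dom Z (phi t),
      Sigma (phi t) -> crossing Z (phi t),
      (exists2 s, J s & t < s) -> right_deriv phi t (vel_out Z (phi t)) &
      (exists2 s, J s & s < t) -> left_deriv phi t (vel_in Z (phi t))].

Definition periodic_orbit Z g : Prop := exists phi (T : R),
  [/\ trajectory Z setT phi, 0 < T, forall t, phi (t + T) = phi t,
      exists s t, phi s <> phi t & g = range phi].

Definition crossing_periodic_orbit Z g : Prop :=
  [/\ periodic_orbit Z g, g `&` Sigma !=set0 & g `&` Sigma `<=` crossing Z].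

Definition simple_period g : Prop :=
  exists p q, p <> q /\ g `&` Sigma = [set p; q].

Definition isolated_orbit Z g : Prop := exists2 V, set_nbhs g V &
  forall g', periodic_orbit Z g' -> g' `<=` V -> g' = g.

Definition simple_crossing_limit_cycle Z g : Prop :=
  [/\ crossing_periodic_orbit Z g, simple_period g & isolated_orbit Z g].

(* P is, near p, the first return map to an open piece S of Sigma (in the
   coordinates (x, y)) that meets g only at p; shrinking S leaves out the other
   points of g on Sigma, so that P is the return map and not a half-return. *)
Definition return_map Z g (p : 'rV[R]_2) (P : 'rV[R]_2 -> 'rV[R]_2) : Prop :=
  exists S : set 'rV[R]_2,
  [/\ open S, S p, forall q, S q -> g (toSigma q) -> q = p &
      \forall q \near p, exists phi (tau : R),
      [/\ 0 < tau /\ trajectory Z `[0, tau]%classic phi,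
          phi 0 = toSigma q, phi tau = toSigma (P q), S (P q) &
          forall t r, 0 < t < tau -> S r -> phi t <> toSigma r]].

Definition hyperbolic Z g : Prop :=
  forall p : 'rV[R]_2, g (toSigma p) ->
  exists P, [/\ return_map Z g p P, differentiable P p &
    forall l : R[i],
      eigenvalue (map_mx (real_complex R) (jacobian P p)) l -> `|l| != 1].

Definition forward_trajectory Z p phi : Prop :=
  trajectory Z `[0, +oo[%classic phi /\ phi 0 = p.

Definition orbitally_stable Z g : Prop := forall V, set_nbhs g V ->
  exists2 W, set_nbhs g W & forall p, W p ->
    (exists phi, forward_trajectory Z p phi) /\
    (forall phi, forward_trajectory Z p phi -> forall t, 0 <= t -> V (phi t)).

Definition orbitally_attractive Z g : Prop :=
  exists2 W, set_nbhs g W & forall p phi, W p -> forward_trajectory Z p phi ->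
    forall e : R, 0 < e ->
    \forall t \near +oo, exists2 q, g q & `|phi t - q| < e.

Definition orbitally_asymptotically_stable Z g : Prop :=
  orbitally_stable Z g /\ orbitally_attractive Z g.

End Orbits.

Section Perturbations.
Variable R : realType.
Implicit Types (K : set 'rV[R]_3) (F G : 'rV[R]_3 -> 'rV[R]_3).

Definition C1_on K F : Prop := exists O, [/\ open O, K `<=` O &
  forall p, O p -> differentiable F p /\ {for p, continuous (jacobian F)}].

(* For C^1 fields F, G and a compact K this says that the C^1 norm of G - F
   on K is less than eps: the suprema are attained. *)
Definition C1_close K (eps : R) F G : Prop := forall p, K p ->
  `|G p - F p| < eps /\ `|jacobian (G \- F) p| < eps.

End Perturbations.

(* Main.v *)
Require Import Defs.
From HB Require Import structures.
From mathcomp Require Import all_boot all_order all_algebra.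
From mathcomp Require Import complex.
From mathcomp Require Import all_classical all_reals all_analysis.
From mathcomp Require Import ring lra.

(** The lower field is the image of the upper field under the involution [canonS],
    which maps the switching plane to itself. Following an arc of the upper field
    until it lands and applying [canonS] gives a map of the plane to itself, the
    half-return map; the turn around a cycle consists of two such steps, the
    second one for the system conjugate under [canonS].

    The unperturbed cycle. The upper field is affine: height and vertical speed
    form an expanding focus, and a third coordinate decays like e^(-2 mu t). So
    arcs are explicit ([arcflow]), and take-off and landing speed are functions of
    the arc time alone ([landing_speed]). A cycle of simple period consists of two
    arcs; if their times were different, eliminating H from the two matching
    conditions would give a contradiction ([times_ordered]). Hence the cycle is one
    arc together with its mirror image ([cycle_shape]), and its take-off point is
    a fixed point of the half-return map.

    Its stability. In suitable coordinates the derivative of the half-return map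
    at this point is (x, y) |-> (a x - d y, x), with 0 < d < 1 and |a| < 1 + d
    ([half_derivativeE], [half_contraction]). These are the conditions under which
    both eigenvalues lie in the unit disc; an explicit quadratic form yields a norm
    in which the derivative is a strict contraction ([adapted_norm_exists]).

    Persistence. Fields that are C^1-close to the two given ones on K are close to
    them in size and in Lipschitz constant on a tube around the arc
    ([c1_near_field]). In such a tube arcs still exist, are transversal to the
    plane where they land, and depend on their starting points as the linearized
    flow prescribes, up to a small multiple of the distance
    ([landing_linearized]). Therefore the half-return maps of all perturbed systems
    contract, in the adapted norm and with one common factor, on one common ball,
    which they map to itself ([small_data_exists]). The two half-return maps of a
    perturbed system exchange a pair of points ([fixed_pair_exists]), and the two
    arcs between these form a crossing cycle of simple period ([orbit_cycle]).

    Every trajectory that starts in a fixed neighborhood of the unperturbed cycle,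
    the [basin], is a concatenation of such arcs ([forward_exists],
    [trajectory_follows_arc]) and approaches the new cycle at a geometric rate
    ([forward_near]). This gives orbital stability and attraction, and also
    uniqueness and isolation, since a periodic orbit cannot approach another one
    without being equal to it ([periodic_attracted]). Finally the return map is
    differentiable ([landing_differentiable]), and its derivative inherits the
    contraction, so that no eigenvalue has modulus one ([contracting_eigenvalue]):
    the cycle is hyperbolic ([orbit_hyperbolic]). *)

Set Implicit Arguments.
Unset Strict Implicit.
Unset Printing Implicit Defensive.

Import Order.TTheory GRing.Theory Num.Theory numFieldNormedType.Exports.

Local Open Scope classical_set_scope.
Local Open Scope ring_scope.

(** * Calculus of vector-valued functions of time *)

Section VectorCalculus.
Variables (R : realType) (n : nat).
Implicit Types (v w : 'rV[R]_n) (f : R -> 'rV[R]_n) (a b t s m L : R).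

Lemma norm_rV_le v e : 0 <= e -> (forall j, `|v ord0 j| <= e) -> `|v| <= e.
Proof.
move=> e0 H; rewrite /Num.norm/= mx_normrE; apply: bigmax_le => // -[i j] _.
by rewrite /= ord1.
Qed.

Lemma coord_le_norm v j : `|v ord0 j| <= `|v|.
Proof.
rewrite [leRHS]/Num.norm/= mx_normrE.
by have := le_bigmax 0 (fun i : 'I_1 * 'I_n => `|v i.1 i.2|) (ord0, j).
Qed.

Lemma is_derive_rV f t v :
  is_derive t 1 f v <-> forall j, is_derive t 1 (fun s => f s ord0 j) (v ord0 j).
Proof.
split=> [[df <-] j|H].
  move/derivable_mxP: (df) => H.
  by rewrite (derive_mx df) mxE; apply/derivableP/H.
have df : derivable f t 1 by apply/derivable_mxP => i j; rewrite ord1; case: (H j).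
by apply: (DeriveDef df); rewrite (derive_mx df); apply/rowP => j; rewrite mxE; case: (H j).
Qed.

Lemma within_continuous_coord (A : set R) f j :
  {within A, continuous f} -> {within A, continuous (fun s => f s ord0 j)}.
Proof.
move=> cf; apply: (@within_continuous_comp _ _ _ A f (fun M => M ord0 j)) => //.
by move=> x _; exact: coord_continuous.
Qed.

(** The mean value theorem holds coordinatewise, hence in the sup norm. *)
Lemma mean_value_le f df a b v m : a <= b -> {within `[a, b], continuous f} ->
  (forall t, t \in `]a, b[ -> is_derive t 1 f (df t)) ->
  (forall t, t \in `]a, b[ -> `|df t - v| <= m) ->
  `|f b - f a - (b - a) *: v| <= m * (b - a).
Proof.
rewrite le_eqVlt => /predU1P[->|ab] cf fdf Hm.
  by rewrite !subrr scale0r subr0 normr0 mulr0.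
have m0 : 0 <= m.
  by apply: le_trans (Hm ((a + b) / 2) _); rewrite ?normr_ge0//; exact: mid_in_itvoo.
apply: norm_rV_le => [|j]; first by rewrite mulr_ge0// subr_ge0 ltW.
have [c cab] := MVT ab (fun x xab => (is_derive_rV f x (df x)).1 (fdf x xab) j)
  (@within_continuous_coord _ _ j cf).
rewrite !mxE => ->; rewrite [_ * v _ _]mulrC -mulrBl normrM.
rewrite [X in _ * X]gtr0_norm ?subr_gt0// ler_wpM2r ?subr_ge0 ?(ltW ab)//.
by apply: le_trans (Hm c cab); have := coord_le_norm (df c - v) j; rewrite !mxE.
Qed.

Lemma sum_const_ord (x : R) : \sum_(j < n) x = n%:R * x.
Proof. by rewrite sumr_const card_ord mulr_natl. Qed.

(** Gronwall's inequality. The square of the Euclidean norm is used because it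
    is differentiable. *)
Lemma gronwall f df a b L m : a <= b -> 0 <= L -> 0 <= m ->
  {within `[a, b], continuous f} ->
  (forall t, t \in `]a, b[ -> is_derive t 1 f (df t)) ->
  (forall t, t \in `]a, b[ -> `|df t| <= L * `|f t| + m) ->
  `|f b| <= n.+1%:R * expR (n%:R * (2 * L + 1) * (b - a)) * (`|f a| + m).
Proof.
move=> ab L0 m0 cf fdf Hm.
set K := n%:R * (2 * L + 1).
have K0 : 0 <= K by rewrite mulr_ge0// addr_ge0// mulr_ge0.
pose e t := \sum_j (f t ord0 j) ^+ 2.
have sqe t : `|f t| ^+ 2 <= e t.
  have e0 : 0 <= e t by apply: sumr_ge0 => j _; exact: sqr_ge0.
  rewrite -[leRHS]sqr_sqrtr// ler_pXn2r ?nnegrE ?sqrtr_ge0//.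
  apply: norm_rV_le => [|j]; first exact: sqrtr_ge0.
  rewrite -sqrtr_sqr ler_wsqrtr// /e (bigD1 j)//= lerDl.
  by apply: sumr_ge0 => i _; exact: sqr_ge0.
have sqe' t : e t <= n%:R * `|f t| ^+ 2.
  rewrite -sum_const_ord; apply: ler_sum => j _; rewrite -[leLHS]real_normK ?num_real//.
  by rewrite ler_pXn2r ?nnegrE// coord_le_norm.
pose g t := (e t + m ^+ 2) * expR (- K * (t - a)).
pose dg t := (\sum_j 2 * f t ord0 j * df t ord0 j - K * (e t + m ^+ 2)) * expR (- K * (t - a)).
have gdg t : t \in `]a, b[ -> is_derive t 1 g (dg t).
  move=> tab.
  have de : is_derive t 1 e (\sum_j 2 * f t ord0 j * df t ord0 j).
    have -> : e = \sum_j (fun s => f s ord0 j ^+ 2).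
      by apply/funext => s; rewrite /e fct_sumE.
    apply: is_derive_sum => j.
    have H := (is_derive_rV f t (df t)).1 (fdf t tab) j.
    apply: (@is_derive_eq _ _ _ ((fun s => f s ord0 j) ^+ 2)).
    by rewrite expr1 /GRing.scale/= mulr_natl.
  have dx : is_derive t 1 (fun t => expR (- K * (t - a))) (expR (- K * (t - a)) * - K).
    apply: (@is_derive1_comp _ expR (fun t => - K * (t - a))).
    have -> : (fun t => - K * (t - a)) = (- K) *: (id - cst a) by apply/funext.
    by apply: is_derive_eq; rewrite subr0 /GRing.scale/= mulr1.
  have -> : g = (e + cst (m ^+ 2)) * (fun t => expR (- K * (t - a))) by apply/funext.
  apply: is_derive_eq. rewrite /= /GRing.scale/= addr0 /dg/= -[(e + _) t]/(e t + m ^+ 2); ring.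
have dg0 t : t \in `]a, b[ -> dg t <= 0.
  move=> tab; rewrite /dg pmulr_lle0 ?expR_gt0// subr_le0.
  apply: (@le_trans _ _ (n%:R * (2 * `|f t| * (L * `|f t| + m)))).
    rewrite -sum_const_ord; apply: ler_sum => j _.
    apply: le_trans (ler_norm _) _; rewrite !normrM ger0_norm//.
    apply: ler_pM => //; first by rewrite ler_pM// coord_le_norm.
    exact: le_trans (coord_le_norm _ _) (Hm _ tab).
  rewrite /K -[leRHS]mulrA ler_wpM2l//.
  have := sqe t; set x := `|f t|; set y := e t => xy.
  have : 2 * x * m <= x ^+ 2 + m ^+ 2 by have := sqr_ge0 (x - m); rewrite sqrrB; lra.
  have : L * x ^+ 2 <= L * y by rewrite ler_wpM2l.
  have : 0 <= L * m ^+ 2 by rewrite mulr_ge0// sqr_ge0.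
  by lra.
have cg : {within `[a, b], continuous g}.
  have ce : {within `[a, b], continuous e}.
    apply: (@within_continuous_comp _ _ _ _ f (fun M => \sum_j M ord0 j ^+ 2)) => //.
    move=> x _; move: x; apply: continuous_big => [|j _ x]; first exact: add_continuous.
    by apply: continuousM; exact: coord_continuous.
  have cx : {within `[a, b], continuous (fun t => expR (- K * (t - a)))}.
    apply: continuous_subspaceT => x.
    apply: (@continuous_comp _ _ _ (fun t => - K * (t - a)) expR); last exact: continuous_expR.
    apply: continuousM; first exact: cst_continuous.
    by apply: continuousB; [exact: cvg_id|exact: cst_continuous].
  have -> : g = (e + cst (m ^+ 2)) * (fun t => expR (- K * (t - a))) by apply/funext.
  move=> x; apply: continuousM; last exact: cx.
  by apply: continuousD; [exact: ce|exact: cst_continuous].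
have gab : g b <= g a.
  apply: (@ler0_derive1_le_cc R g a b) => //.
  - by move=> x xab; case: (gdg _ xab).
  - by move=> x xab; rewrite derive1E; have [_ ->] := gdg _ xab; exact: dg0.
  - by rewrite in_itv/= lexx ab.
  - by rewrite in_itv/= lexx ab.
set E := expR (K * (b - a)).
have E1 : 1 <= E by rewrite -expR0 ler_expR mulr_ge0// subr_ge0.
have H1 : e b + m ^+ 2 <= (e a + m ^+ 2) * E.
  move: gab; rewrite /g subrr mulr0 expR0 mulr1 => /(ler_wpM2r (ltW (expR_gt0 (K * (b - a))))).
  by rewrite -mulrA -expRD mulNr addNr expR0 mulr1.
rewrite -(@ler_pXn2r _ 2)// ?nnegrE// ?mulr_ge0 ?expR_ge0 ?addr_ge0//.
apply: le_trans (sqe b) _; apply: (@le_trans _ _ (e b + m ^+ 2)).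
  by rewrite lerDl sqr_ge0.
apply: le_trans H1 _; rewrite exprMn.
apply: (@le_trans _ _ ((n%:R * `|f a| ^+ 2 + m ^+ 2) * E)).
  by rewrite ler_wpM2r ?expR_ge0// lerD2r.
rewrite mulrC exprMn -/E.
have -> : n.+1%:R ^+ 2 * E ^+ 2 * (`|f a| + m) ^+ 2 =
  E * (n.+1%:R ^+ 2 * (E * (`|f a| + m) ^+ 2)) by ring.
rewrite ler_wpM2l ?expR_ge0//.
apply: (@le_trans _ _ (n.+1%:R ^+ 2 * (`|f a| + m) ^+ 2)); last first.
  by rewrite ler_wpM2l ?sqr_ge0// -[leLHS]mul1r ler_wpM2r ?sqr_ge0.
apply: (@le_trans _ _ (n.+1%:R ^+ 2 * (`|f a| ^+ 2 + m ^+ 2))); last first.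
  rewrite ler_wpM2l ?sqr_ge0// sqrrD addrAC lerDl mulrn_wge0// mulr_ge0//.
rewrite mulrDr lerD//.
  rewrite ler_wpM2r ?sqr_ge0// -natrX ler_nat.
  by rewrite expnS expn1 mulSn; apply: leq_trans (leqnSn n) _; exact: leq_addr.
by rewrite -[leLHS]mul1r ler_wpM2r ?sqr_ge0// -natrX ler1n expn_gt0.
Qed.

End VectorCalculus.

Section Primitive.
Variable R : realType.
Implicit Types (f F : R -> R) (a t : R).

Lemma is_deriveP n (f : R -> 'rV[R]_n) t v :
  (forall e, 0 < e -> exists2 d, 0 < d & forall h, `|h| < d ->
    `|f (t + h) - f t - h *: v| <= e * `|h|) -> is_derive t 1 f v.
Proof.
move=> H.
have cv : (fun h => h^-1 *: (f (h *: 1 + t) - f t)) @ 0^' --> v.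
  apply/cvgrPdist_le => /= e e0; have [d d0 Hd] := H e e0.
  exists d => //= h; rewrite /ball_/= sub0r normrN => hd h0.
  rewrite distrC -[v in X in X <= _](scalerK h0) -scalerBr normrZ normfV.
  rewrite mulrC ler_pdivrMr ?normr_gt0//.
  by have := Hd h hd; rewrite [h *: 1]mulr1 [h + t]addrC.
by apply: DeriveDef; [apply/cvg_ex; exists v|exact/cvg_lim].
Qed.

Lemma continuous_is_derive n (f df : R -> 'rV[R]_n) :
  (forall t, is_derive t 1 f (df t)) -> continuous f.
Proof.
by move=> H t; apply/differentiable_continuous/derivable1_diffP; case: (H t).
Qed.

Lemma is_derive_reflect n (f : R -> 'rV[R]_n) c t v :
  is_derive (c - t) 1 f v -> is_derive t 1 (fun s => f (c - s)) (- v).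
Proof.
move=> /is_derive_rV H; apply/is_derive_rV => j.
have := H j => Hj.
have d1 : is_derive t 1 (fun s : R => c - s) (-1).
  have -> : (fun s : R => c - s) = cst c - id by apply/funext.
  by apply: is_derive_eq; rewrite sub0r.
by have := @is_derive1_comp R (fun s => f s ord0 j) (fun s => c - s) t _ _ Hj d1; rewrite mxE mulrN1.
Qed.

Lemma primitive_right a f : continuous f ->
  exists F, forall t, a < t -> is_derive t 1 F (f t).
Proof.
move=> cf; exists (fun x => \int[lebesgue_measure]_(t in `[a, x]) f t) => t ta.
have [||//||d1 d2] := @continuous_FTC1_closed R f a t (t + 1).
- by rewrite ltrDl.
- apply: continuous_compact_integrable; first exact: segment_compact.
  exact: continuous_subspaceT.
- exact: cf.
by apply: (DeriveDef d1); rewrite -derive1E.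
Qed.

(** Integration from a base point gives a primitive to the right of it; the
    left half-line is reached by reflecting time. *)
Lemma primitive f : continuous f ->
  exists F, forall t, is_derive t 1 F (f t).
Proof.
move=> cf; have [F1 HF1] := primitive_right (-1) cf.
have cf' : continuous (fun s => - f (- s)).
  by move=> x; apply: continuousN; apply: continuous_comp; [exact: opp_continuous|exact: cf].
have [F2 HF2] := primitive_right (-1) cf'.
pose G t := F2 (- t).
have HG t : t < 1 -> is_derive t 1 G (f t).
  move=> t1; have t1' : -1 < - t by rewrite ltrN2.
  have H2 := HF2 _ t1'; rewrite opprK in H2.
  have := is_derive1_comp H2 (is_deriveNid t 1).
  by rewrite mulrN1 opprK.
have FG t : -1 < t -> t < 1 -> F1 t - G t = F1 0 - G 0.
  move=> t1 t2; have dD (s : R) : -1 < s -> s < 1 -> is_derive s 1 (F1 - G) 0.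
    by move=> s1 s2; have := HF1 _ s1; have := HG _ s2 => ? ?; apply: is_derive_eq; rewrite subrr.
  have key (x y : R) : -1 < x -> x <= y -> y < 1 -> F1 y - G y = F1 x - G x.
    move=> x1 xy y1; have dD' (s : R) : s \in `[x, y] -> is_derive s 1 (F1 - G) 0.
      rewrite in_itv/= => /andP[? ?]; apply: dD; [exact: lt_le_trans x1 _|exact: le_lt_trans y1].
    have H1 (s : R) : s \in `]x, y[ -> is_derive s 1 (F1 - G) ((fun _ : R => 0 : R) s).
      by rewrite in_itv/= => /andP[s1 s2]; apply: dD'; rewrite in_itv/= !ltW.
    have H2 : {within `[x, y], continuous (F1 - G)}.
      by apply: derivable_within_continuous => s sxy; case: (dD' s sxy).
    have [c _ Hc] := MVT_segment xy H1 H2; move: Hc.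
    by rewrite mul0r => /subr0_eq.
  by case: (leP 0 t) => [t0|/ltW t0]; [apply: key|rewrite (key t 0)].
exists (fun t => if t < 0 then G t + (F1 0 - G 0) else F1 t) => t.
have [t0|t0|->] := ltgtP t 0.
- have Ht : is_derive t 1 (G + cst (F1 0 - G 0)) (f t).
    by have := HG t (lt_trans t0 ltr01) => ?; apply: is_derive_eq; rewrite addr0.
  apply: near_eq_is_derive Ht; near=> s; rewrite ifT//.
  by near: s; exact: lt_nbhsl.
- have Ht := HF1 t (lt_trans (ltrN10 _) t0).
  apply: near_eq_is_derive Ht; near=> s; rewrite ifF//.
  apply/negbTE; rewrite -leNgt ltW//; near: s; exact: lt_nbhsr.
- have Ht := HF1 0 (ltrN10 _).
  apply: near_eq_is_derive Ht; near=> s; case: ifP => // _.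
  rewrite -(FG s); first by rewrite addrC subrK.
  + near: s; exact: lt_nbhsr.
  + near: s; exact: lt_nbhsl.
Unshelve. all: by end_near. Qed.

Lemma primitive_rV n (f : R -> 'rV[R]_n) : continuous f ->
  exists F : R -> 'rV[R]_n, forall t, is_derive t 1 F (f t).
Proof.
move=> cf.
have H j : exists F, forall t, is_derive t 1 F (f t ord0 j).
  apply: (primitive (f := fun t => f t ord0 j)) => x.
  by apply: (@continuous_comp _ _ _ f (fun M => M ord0 j)); [exact: cf|exact: coord_continuous].
exists (fun t => \row_j sval (cid (H j)) t) => t.
apply/is_derive_rV => j; rewrite (_ : (fun _ => _) = sval (cid (H j))).
  by case: cid.
by apply/funext => s; rewrite mxE.
Qed.

Lemma mean_value_dist n (f df : R -> 'rV[R]_n) a b v m :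
  (forall t, is_derive t 1 f (df t)) ->
  (forall t, `|t - a| <= `|b - a| -> `|df t - v| <= m) ->
  `|f b - f a - (b - a) *: v| <= m * `|b - a|.
Proof.
move=> fdf H; have cf := continuous_is_derive fdf.
have cfw A : {within A, continuous f} by exact: continuous_subspaceT.
have [ab|/ltW ba] := leP a b.
  rewrite [X in _ * X]ger0_norm ?subr_ge0//; apply: (mean_value_le ab) => // t.
  rewrite in_itv/= => /andP[? ?]; apply: H; rewrite !ger0_norm; lra.
rewrite [X in _ * X]ler0_norm ?subr_le0// opprB.
rewrite (_ : f b - f a - (b - a) *: v = - (f a - f b - (a - b) *: v)); last first.
  by rewrite -[b - a]opprB scaleNr !opprB opprK addrC.
rewrite normrN; apply: (mean_value_le ba) => // t.
rewrite in_itv/= => /andP[? ?]; apply: H; rewrite !ler0_norm; lra.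
Qed.

End Primitive.

Section GeometricLimit.
Variables (R : realType) (n : nat).

Lemma powers_small (c th e : R) : 0 <= th -> th < 1 -> 0 < e -> exists N, forall m, (N <= m)%N -> c * th ^+ m < e.
Proof.
move=> th0 th1 e0.
have := @cvg_expr R th; rewrite ger0_norm// => /(_ th1) /cvgrPdist_lt H.
have c1 : 0 < `|c| + 1 by rewrite ltr_wpDl.
have [N _ HN] := H _ (divr_gt0 e0 c1).
exists N => m Nm; have := HN m Nm; rewrite /= sub0r normrN ger0_norm ?exprn_ge0// => h.
apply: (@le_lt_trans _ _ ((`|c| + 1) * th ^+ m)).
  by rewrite ler_wpM2r ?exprn_ge0//; have := ler_norm c; lra.
by rewrite mulrC -ltr_pdivlMr.
Qed.

Lemma geometric_limit (u : nat -> 'rV[R]_n) c th : 0 <= th -> th < 1 ->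
  (forall i, `|u i.+1 - u i| <= c * th ^+ i) ->
  exists l, forall i, `|l - u i| <= c / (1 - th) * th ^+ i.
Proof.
move=> th0 th1 Hu; have d0 : 0 < 1 - th by rewrite subr_gt0.
have c0 : 0 <= c by have := Hu 0%N; rewrite expr0 mulr1; apply: le_trans.
have Hc i j : `|u (i + j)%N - u i| <= c / (1 - th) * th ^+ i - c / (1 - th) * th ^+ (i + j).
  elim: j => [|j IH]; first by rewrite addn0 !subrr normr0.
  rewrite addnS -(subrKA (u (i + j)%N)); apply: le_trans (ler_normD _ _) _.
  have := lerD (Hu (i + j)%N) IH => H2; apply: le_trans H2 _.
  rewrite exprS le_eqVlt; apply/orP; left; apply/eqP; field; lra.
have Hc' i m : (i <= m)%N -> `|u m - u i| <= c / (1 - th) * th ^+ i.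
  move=> im; have := Hc i (m - i)%N; rewrite subnKC// => H; apply: le_trans H _.
  by rewrite lerBlDr lerDl mulr_ge0 ?exprn_ge0// divr_ge0// ltW.
have cu : cvg (u @ \oo).
  apply/cauchy_cvgP/cauchy_exP => e e0.
  have [N HN] := powers_small (c / (1 - th)) th0 th1 e0.
  exists (u N); exists N => // m /= Nm.
  rewrite -ball_normE /= distrC; apply: le_lt_trans (Hc' _ _ Nm) (HN _ (leqnn _)).
exists (lim (u @ \oo)) => i; apply/ler_addgt0Pr => e e0.
have /cvgrPdist_lt/(_ _ e0) [N _ HN] := cu.
have := HN (maxn N i); rewrite /= leq_maxl => /(_ isT) /ltW h1.
rewrite -(subrKA (u (maxn N i))); apply: le_trans (ler_normD _ _) _.
by rewrite addrC lerD// Hc' ?leq_maxr.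
Qed.

End GeometricLimit.

Section Picard.
Variables (R : realType) (n : nat).
Implicit Types (t s k L : R).

Lemma geometric_small (c e : R) : 0 < e -> exists N, forall m, (N <= m)%N -> c / 2 ^+ m < e.
Proof.
have h0 : 0 <= 2^-1 :> R by []; have h1 : 2^-1 < 1 :> R by rewrite invf_lt1// ltr1n.
move=> /(powers_small c h0 h1)[N HN]; exists N => m /HN; by rewrite exprVn.
Qed.

Lemma geometric_cvg (u : nat -> 'rV[R]_n) c :
  (forall i, `|u i.+1 - u i| <= c / 2 ^+ i) ->
  exists l, forall i, `|l - u i| <= 2 * c / 2 ^+ i.
Proof.
have h0 : 0 <= 2^-1 :> R by []; have h1 : 2^-1 < 1 :> R by rewrite invf_lt1// ltr1n.
move=> Hu; have [|l Hl] := geometric_limit (u := u) (c := c) h0 h1.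
  by move=> i; rewrite exprVn.
exists l => i; have := Hl i; rewrite exprVn (_ : c / (1 - 2^-1) = 2 * c)//; field; lra.
Qed.

Lemma is_derive_expc (c a t k : R) :
  is_derive t 1 (fun s => k * expR (c * (s - a))) (c * (k * expR (c * (t - a)))).
Proof.
have dx : is_derive t 1 (fun t => expR (c * (t - a))) (expR (c * (t - a)) * c).
  apply: (@is_derive1_comp _ expR (fun t => c * (t - a))).
  have -> : (fun t => c * (t - a)) = c *: (id - cst a) by apply/funext.
  by apply: is_derive_eq; rewrite subr0 /GRing.scale/= mulr1.
have -> : (fun s => k * expR (c * (s - a))) = k *: (fun t => expR (c * (t - a))) by apply/funext.
by apply: is_derive_eq; rewrite /GRing.scale/=; ring.
Qed.

Lemma exp_dominate1 (g dg : R -> R) t0 t k c : 0 < c -> 0 <= k -> t0 <= t ->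
  (forall s, is_derive s 1 g (dg s)) -> g t0 = 0 ->
  (forall s, t0 <= s -> dg s <= c * (k * expR (c * (s - t0)))) ->
  g t <= k * expR (c * (t - t0)).
Proof.
move=> c0 k0 t0t dgP g0 H.
pose h := (fun s => k * expR (c * (s - t0))) - g.
have dh s : is_derive s 1 h (c * (k * expR (c * (s - t0))) - dg s).
  by have := dgP s; have := is_derive_expc c t0 s k => ? ?; exact: is_deriveB.
have ht : h t0 <= h t.
  apply: (@ger0_derive1_le_cc R h t0 t) => //.
  - move=> s; rewrite in_itv/= => /andP[/ltW t0s _].
    by rewrite derive1E; have [_ ->] := dh s; rewrite subr_ge0 H.
  - by apply: derivable_within_continuous => s _; case: (dh s).
  - by rewrite in_itv/= lexx.
  - by rewrite in_itv/= lexx t0t.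
rewrite -subr_ge0; apply: le_trans ht.
by rewrite -[h t0]/(_ - g t0) g0 subr0 mulr_ge0// expR_ge0.
Qed.

(** The weight [expR (c * `|t - t0|)] is its own primitive up to the factor
    [c]; so the integral operator is a contraction in the weighted norm. *)
Lemma exp_dominate (g dg : R -> 'rV[R]_n) t0 t k c : 0 < c -> 0 <= k ->
  (forall s, is_derive s 1 g (dg s)) -> g t0 = 0 ->
  (forall s, `|dg s| <= c * (k * expR (c * `|s - t0|))) ->
  `|g t| <= k * expR (c * `|t - t0|).
Proof.
move=> c0 k0 dgP g0 H.
have key (f df : R -> 'rV[R]_n) s : (forall s, is_derive s 1 f (df s)) -> f t0 = 0 ->
    (forall s, `|df s| <= c * (k * expR (c * `|s - t0|))) -> t0 <= s ->
    `|f s| <= k * expR (c * `|s - t0|).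
  move=> dfP f0 Hf t0s; apply: norm_rV_le => [|j]; first by rewrite mulr_ge0// expR_ge0.
  have Hj u : t0 <= u -> `|df u ord0 j| <= c * (k * expR (c * (u - t0))).
    move=> t0u; apply: le_trans (coord_le_norm _ _) _; apply: le_trans (Hf u) _.
    by rewrite ger0_norm// subr_ge0.
  rewrite (ger0_norm (x := s - t0)) ?subr_ge0// ler_norml lerNl; apply/andP; split.
    apply: (@exp_dominate1 (fun u => - f u ord0 j) (fun u => - df u ord0 j)) => //.
    - move=> u; have := (is_derive_rV f u (df u)).1 (dfP u) j => ?.
      exact: is_deriveN.
    - by rewrite f0 mxE oppr0.
    - move=> u /Hj; apply: le_trans; rewrite lerNl; exact: lerNnormlW.
  apply: (@exp_dominate1 (fun u => f u ord0 j) (fun u => df u ord0 j)) => //.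
  - move=> u; exact: (is_derive_rV f u (df u)).1 (dfP u) j.
  - by rewrite f0 mxE.
  - by move=> u /Hj; apply: le_trans; exact: ler_norm.
have [t0t|/ltW tt0] := leP t0 t; first exact: (key g dg).
have := key (fun s => g (t0 + t0 - s)) (fun s => - dg (t0 + t0 - s)) (t0 + t0 - t).
rewrite subKr (_ : t0 + t0 - t - t0 = - (t - t0)); last by ring.
rewrite normrN; apply.
- by move=> s; apply: is_derive_reflect; exact: dgP.
- by rewrite addrK.
- move=> s; rewrite normrN; apply: le_trans (H _) _.
  by rewrite (_ : t0 + t0 - s - t0 = - (s - t0)) ?normrN//; ring.
- lra.
Qed.

(** Picard iteration: weighting time by [expR (2 * L * `|t - t0|)] makes the
    integral operator halve distances on the whole line at once, so that no
    continuation of local solutions is needed. *)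
Lemma picard (F : R -> 'rV[R]_n -> 'rV[R]_n) L B t0 p : 0 < L ->
  (forall t x y, `|F t x - F t y| <= L * `|x - y|) ->
  (forall u, continuous u -> continuous (fun t => F t (u t))) ->
  (forall t, `|F t p| <= B) ->
  exists phi, phi t0 = p /\ forall t, is_derive t 1 phi (F t (phi t)).
Proof.
move=> L0 FL Fc FB.
have B0 : 0 <= B by apply: le_trans (FB t0); exact: normr_ge0.
pose prim (f : R -> 'rV[R]_n) : R -> 'rV[R]_n :=
  get [set G : R -> 'rV[R]_n | forall t, is_derive t 1 G (f t)].
have primP f : continuous f -> forall t, is_derive t 1 (prim f) (f t).
  by move=> /primitive_rV[G GP]; rewrite /prim; case: xgetP => [y -> //|/(_ G)].
pose next (u : R -> 'rV[R]_n) t := p + (prim (fun s => F s (u s)) t - prim (fun s => F s (u s)) t0).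
pose y i := iter i next (fun=> p).
have nextP u : continuous u -> forall t, is_derive t 1 (next u) (F t (u t)).
  move=> cu t; have H := primP _ (Fc _ cu) t.
  have H0 := is_derive_cst (prim (fun s => F s (u s)) t0) t 1.
  have := is_deriveD (is_derive_cst p t 1) (is_deriveB H H0).
  by rewrite subr0 add0r.
have yc i : continuous (y i).
  elim: i => [|i IH]; first exact: cst_continuous.
  exact: continuous_is_derive (nextP _ IH).
have yS i t : is_derive t 1 (y i.+1) (F t (y i t)) by exact: nextP.
have y0 i : y i t0 = p by case: i => [//|i]; rewrite /y /= /next subrr addr0.
have yz : y 0%N = fun=> p by [].
clearbody y; clear nextP next.
pose w t := expR (2 * L * `|t - t0|).
have w1 t : 1 <= w t by rewrite -expR0 ler_expR !mulr_ge0// ltW.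
have L20 : 0 < 2 * L by rewrite mulr_gt0.
pose k := B / (2 * L).
have k0 : 0 <= k by rewrite divr_ge0// ltW.
have dy i t : `|y i.+1 t - y i t| <= k * w t / 2 ^+ i.
  elim: i t => [|i IH] t.
    rewrite expr0 divr1.
    apply: (@exp_dominate (y 1%N - y 0%N) (fun s => F s p)) => //.
    - move=> s; have := yS 0%N s => H.
      have : is_derive s 1 (y 0%N) 0 by rewrite yz; exact: is_derive_cst.
      by move=> H0; have := is_deriveB H H0; rewrite yz subr0.
    - by rewrite -[(_ - _) t0]/(y 1%N t0 - y 0%N t0) !y0 subrr.
    - move=> s; apply: le_trans (FB s) _; rewrite mulrA /k [X in X * _]mulrC divfK ?gt_eqF//.
      by rewrite -[leLHS]mulr1 ler_wpM2l//; exact: (w1 s).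
  have -> : k * w t / 2 ^+ i.+1 = k / 2 ^+ i.+1 * w t by ring.
  apply: (@exp_dominate (y i.+2 - y i.+1) (fun s => F s (y i.+1 s) - F s (y i s))) => //.
  - by rewrite divr_ge0// exprn_ge0.
  - by rewrite -[(_ - _) t0]/(y i.+2 t0 - y i.+1 t0) !y0 subrr.
  - move=> s; apply: le_trans (FL _ _ _) _; apply: le_trans (ler_wpM2l (ltW L0) (IH s)) _.
    rewrite le_eqVlt; apply/orP; left; apply/eqP; rewrite -/(w s) exprS.
    by field; rewrite expf_neq0.
have lim t : exists l, forall i, `|l - y i t| <= 2 * (k * w t) / 2 ^+ i.
  exact: geometric_cvg.
pose phi t := sval (cid (lim t)).
have phiP t i : `|phi t - y i t| <= 2 * (k * w t) / 2 ^+ i by rewrite /phi; case: cid.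
have phi0 : phi t0 = p.
  apply/subr0_eq/normr0_eq0/eqP; rewrite eq_le normr_ge0 andbT.
  apply/ler_addgt0Pr => e e0; rewrite add0r.
  have [N /(_ _ (leqnn _)) HN] := geometric_small (2 * (k * w t0)) e0.
  by apply: le_trans (ltW HN); have := phiP t0 N; rewrite y0.
(* the distance to the iterates is bounded uniformly on the unit ball
   around [t], which is needed to pass to the limit in the derivative *)
pose W t := expR (2 * L * (`|t - t0| + 1)).
have phiW t s i : `|s - t| <= 1 -> `|phi s - y i s| <= 2 * (k * W t) / 2 ^+ i.
  move=> st; apply: le_trans (phiP s i) _; rewrite ler_wpM2r ?invr_ge0 ?exprn_ge0//.
  rewrite ler_wpM2l// ler_wpM2l// ler_expR ler_wpM2l ?(ltW L20)//.
  by rewrite -(subrKA t); apply: le_trans (ler_normD _ _) _; rewrite addrC lerD2l.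
have phic : continuous phi.
  move=> t; apply/cvgrPdist_le => /= e e0.
  have e3 : 0 < e / 3 by rewrite divr_gt0.
  have [N /(_ _ (leqnn _)) /ltW HN] := geometric_small (2 * (k * W t)) e3.
  have /cvgrPdist_le/(_ _ e3) Hy := yc N t.
  have t1 : \forall s \near t, `|t - s| <= 1.
    by have /cvgrPdist_le/(_ 1 ltr01) := @cvg_id _ (nbhs t).
  near=> s.
  have h1 : `|phi t - y N t| <= e / 3 by apply: le_trans HN; apply: phiW; rewrite subrr normr0.
  have h2 : `|y N t - y N s| <= e / 3 by near: s.
  have h3 : `|phi s - y N s| <= e / 3.
    by apply: le_trans HN; apply: phiW; rewrite distrC; near: s.
  rewrite -(subrKA (y N t)) -[y N t - _](subrKA (y N s)).
  apply: le_trans (ler_normD _ _) _; rewrite [leRHS](_ : e = e / 3 + (e / 3 + e / 3)); last by field.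
  rewrite lerD//; apply: le_trans (ler_normD _ _) _; rewrite lerD//.
  by rewrite distrC.
exists phi; split=> // t; apply: is_deriveP => e e0.
have e4 : 0 < e / 2 by rewrite divr_gt0.
have /cvgrPdist_le/(_ _ e4) [d /= d0 Hd] := Fc _ phic t.
exists (Num.min d 1) => [|h]; first by rewrite lt_min d0 ltr01.
rewrite lt_min => /andP[hd h1].
apply/ler_addgt0Pr => e' e'0.
have e'3 : 0 < e' / 2 by rewrite divr_gt0.
have eL : 0 < e / 2 / L by rewrite divr_gt0.
have [N1 HN1] := geometric_small (2 * (k * W t)) e'3.
have [N2 HN2] := geometric_small (2 * (k * W t)) eL.
pose N := maxn N1 N2.
have HN1' s i : `|s - t| <= 1 -> (N <= i)%N -> `|phi s - y i s| <= e' / 2.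
  move=> st Ni; apply: le_trans (phiW t s i st) _; apply/ltW/HN1.
  exact: leq_trans (leq_maxl _ _) Ni.
have hh : `|t + h - t| = `|h| by rewrite addrAC subrr add0r.
have main : `|y N.+1 (t + h) - y N.+1 t - h *: F t (phi t)| <= e * `|h|.
  rewrite -hh -[X in X *: F t _](_ : t + h - t = h); last by rewrite addrAC subrr add0r.
  apply: (mean_value_dist (yS N)) => s; rewrite hh => sh.
  rewrite -(subrKA (F s (phi s))); apply: le_trans (ler_normD _ _) _.
  rewrite [e]splitr lerD//.
    apply: le_trans (FL _ _ _) _; rewrite -ler_pdivlMl// mulrC distrC.
    apply: le_trans (phiW t s N _) _; first by apply: le_trans sh _; exact: ltW.
    by apply/ltW/HN2; exact: leq_maxr.
  by rewrite distrC; apply: Hd; rewrite /ball_/= distrC; exact: le_lt_trans hd.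
have a1 : `|phi (t + h) - y N.+1 (t + h)| <= e' / 2.
  by apply: HN1'; [rewrite hh ltW|exact: leqnSn].
have a2 : `|phi t - y N.+1 t| <= e' / 2.
  by apply: HN1'; [rewrite subrr normr0|exact: leqnSn].
rewrite (_ : _ - _ - _ = (y N.+1 (t + h) - y N.+1 t - h *: F t (phi t)) +
  ((phi (t + h) - y N.+1 (t + h)) - (phi t - y N.+1 t))); last first.
  by rewrite opprB; apply/rowP => j; rewrite !mxE; ring.
apply: le_trans (ler_normD _ _) _; rewrite lerD//.
apply: le_trans (ler_normB _ _) _; rewrite [e']splitr lerD//.
Unshelve. all: by end_near. Qed.

End Picard.

(** * Perturbed flows in a tube *)

Section Maps.
Variable R : realType.

Lemma norm_mulmx_le l n k (x : 'M[R]_(l, n)) (M : 'M[R]_(n, k)) :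
  `|x *m M| <= n%:R * `|M| * `|x|.
Proof.
have coord a b (P : 'M[R]_(a, b)) i j : `|P i j| <= `|P|.
  rewrite [leRHS]/Num.norm/= mx_normrE.
  by have := le_bigmax 0 (fun i : 'I_a * 'I_b => `|P i.1 i.2|) (i, j).
rewrite [leLHS]/Num.norm/= mx_normrE; apply: bigmax_le; first by rewrite !mulr_ge0.
move=> -[i j] _ /=; rewrite mxE; apply: le_trans (ler_norm_sum _ _ _) _.
rewrite -mulrA -sum_const_ord; apply: ler_sum => a _.
by rewrite normrM mulrC ler_pM.
Qed.

Lemma is_derive_affine (a b t : R) : is_derive t 1 (fun s => a + s * b) b.
Proof.
have H : is_derive t 1 (b *: (id : R -> R)) (b *: (1 : R)) by exact: is_deriveZ.
have := is_deriveD (is_derive_cst a t 1) H; rewrite add0r /GRing.scale/= mulr1.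
by congr (is_derive _ _ _ _); apply/funext => s; rewrite [_ * b]mulrC.
Qed.

(** Mean value inequality for [f - A] along the segment from [q] to [p]. *)
Lemma diff_close_ball n k (f : 'rV[R]_n -> 'rV[R]_k) (A : 'M[R]_(n, k)) c r m :
  (forall p, `|p - c| <= r -> differentiable f p) ->
  (forall p v, `|p - c| <= r -> `|'d f p v - v *m A| <= m * `|v|) ->
  forall p q, `|p - c| <= r -> `|q - c| <= r ->
  `|f p - f q - (p - q) *m A| <= m * `|p - q|.
Proof.
move=> df Hd p q pr qr.
pose l := fun t : R => q + t *: (p - q).
have dl (t : R) : is_derive t 1 l (p - q).
  apply/is_derive_rV => j.
  have -> : (fun s => l s ord0 j) = (fun s => q ord0 j + s * (p - q) ord0 j).
    by apply/funext => s; rewrite /l !mxE.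
  exact: is_derive_affine.
have lr (t : R) : 0 <= t <= 1 -> `|l t - c| <= r.
  move=> /andP[t0 t1].
  have -> : l t - c = t *: (p - c) + (1 - t) *: (q - c).
    by apply/rowP => j; rewrite !mxE; ring.
  apply: le_trans (ler_normD _ _) _; rewrite !normrZ (ger0_norm t0) ger0_norm ?subr_ge0//.
  apply: (@le_trans _ _ (t * r + (1 - t) * r)); last by lra.
  by rewrite lerD// ler_wpM2l// subr_ge0.
have dfl (t : R) : 0 <= t <= 1 -> is_derive t 1 (f \o l) ('d f (l t) (p - q)).
  move=> t01; have dlt : differentiable l t by apply/derivable1_diffP; case: (dl t).
  have dft := df _ (lr t t01).
  have dc : differentiable (f \o l) t by exact: differentiable_comp.
  apply: DeriveDef; first exact/derivable1_diffP.
  rewrite deriveE// diff_comp//=; congr ('d f _ _).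
  by rewrite -deriveE//; case: (dl t).
have := @mean_value_le R k (f \o l) (fun t => 'd f (l t) (p - q)) 0 1 ((p - q) *m A)
  (m * `|p - q|) ler01.
rewrite subr0 scale1r mulr1 /= /l scale0r addr0 scale1r [q + _]addrC subrK; apply.
- apply: derivable_within_continuous => t; rewrite in_itv/= => t01.
  by case: (dfl t t01).
- by move=> t; rewrite in_itv/= => /andP[t0 t1]; apply: dfl; rewrite !ltW.
- by move=> t; rewrite in_itv/= => /andP[t0 t1]; apply/Hd/lr; rewrite !ltW.
Qed.

End Maps.

Section Clamp.
Variables (R : realType) (n : nat) (r : R).
Hypothesis r0 : 0 <= r.
Implicit Types v w : 'rV[R]_n.

(** Retraction onto a cube. Composed with a field that is known in a tube only
    it gives a field to which global existence applies. *)
Definition clamp v : 'rV[R]_n := \row_j Num.max (- r) (Num.min r (v ord0 j)).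

Lemma clamp_le v : `|clamp v| <= r.
Proof.
apply: norm_rV_le => // j; rewrite mxE ler_norml le_max lexx/= ge_max ge_min lexx/= andbT.
by apply: le_trans r0; rewrite oppr_le0.
Qed.

Lemma clamp_id v : `|v| <= r -> clamp v = v.
Proof.
move=> vr; apply/rowP => j; rewrite mxE.
have := le_trans (coord_le_norm v j) vr; rewrite ler_norml => /andP[h1 h2].
by rewrite (min_idPr h2) (max_idPr h1).
Qed.

Lemma clamp_lipschitz v w : `|clamp v - clamp w| <= `|v - w|.
Proof.
apply: norm_rV_le => // j; have := coord_le_norm (v - w) j; rewrite !mxE.
apply: le_trans; have := ler_norm (v ord0 j - w ord0 j).
have := ler_norm (- (v ord0 j - w ord0 j)); rewrite normrN.
move: (v ord0 j) (w ord0 j) `|_| => a b k h1 h2; rewrite ler_norml.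
by case: (leP r a); case: (leP r b) => *; do ?case: (leP (- r) _) => *; lra.
Qed.

End Clamp.

Section PerturbedFlow.
Variables (R : realType) (n : nat).
Implicit Types (X F : 'rV[R]_n -> 'rV[R]_n) (gam phi : R -> 'rV[R]_n) (t : R).

(** The last clause bounds the Lipschitz constant of [F - X], not only its
    size: this makes half-return maps close in the Lipschitz sense, and hence
    contracting together with the unperturbed one. *)
Definition tube_close X gam T1 r eps F := forall t, 0 <= t <= T1 ->
  forall p, `|p - gam t| <= r -> [/\ {for p, continuous F}, `|F p - X p| <= eps &
    forall q, `|q - gam t| <= r -> `|(F p - X p) - (F q - X q)| <= eps * `|p - q|].

Definition solution F a b phi := forall t, a <= t <= b -> is_derive t 1 phi (F (phi t)).

Lemma solution_within F a b phi c d : solution F a b phi -> a <= c -> d <= b ->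
  {within `[c, d], continuous phi}.
Proof.
move=> H ac db; apply: derivable_within_continuous => t; rewrite in_itv/= => /andP[ct td].
by have [] : is_derive t 1 phi (F (phi t)) by apply: H; rewrite (le_trans ac ct) (le_trans td db).
Qed.

(** The constant of [gronwall] for a time interval of length [T]. *)
Definition gconst (L T : R) : R := n.+1%:R * expR (n%:R * (2 * L + 1) * T).

Lemma gconst_ge1 L T : 0 <= L -> 0 <= T -> 1 <= gconst L T.
Proof.
move=> L0 T0; rewrite /gconst -[leLHS]mulr1 ler_pM// ?ler1n//.
by rewrite -expR0 ler_expR !mulr_ge0// addr_ge0// mulr_ge0.
Qed.

Lemma gconst_mono L T T' : 0 <= L -> T <= T' -> gconst L T <= gconst L T'.
Proof.
move=> L0 TT; rewrite ler_wpM2l// ler_expR ler_wpM2l// mulr_ge0// addr_ge0// mulr_ge0//.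
Qed.

Variables (X : 'rV[R]_n -> 'rV[R]_n) (L : R) (gam : R -> 'rV[R]_n) (T1 r eps : R).
Hypotheses (L0 : 0 <= L) (XL : forall p q, `|X p - X q| <= L * `|p - q|).
Hypothesis gamP : forall t, is_derive t 1 gam (X (gam t)).
Hypotheses (T10 : 0 <= T1) (r0 : 0 < r) (eps01 : 0 <= eps <= 1).

Lemma tube_lipschitz F t p q : tube_close X gam T1 r eps F -> 0 <= t <= T1 ->
  `|p - gam t| <= r -> `|q - gam t| <= r -> `|F p - F q| <= (L + 1) * `|p - q|.
Proof.
move=> FX tT pr qr; have [_ _ /(_ q qr) H] := FX t tT p pr.
have -> : F p - F q = (X p - X q) + ((F p - X p) - (F q - X q)).
  by apply/rowP => j; rewrite !mxE; ring.
apply: le_trans (ler_normD _ _) _; rewrite mulrDl lerD// ?XL//.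
by apply: le_trans H _; rewrite ler_wpM2r//; case/andP: eps01.
Qed.

(** The perturbation [F - X] is precomposed with the retraction onto the moving
    cube around [gam t]. The equation then has a solution for all times, and
    Gronwall's inequality keeps it in the tube, where the retraction is the
    identity. *)
Lemma tube_solution_exists F t0 p :
  tube_close X gam T1 r eps F -> 0 <= t0 <= T1 ->
  gconst L T1 * (`|p - gam t0| + eps) <= r ->
  exists phi, [/\ phi t0 = p, solution F t0 T1 phi &
    forall t, t0 <= t <= T1 -> `|phi t - gam t| <= gconst L T1 * (`|p - gam t0| + eps)].
Proof.
move=> FX tT Hr; have [e0 e1] := andP eps01.
pose c t := Num.max 0 (Num.min T1 t).
have cT t : 0 <= c t <= T1 by rewrite /c le_max lexx/= ge_max T10 ge_min lexx.
have cid t : 0 <= t <= T1 -> c t = t.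
  by move=> /andP[h1 h2]; rewrite /c (min_idPr h2) (max_idPr h1).
pose w t q := gam (c t) + clamp r (q - gam (c t)).
have wr t q : `|w t q - gam (c t)| <= r by rewrite /w addrC addKr clamp_le// ltW.
pose G t q := X q + (F (w t q) - X (w t q)).
have cc : continuous c.
  move=> t; rewrite /c; apply: continuous_max; first exact: cst_continuous.
  by apply: continuous_min; [exact: cst_continuous|exact: cvg_id].
have gc : continuous gam := continuous_is_derive gamP.
have lipc (f : 'rV[R]_n -> 'rV[R]_n) K : (forall p q, `|f p - f q| <= K * `|p - q|) -> continuous f.
  move=> Hf x; apply/(@cvgrPdist_le _ _ _ _ (nbhs_filter x)) => e e0'.
  have K0 : 0 < `|K| + 1 by rewrite ltr_wpDl.
  near=> y; apply: le_trans (Hf x y) _; apply: (@le_trans _ _ ((`|K| + 1) * `|x - y|)).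
    by rewrite ler_wpM2r// (le_trans (ler_norm _))// lerDl.
  rewrite -ler_pdivlMl// mulrC; near: y.
  have /(@cvgrPdist_le _ _ _ _ (nbhs_filter x)) := @cvg_id _ (nbhs x); apply; exact: divr_gt0.
have Xc : continuous X := lipc _ _ XL.
have clc : continuous (@clamp R n r).
  by apply: (lipc _ 1) => v v'; rewrite mul1r; exact: clamp_lipschitz.
have [] := @picard R n G (L + 1) (`|X p| + eps) t0 p.
- by rewrite ltr_wpDl.
- move=> t x y; rewrite /G.
  have -> : X x + (F (w t x) - X (w t x)) - (X y + (F (w t y) - X (w t y))) =
    (X x - X y) + ((F (w t x) - X (w t x)) - (F (w t y) - X (w t y))).
    by apply/rowP => j; rewrite !mxE; ring.
  apply: le_trans (ler_normD _ _) _; rewrite mulrDl lerD// ?XL//.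
  have [_ _ /(_ _ (wr t y)) H] := FX _ (cT t) _ (wr t x); apply: le_trans H _.
  rewrite ler_pM// /w opprD addrACA subrr add0r.
  apply: le_trans (clamp_lipschitz _ _ _) _ => //.
  by rewrite opprB addrA subrK.
- move=> u uc t; have wc : {for t, continuous (fun t => w t (u t))}.
    have g1 : {for t, continuous (gam \o c)} by apply: continuous_comp; [exact: cc|exact: gc].
    apply: continuousD; first exact: g1.
    apply: (@continuous_comp _ _ _ (fun t => u t - gam (c t)) (clamp r)); last exact: clc.
    by apply: continuousB; [exact: uc|exact: g1].
  rewrite /G /continuous_at.
  apply: cvgD; first by apply: continuous_comp; [exact: uc|exact: Xc].
  have [Fc _ _] := FX _ (cT t) _ (wr t (u t)).
  apply: cvgB; first by apply: (@continuous_comp _ _ _ (fun t => w t (u t)) F).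
  by apply: (@continuous_comp _ _ _ (fun t => w t (u t)) X) => //; exact: Xc.
- move=> t; apply: le_trans (ler_normD _ _) _; rewrite lerD2l.
  by have [_ H _] := FX _ (cT t) _ (wr t p).
move=> phi [phi0 dphi]; exists phi.
have near t : t0 <= t <= T1 -> `|phi t - gam t| <= gconst L T1 * (`|p - gam t0| + eps).
  move=> /andP[t0t tT1].
  have Hg := @gronwall R n (phi - gam) (fun s => G s (phi s) - X (gam s)) t0 t L eps t0t L0 e0.
  have dpg (s : R) : is_derive s 1 (phi - gam) (G s (phi s) - X (gam s)).
    by have := dphi s; have := gamP s => ? ?; exact: is_deriveB.
  have := Hg _ (fun s _ => dpg s) _.
  rewrite -[(phi - gam) t]/(phi t - gam t) -[(phi - gam) t0]/(phi t0 - gam t0) phi0.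
  move=> H; apply: le_trans (H _ _) _.
  - by apply: derivable_within_continuous => s _; case: (dpg s).
  - move=> s _; rewrite -[(phi - gam) s]/(phi s - gam s) /G addrAC.
    apply: le_trans (ler_normD _ _) _; rewrite lerD// ?XL//.
    by have [_ H' _] := FX _ (cT s) _ (wr s (phi s)).
  - rewrite ler_wpM2r ?addr_ge0//; apply: gconst_mono => //.
    by rewrite lerBlDr (le_trans tT1)// lerDl; case/andP: tT.
split=> // t /andP[t0t tT1]; have := dphi t.
have t01 : 0 <= t <= T1 by rewrite tT1 andbT; apply: le_trans t0t; case/andP: tT.
have -> : G t (phi t) = F (phi t); last by [].
rewrite /G /w (cid t t01) clamp_id; last by apply: le_trans Hr; apply: near; rewrite t0t.
by rewrite [gam t + _]addrC subrK addrC subrK.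
Unshelve. all: by end_near. Qed.

Lemma tube_solution_dist F t0 phi psi t : tube_close X gam T1 r eps F ->
  0 <= t0 -> t0 <= t -> t <= T1 ->
  {within `[t0, t], continuous phi} -> {within `[t0, t], continuous psi} ->
  (forall s, t0 < s < t -> is_derive s 1 phi (F (phi s))) ->
  (forall s, t0 < s < t -> is_derive s 1 psi (F (psi s))) ->
  (forall s, t0 < s < t -> `|phi s - gam s| <= r) ->
  (forall s, t0 < s < t -> `|psi s - gam s| <= r) ->
  `|phi t - psi t| <= gconst (L + 1) T1 * `|phi t0 - psi t0|.
Proof.
move=> FX t00 t0t tT1 cphi cpsi dphi dpsi rphi rpsi.
have L1 : 0 <= L + 1 by rewrite addr_ge0.
have := @gronwall R n (phi - psi) (fun s => F (phi s) - F (psi s)) t0 t (L + 1) 0 t0t L1 (lexx _).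
rewrite addr0 -[(phi - psi) t]/(phi t - psi t) -[(phi - psi) t0]/(phi t0 - psi t0).
move=> H; apply: le_trans (H _ _ _) _.
- by move=> s; apply: continuousD; [exact: cphi|apply: continuousN; exact: cpsi].
- move=> s; rewrite in_itv/= => sI; have := dphi s sI; have := dpsi s sI => ? ?.
  exact: is_deriveB.
- move=> s; rewrite in_itv/= => sI; rewrite addr0 -[(phi - psi) s]/(phi s - psi s).
  apply: (tube_lipschitz (t := s)) => //; [|exact: rphi|exact: rpsi].
  by case/andP: sI => s1 s2; rewrite (le_trans t00 (ltW s1)) (le_trans (ltW s2)).
- by rewrite ler_wpM2r//; apply: gconst_mono => //; lra.
Qed.

(** Gronwall's inequality for the error [psi - phi - v]. *)
Lemma solution_linearized F (A : R -> 'M[R]_n) phi psi (v : R -> 'rV[R]_n) (t0 t k d C : R) :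
  t0 <= t -> 0 <= k -> 0 <= d -> 0 <= C ->
  solution F t0 t phi -> solution F t0 t psi ->
  (forall s, t0 <= s <= t -> is_derive s 1 v (v s *m A s)) ->
  (forall s (x : 'rV[R]_n), t0 <= s <= t -> `|x *m A s| <= C * `|x|) ->
  (forall s, t0 <= s <= t ->
     `|F (psi s) - F (phi s) - (psi s - phi s) *m A s| <= k * `|psi s - phi s|) ->
  (forall s, t0 <= s <= t -> `|psi s - phi s| <= d) ->
  v t0 = psi t0 - phi t0 ->
  `|psi t - phi t - v t| <= gconst C (t - t0) * (k * d).
Proof.
move=> t0t k0 d0 C0 dphi dpsi dv AC HF Hd v0.
have dw (s : R) : t0 <= s <= t -> is_derive s 1 (psi - phi - v) (F (psi s) - F (phi s) - v s *m A s).
  move=> sI; have := dphi s sI; have := dpsi s sI; have := dv s sI => ? ? ?.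
  exact: is_deriveB.
have := @gronwall R n (psi - phi - v) (fun s => F (psi s) - F (phi s) - v s *m A s) t0 t C (k * d) t0t C0.
rewrite mulr_ge0// => /(_ isT).
rewrite -[(_ - v) t]/(psi t - phi t - v t) -[(_ - v) t0]/(psi t0 - phi t0 - v t0).
rewrite v0 subrr normr0 add0r; apply.
- by apply: derivable_within_continuous => s sI; rewrite in_itv/= in sI; case: (dw s sI).
- by move=> s; rewrite in_itv/= => /andP[s1 s2]; apply: dw; rewrite !ltW.
- move=> s; rewrite in_itv/= => /andP[s1 s2]; have sI : t0 <= s <= t by rewrite !ltW.
  rewrite -[(_ - v) s]/(psi s - phi s - v s).
  have -> : F (psi s) - F (phi s) - v s *m A s =
    (psi s - phi s - v s) *m A s + (F (psi s) - F (phi s) - (psi s - phi s) *m A s).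
    by rewrite [(_ - v s) *m _]mulmxBl; apply/rowP => j; rewrite !mxE; ring.
  apply: le_trans (ler_normD _ _) _; rewrite lerD ?AC//.
  by apply: le_trans (HF s sI) _; rewrite ler_wpM2l// Hd.
Qed.

End PerturbedFlow.

(** * Arcs in the half-space above the switching plane *)

Section Coord.
Variable R : realType.
Implicit Types (p q v : 'rV[R]_3) (phi : R -> 'rV[R]_3).

Lemma zc_norm v : `|zc v| <= `|v|. Proof. exact: coord_le_norm. Qed.
Lemma zcB p q : zc (p - q) = zc p - zc q. Proof. by rewrite /zc !mxE. Qed.
Lemma zcD p q : zc (p + q) = zc p + zc q. Proof. by rewrite /zc !mxE. Qed.
Lemma zcZ (a : R) p : zc (a *: p) = a * zc p. Proof. by rewrite /zc !mxE. Qed.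

Lemma is_derive_zc phi (t : R) v : is_derive t 1 phi v ->
  is_derive t 1 (fun s => zc (phi s)) (zc v).
Proof. by move=> /is_derive_rV/(_ (inord 2)). Qed.

Lemma within_zc (A : set R) phi : {within A, continuous phi} ->
  {within A, continuous (fun s => zc (phi s))}.
Proof. exact: within_continuous_coord. Qed.

End Coord.

Section Arcs.
Variable R : realType.
Implicit Types (X F : 'rV[R]_3 -> 'rV[R]_3) (gam phi : R -> 'rV[R]_3).
Implicit Types (p q : 'rV[R]_3) (t s : R).

(** A reference trajectory [gam] of a Lipschitz field [X] that leaves the plane
    upwards at time 0 and reaches it downwards at time [T], together with the
    margins ([k] in time, [r] in space, [m] in vertical speed) with which this
    picture persists in a tube around it. *)
Record arc_base X (L : R) gam (T k r m : R) : Prop := ArcBase {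
  ab_L0 : 0 <= L;
  ab_lip : forall p q, `|X p - X q| <= L * `|p - q|;
  ab_gam : forall t, is_derive t 1 gam (X (gam t));
  ab_k0 : 0 < k;
  ab_kT : 2 * k < T;
  ab_r0 : 0 < r;
  ab_m0 : 0 < m;
  ab_up : forall t p, 0 <= t <= k -> `|p - gam t| <= r -> 2 * m <= zc (X p);
  ab_down : forall t p, T - k <= t <= T + k -> `|p - gam t| <= r ->
    zc (X p) <= - (2 * m);
  ab_mid : forall t p, k <= t <= T - k -> `|p - gam t| <= r -> 0 < zc p;
  ab_start : zc (gam 0) = 0;
  ab_hit : zc (gam T) = 0;
  ab_end : forall p, `|p - gam (T + k)| <= r -> zc p < 0 }.

(** With [eps <= m] half of the margin [2 * m] on vertical speeds survives. *)
Record near_field X gam (T k r m eps : R) F : Prop := NearField {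
  nf_eps0 : 0 <= eps;
  nf_eps1 : eps <= 1;
  nf_epsm : eps <= m;
  nf_close : tube_close X gam (T + k) r eps F }.

(** Points of the plane are admitted at time 0 only, where the field points
    upwards; elsewhere in the tube they may be about to land. *)
Definition arc_start gam (T k d t0 : R) p :=
  [/\ 0 <= t0 <= T + k, `|p - gam t0| <= d & 0 < zc p \/ zc p = 0 /\ t0 = 0].

Record is_arc F gam (T k r t0 : R) p phi (tau : R) : Prop := IsArc {
  arc0 : phi t0 = p;
  arc_sol : solution F t0 (T + k) phi;
  arc_tube : forall t, t0 <= t <= T + k -> `|phi t - gam t| < r;
  arc_tau : t0 < tau < T + k;
  arc_late : T - k < tau;
  arc_hit : zc (phi tau) = 0;
  arc_pos : forall t, t0 < t < tau -> 0 < zc (phi t) }.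

Variables (X : 'rV[R]_3 -> 'rV[R]_3) (L : R) (gam : R -> 'rV[R]_3) (T k r m eps : R).
Variable F : 'rV[R]_3 -> 'rV[R]_3.
Hypotheses (B : arc_base X L gam T k r m) (N : near_field X gam T k r m eps F).

Let C0 := gconst 3 (L + 1) (T + k).
Let Tk0 : 0 <= T + k.
Proof. have := ab_k0 B; have := ab_kT B; lra. Qed.
Let e01 : 0 <= eps <= 1. Proof. by rewrite (nf_eps0 N) (nf_eps1 N). Qed.

Lemma C0_ge1 : 1 <= C0.
Proof. by apply: gconst_ge1 => //; rewrite addr_ge0// (ab_L0 B). Qed.

Lemma field_down t p : T - k <= t <= T + k -> `|p - gam t| <= r -> zc (F p) <= - m.
Proof.
move=> tI pr; have H := ab_down B tI pr.
have tI' : 0 <= t <= T + k.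
  by case/andP: tI => t1 ->; have := ab_kT B; have := ab_k0 B; rewrite andbT; lra.
have [_ H2 _] := nf_close N tI' pr.
have := zc_norm (F p - X p); rewrite zcB ler_norml => /andP[_ H3].
have := nf_epsm N; lra.
Qed.

Lemma field_up t p : 0 <= t <= k -> `|p - gam t| <= r -> m <= zc (F p).
Proof.
move=> tI pr; have H := ab_up B tI pr.
have tI' : 0 <= t <= T + k.
  by case/andP: tI => -> t1 /=; have := ab_kT B; have := ab_k0 B; lra.
have [_ H2 _] := nf_close N tI' pr.
have := zc_norm (F p - X p); rewrite zcB ler_norml => /andP[H3 _].
have := nf_epsm N; lra.
Qed.

Section OneSolution.
Variables (t0 : R) (phi : R -> 'rV[R]_3).
Hypotheses (t00 : 0 <= t0) (sol : solution F t0 (T + k) phi).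
Hypothesis tube : forall t, t0 <= t <= T + k -> `|phi t - gam t| <= r.

Let zmvt (a b : R) : t0 <= a -> a <= b -> b <= T + k ->
  exists2 c, c \in `[a, b] & zc (phi b) - zc (phi a) = zc (F (phi c)) * (b - a).
Proof.
move=> ta ab bT; apply: (@MVT_segment R (fun s => zc (phi s)) (fun s => zc (F (phi s)))) => //.
  move=> s; rewrite in_itv/= => /andP[s1 s2]; apply/is_derive_zc/sol.
  by rewrite (le_trans ta (ltW s1)) (le_trans (ltW s2)).
exact/within_zc/(solution_within sol).
Qed.

Lemma slope_down a b : t0 <= a -> T - k <= a -> a <= b -> b <= T + k ->
  m * (b - a) <= zc (phi a) - zc (phi b).
Proof.
move=> ta Ta ab bT; have [c /[!in_itv]/= /andP[c1 c2] H] := zmvt ta ab bT.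
have ba : 0 <= b - a by rewrite subr_ge0.
have : zc (F (phi c)) <= - m.
  apply: (field_down (t := c)); first by rewrite (le_trans Ta c1) (le_trans c2).
  by apply: tube; rewrite (le_trans ta c1) (le_trans c2).
by move=> /(ler_wpM2r ba); rewrite -H; lra.
Qed.

Lemma slope_up a b : t0 <= a -> a <= b -> b <= k ->
  m * (b - a) <= zc (phi b) - zc (phi a).
Proof.
move=> ta ab bk; have bT : b <= T + k by have := ab_kT B; have := ab_k0 B; lra.
have [c /[!in_itv]/= /andP[c1 c2] H] := zmvt ta ab bT.
have ba : 0 <= b - a by rewrite subr_ge0.
have : m <= zc (F (phi c)).
  apply: (field_up (t := c)); first by rewrite (le_trans t00 (le_trans ta c1)) (le_trans c2).
  by apply: tube; rewrite (le_trans ta c1) (le_trans c2).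
by move=> /(ler_wpM2r ba); rewrite -H; lra.
Qed.

(** The height is increasing near the start of the tube, positive in its
    middle and decreasing near its end, hence vanishes exactly once. *)
Lemma hit_exists : 0 < zc (phi t0) \/ zc (phi t0) = 0 /\ t0 = 0 -> t0 <= T + k ->
  exists tau, [/\ t0 < tau < T + k, T - k < tau, zc (phi tau) = 0 &
    forall t, t0 < t < tau -> 0 < zc (phi t)].
Proof.
move=> z0 t0T; have k0 := ab_k0 B; have kT := ab_kT B; have m0 := ab_m0 B.
have zend : zc (phi (T + k)) < 0.
  by apply: (ab_end B); apply: tube; rewrite t0T lexx.
have early t : t0 < t -> t <= T - k -> 0 < zc (phi t).
  move=> t0t tTk; have [kt|tk] := leP k t.
    by apply: (ab_mid B (t := t)); [rewrite kt|apply: tube; rewrite ltW//=; lra].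
  have z00 : 0 <= zc (phi t0) by case: z0 => [/ltW|[->]].
  have := slope_up (lexx t0) (ltW t0t) (ltW tk).
  have : 0 < m * (t - t0) by rewrite mulr_gt0// subr_gt0.
  by lra.
pose a := Num.max t0 (T - k).
have ta : t0 <= a by rewrite /a le_max lexx.
have Ta : T - k <= a by rewrite /a le_max lexx orbT.
have za : 0 < zc (phi a).
  rewrite /a; case: (leP (T - k) t0) => h.
    by case: z0 => // -[_ t0e]; move: h; rewrite t0e; lra.
  by apply: early.
have aT : a <= T + k by rewrite /a ge_max t0T/=; lra.
have [||tau /[!in_itv]/= /andP[at1 tT1] ztau] := @IVT R (fun s => zc (phi s)) a (T + k) 0 aT.
- exact/within_zc/(solution_within sol).
- by rewrite ge_min le_max (ltW za) (ltW zend) orbT.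
have atau : a < tau.
  by rewrite lt_neqAle at1 andbT; apply/eqP => e; move: za; rewrite e ztau ltxx.
have tauT : tau < T + k.
  by rewrite lt_neqAle tT1 andbT; apply/eqP => e; move: zend; rewrite -e ztau ltxx.
exists tau; split => //.
- by rewrite (le_lt_trans ta).
- exact: le_lt_trans Ta atau.
- move=> t /andP[t0t ttau]; have [tTk|tTk] := leP t (T - k); first exact: early.
  have := slope_down (ltW t0t) (ltW tTk) (ltW ttau) tT1; rewrite ztau.
  have : 0 < m * (tau - t) by rewrite mulr_gt0// subr_gt0.
  by lra.
Qed.

End OneSolution.

Lemma arc_exists d t0 p : C0 * (d + eps) < r -> arc_start gam T k d t0 p ->
  exists phi tau, is_arc F gam T k r t0 p phi tau /\
   forall t, t0 <= t <= T + k -> `|phi t - gam t| <= C0 * (`|p - gam t0| + eps).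
Proof.
move=> Cr [t0I pd z0].
have L1 : 0 <= L + 1 by rewrite addr_ge0// (ab_L0 B).
have g1 : gconst 3 L (T + k) <= C0.
  rewrite /C0 /gconst ler_wpM2l// ler_expR ler_wpM2r// ler_wpM2l//; lra.
have pe : 0 <= `|p - gam t0| + eps by rewrite addr_ge0// (nf_eps0 N).
have Hr : C0 * (`|p - gam t0| + eps) < r.
  apply: le_lt_trans Cr; rewrite ler_wpM2l ?lerD2r//.
  exact: le_trans C0_ge1.
have [phi [phi0 sol near]] := @tube_solution_exists R 3 X L gam (T + k) r eps (ab_L0 B)
  (ab_lip B) (ab_gam B) Tk0 (ab_r0 B) e01 F t0 p (nf_close N) t0I
  (le_trans (ler_wpM2r pe g1) (ltW Hr)).
have near' t : t0 <= t <= T + k -> `|phi t - gam t| <= C0 * (`|p - gam t0| + eps).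
  by move=> tI; apply: le_trans (near t tI) _; rewrite ler_wpM2r.
case/andP: t0I => t00 t0T.
have [||tau [h1 h2 h3 h4]] := hit_exists t00 sol _ _ t0T.
- by move=> t tI; apply: le_trans (near' t tI) (ltW Hr).
- by rewrite phi0.
exists phi, tau; split => //; split => // t tI; exact: le_lt_trans (near' t tI) Hr.
Qed.

Section TwoArcs.
Variables (t0 : R) (p q : 'rV[R]_3) (phi psi : R -> 'rV[R]_3) (tau sig : R).
Hypotheses (t00 : 0 <= t0).
Hypotheses (Aphi : is_arc F gam T k r t0 p phi tau) (Apsi : is_arc F gam T k r t0 q psi sig).

Lemma arc_dist t : t0 <= t <= T + k -> `|phi t - psi t| <= C0 * `|p - q|.
Proof.
move=> /andP[t0t tT]; rewrite -(arc0 Aphi) -(arc0 Apsi).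
apply: (@tube_solution_dist R 3 X L gam (T + k) r eps (ab_L0 B)
  (ab_lip B) e01 F) => //; first exact: (nf_close N).
- exact: (solution_within (arc_sol Aphi)).
- exact: (solution_within (arc_sol Apsi)).
- by move=> s /andP[s1 s2]; apply: (arc_sol Aphi); rewrite ltW//= (le_trans (ltW s2)).
- by move=> s /andP[s1 s2]; apply: (arc_sol Apsi); rewrite ltW//= (le_trans (ltW s2)).
- by move=> s /andP[s1 s2]; apply/ltW/(arc_tube Aphi); rewrite ltW//= (le_trans (ltW s2)).
- by move=> s /andP[s1 s2]; apply/ltW/(arc_tube Apsi); rewrite ltW//= (le_trans (ltW s2)).
Qed.

(** Landing at vertical speed at least [m], the arc that comes down later is
    at height at least [m * (sig - tau)] when the other one lands. *)
Lemma hit_time_dist_le : tau <= sig -> m * (sig - tau) <= C0 * `|p - q|.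
Proof.
move=> ts; case/andP: (arc_tau Aphi) => t1 t2; case/andP: (arc_tau Apsi) => s1 s2.
have tubepsi t : t0 <= t <= T + k -> `|psi t - gam t| <= r by move=> /(arc_tube Apsi)/ltW.
have := slope_down (arc_sol Apsi) tubepsi (ltW t1) (ltW (arc_late Aphi)) ts (ltW s2).
rewrite (arc_hit Apsi) subr0 => H; apply: le_trans H _.
have := arc_dist (t := tau); rewrite (ltW t1) (ltW t2) => /(_ isT); apply: le_trans.
have := zc_norm (phi tau - psi tau); rewrite zcB (arc_hit Aphi) sub0r normrN.
by apply: le_trans; exact: ler_norm.
Qed.

End TwoArcs.

Lemma hit_time_dist t0 p q phi psi tau sig : 0 <= t0 ->
  is_arc F gam T k r t0 p phi tau -> is_arc F gam T k r t0 q psi sig ->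
  m * `|tau - sig| <= C0 * `|p - q|.
Proof.
move=> t00 A1 A2; have [ts|/ltW ts] := leP tau sig.
  by rewrite distrC ger0_norm ?subr_ge0//; exact: (hit_time_dist_le t00 A1 A2).
by rewrite ger0_norm ?subr_ge0// distrC; exact: (hit_time_dist_le t00 A2 A1).
Qed.

Lemma arc_unique t0 p phi psi tau sig : 0 <= t0 ->
  is_arc F gam T k r t0 p phi tau -> is_arc F gam T k r t0 p psi sig ->
  tau = sig /\ forall t, t0 <= t <= T + k -> phi t = psi t.
Proof.
move=> t00 A1 A2; split.
  have := hit_time_dist t00 A1 A2; rewrite subrr normr0 mulr0 pmulr_rle0 ?(ab_m0 B)//.
  by rewrite normr_le0 subr_eq0 => /eqP.
move=> t tI; have := arc_dist t00 A1 A2 tI.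
by rewrite subrr normr0 mulr0 normr_le0 subr_eq0 => /eqP.
Qed.

Lemma arc_near d t0 p phi tau : C0 * (d + eps) < r -> arc_start gam T k d t0 p ->
  is_arc F gam T k r t0 p phi tau ->
  forall t, t0 <= t <= T + k -> `|phi t - gam t| <= C0 * (`|p - gam t0| + eps).
Proof.
move=> Cr st A t tI; have [psi [sig [A2 H]]] := arc_exists Cr st.
have t00 : 0 <= t0 by case: st => /andP[].
by have [_ ->//] := arc_unique t00 A A2; exact: H.
Qed.

Lemma arc_hit_near d t0 p phi tau : C0 * (d + eps) < r -> arc_start gam T k d t0 p ->
  is_arc F gam T k r t0 p phi tau -> t0 <= T ->
  m * `|tau - T| <= C0 * (`|p - gam t0| + eps).
Proof.
move=> Cr st A t0T; have near := arc_near Cr st A.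
have t00 : 0 <= t0 by case: st => /andP[].
have k0 := ab_k0 B.
have := near T; rewrite t0T lerDl (ltW k0) => /(_ isT) nT.
have := zc_norm (phi T - gam T); rewrite zcB (ab_hit B) subr0 => zT.
have tubephi t : t0 <= t <= T + k -> `|phi t - gam t| <= r by move=> /(arc_tube A)/ltW.
case/andP: (arc_tau A) => h1 h2; have h3 := arc_late A; have h4 := arc_hit A.
have [ts|/ltW ts] := leP tau T.
  rewrite distrC ger0_norm ?subr_ge0//.
  have := slope_down (arc_sol A) tubephi (ltW h1) (ltW h3) ts; rewrite lerDl (ltW k0).
  move=> /(_ isT); rewrite h4 sub0r => H; apply: le_trans H _.
  by apply: le_trans nT; apply: le_trans zT; rewrite -normrN; exact: ler_norm.
rewrite ger0_norm ?subr_ge0//.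
have Tk : T - k <= T by lra.
have := slope_down (arc_sol A) tubephi t0T Tk ts (ltW h2); rewrite h4 subr0.
by move=> H; apply: le_trans H _; apply: le_trans nT; apply: le_trans zT; exact: ler_norm.
Qed.

End Arcs.

(** * Linearization of the half-return map *)

Section FundamentalMatrix.
Variables (R : realType) (n : nat).

(** Its rows are the solutions that start at the basis vectors. *)
Lemma fundamental_matrix (A : R -> 'M[R]_n) C t0 : 0 <= C ->
  (forall t (x : 'rV[R]_n), `|x *m A t| <= C * `|x|) -> continuous A ->
  exists E : R -> 'M[R]_n, E t0 = 1%:M /\
    forall (d : 'rV[R]_n) (t : R), is_derive t 1 (fun t => d *m E t) (d *m E t *m A t).
Proof.
move=> C0 AC Ac.
have H (p : 'rV[R]_n) : exists phi : R -> 'rV[R]_n, phi t0 = p /\ forall t : R, is_derive t 1 phi (phi t *m A t).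
  apply: (@picard R n (fun t x => x *m A t) (C + 1) (C * `|p|)).
  - by rewrite ltr_wpDl.
  - by move=> t x y; rewrite -mulmxBl; apply: le_trans (AC _ _) _; rewrite ler_wpM2r// lerDl.
  - move=> u uc t; apply/(@cvgrPdist_le _ _ _ _ (nbhs_filter t)) => e e0.
    have M0 : 0 < n%:R * `|A t| + 1 by rewrite ltr_wpDl// mulr_ge0.
    have U0 : 0 < n%:R * (`|u t| + 1) + 1 by rewrite ltr_wpDl// mulr_ge0// addr_ge0.
    have /(@cvgrPdist_le _ _ _ _ (nbhs_filter t)) Hu := uc t.
    have /(@cvgrPdist_le _ _ _ _ (nbhs_filter t)) HA := Ac t.
    near=> s.
    have -> : u t *m A t - u s *m A s = (u t - u s) *m A t + u s *m (A t - A s).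
      by rewrite mulmxBl mulmxBr addrA subrK.
    have us : `|u s| <= `|u t| + 1.
      rewrite -[u s](subrK (u t)) addrC; apply: le_trans (ler_normD _ _) _; rewrite lerD2l distrC.
      by near: s; exact: Hu.
    apply: le_trans (ler_normD _ _) _; rewrite [leRHS]splitr lerD//.
      apply: le_trans (norm_mulmx_le _ _) _.
      apply: (@le_trans _ _ ((n%:R * `|A t| + 1) * `|u t - u s|)); first by rewrite ler_wpM2r// lerDl.
      rewrite -ler_pdivlMl// mulrC; near: s; apply: Hu; exact: divr_gt0 (divr_gt0 e0 _) _.
    apply: le_trans (norm_mulmx_le _ _) _.
    apply: (@le_trans _ _ ((n%:R * (`|u t| + 1) + 1) * `|A t - A s|)).
      rewrite mulrAC ler_wpM2r//; apply: (@le_trans _ _ (n%:R * (`|u t| + 1))).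
        by rewrite ler_wpM2l.
      by rewrite lerDl.
    rewrite -ler_pdivlMl// mulrC; near: s; apply: HA; exact: divr_gt0 (divr_gt0 e0 _) _.
  - by move=> t; exact: AC.
pose phi i := sval (cid (H (delta_mx 0 i))).
have phi0 i : phi i t0 = delta_mx 0 i by rewrite /phi; case: cid => ? [].
have dphi i (t : R) : is_derive t 1 (phi i) (phi i t *m A t) by rewrite /phi; case: cid => ? [].
exists (fun t => \matrix_(i, j) phi i t ord0 j); split.
  by apply/matrixP => i j; rewrite !mxE phi0 mxE /= eq_sym.
move=> d t.
have dE s : d *m (\matrix_(i, j) phi i s ord0 j) = \sum_i d ord0 i *: phi i s.
  apply/rowP => j; rewrite !mxE summxE; apply: eq_bigr => i _; by rewrite !mxE.
rewrite dE mulmx_suml.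
have -> : (fun s => d *m (\matrix_(i, j) phi i s ord0 j)) = \sum_i (d ord0 i *: phi i).
  by apply/funext => s; rewrite dE fct_sumE.
apply: is_derive_sum => i.
have -> : (d ord0 i *: phi i t) *m A t = d ord0 i *: (phi i t *m A t) by rewrite scalemxAl.
exact: is_deriveZ.
Unshelve. all: by end_near. Qed.

End FundamentalMatrix.

Section Projection.
Variable R : realType.
Implicit Types v w : 'rV[R]_3.

(** The projection onto the plane of height zero, along [w]. *)
Definition proj_along w v : 'rV[R]_3 := v - (zc v / zc w) *: w.

Lemma proj_alongB w v v' : proj_along w (v - v') = proj_along w v - proj_along w v'.
Proof. by apply/rowP => j; rewrite /proj_along zcB !mxE; ring. Qed.

Lemma proj_along_le w v m : 0 < m -> zc w <= - m ->
  `|proj_along w v| <= (1 + `|w| / m) * `|v|.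
Proof.
move=> m0 wm; apply: le_trans (ler_normB _ _) _; rewrite mulrDl mul1r lerD2l.
rewrite normrZ normrM normfV [leRHS]mulrAC [leLHS]mulrAC -![_ * `|w|]mulrC -!mulrA.
rewrite ler_wpM2l//.
have nm : m <= `|zc w| by rewrite -normrN (le_trans _ (ler_norm _))// lerNr.
have w0 : 0 < `|zc w| by exact: lt_le_trans nm.
apply: ler_pM; rewrite ?invr_ge0 ?zc_norm//; last by rewrite lef_pV2 ?posrE.
Qed.

End Projection.

Section HalfMap.
Variable R : realType.
Implicit Types (F : 'rV[R]_3 -> 'rV[R]_3) (phi psi : R -> 'rV[R]_3) (p q w : 'rV[R]_3).

Lemma solution_mvt F a b phi w c s t : solution F a b phi ->
  a <= s <= b -> a <= t <= b ->
  (forall u, Num.min s t <= u <= Num.max s t -> `|F (phi u) - w| <= c) ->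
  `|phi t - phi s - (t - s) *: w| <= c * `|t - s|.
Proof.
move=> sol /andP[as_ sb] /andP[at_ tb] H.
have key x y : a <= x -> y <= b -> x <= y ->
    (forall u, x <= u <= y -> `|F (phi u) - w| <= c) ->
    `|phi y - phi x - (y - x) *: w| <= c * (y - x).
  move=> ax yb xy Hu; apply: (@mean_value_le R 3 phi (fun u => F (phi u))) => //.
  - exact: (solution_within sol).
  - move=> u; rewrite in_itv/= => /andP[u1 u2]; apply: sol.
    by rewrite (le_trans ax (ltW u1)) (le_trans (ltW u2)).
  - by move=> u; rewrite in_itv/= => /andP[u1 u2]; apply: Hu; rewrite !ltW.
have [st|/ltW ts] := leP s t.
  rewrite [X in _ <= _ * X]ger0_norm ?subr_ge0//; apply: key => // u.
  by have := H u; rewrite (min_idPl st) (max_idPr st).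
rewrite [X in _ <= _ * X]ler0_norm ?subr_le0// opprB.
rewrite (_ : _ - _ = - (phi s - phi t - (s - t) *: w)); last first.
  by rewrite -[t - s]opprB scaleNr !opprB opprK addrC.
by rewrite normrN; apply: key => // u; have := H u; rewrite (min_idPr ts) (max_idPl ts).
Qed.

Variables (X : 'rV[R]_3 -> 'rV[R]_3) (L : R) (gam : R -> 'rV[R]_3) (T k r m : R).
Hypothesis B : arc_base X L gam T k r m.

Let C0 := gconst 3 (L + 1) (T + k).
Let Tk0 : 0 < T + k.
Proof. have := ab_k0 B; have := ab_kT B; lra. Qed.
Let T0 : 0 < T.
Proof. have := ab_k0 B; have := ab_kT B; lra. Qed.
Let C01 : 1 <= C0.
Proof. by apply: gconst_ge1; [rewrite addr_ge0// (ab_L0 B)|exact: ltW]. Qed.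
Let C00 : 0 <= C0 := le_trans ler01 C01.

(** Two nearby arcs reach the plane at different times; to first order this
    amounts to projecting their distance along the velocity [w] at the hit. *)
Lemma hit_linearized eps F t0 p q phi psi tau sig w c : 0 <= t0 -> 
  near_field X gam T k r m eps F ->
  is_arc F gam T k r t0 p phi tau -> is_arc F gam T k r t0 q psi sig ->
  zc w <= - m -> 0 <= c ->
  (forall u, Num.min tau sig <= u <= Num.max tau sig -> `|F (psi u) - w| <= c) ->
  `|psi sig - phi tau - proj_along w (psi tau - phi tau)| <=
    (1 + `|w| / m) * (c * `|sig - tau|).
Proof.
move=> t00 N A1 A2 wm c0 H; have m0 := ab_m0 B.
have /andP[t1 t2] := arc_tau A1; have /andP[s1 s2] := arc_tau A2.
have := solution_mvt (arc_sol A2) _ _ H.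
rewrite (ltW t1) (ltW t2) (ltW s1) (ltW s2) => /(_ isT isT).
set rho := _ - _ - (_ *: w) => Hrho.
have zw : zc w != 0 by apply/eqP => e; move: wm; rewrite e; lra.
have -> : psi sig - phi tau - proj_along w (psi tau - phi tau) = proj_along w rho.
  rewrite /proj_along /rho !zcB zcZ (arc_hit A1) (arc_hit A2).
  apply/rowP => j; rewrite !mxE; by field.
apply: le_trans (proj_along_le _ m0 wm) _.
by rewrite ler_wpM2l// addr_ge0// divr_ge0// ltW.
Qed.

Lemma gam_speed : exists2 G, 0 <= G &
  (forall s, 0 <= s <= T + k -> `|X (gam s)| <= G) /\
  (forall s t, 0 <= s <= T + k -> 0 <= t <= T + k -> `|gam t - gam s| <= G * `|t - s|).
Proof.
pose M := L * (gconst 3 L (T + k) * `|X (gam 0)|)  + `|X (gam 0)|.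
have M0 : 0 <= M by rewrite addr_ge0// !mulr_ge0// ?(ab_L0 B)// expR_ge0.
have H s : 0 <= s <= T + k -> `|X (gam s)| <= M.
  move=> /andP[s0 sT].
  have := @gronwall R 3 (fun u => gam u - gam 0) (fun u => X (gam u)) 0 s L (`|X (gam 0)|) s0 (ab_L0 B) (normr_ge0 _).
  rewrite subrr normr0 add0r subr0 => H.
  have {}H : `|gam s - gam 0| <= gconst 3 L (T + k) * `|X (gam 0)|.
    have dg (u : R) : is_derive u 1 (fun u => gam u - gam 0) (X (gam u)).
      have := is_deriveB (ab_gam B u) (is_derive_cst (gam 0) u 1); by rewrite subr0.
    apply: le_trans (H _ _ _) _.
    - by apply: derivable_within_continuous => u _; case: (dg u).
    - move=> u _; rewrite -{1}[X (gam u)](subrK (X (gam 0))).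
      by apply: le_trans (ler_normD _ _) _; rewrite lerD2r (ab_lip B).
    - by rewrite ler_wpM2r//; have := gconst_mono 3 (ab_L0 B) sT.
  rewrite -[X (gam s)](subrK (X (gam 0))); apply: le_trans (ler_normD _ _) _.
  rewrite lerD2r; apply: le_trans (ab_lip B _ _) _.
  by rewrite ler_wpM2l// (ab_L0 B).
exists M => //; split => // s t sI tI.
have solg : solution X 0 (T + k) gam by move=> u _; exact: (ab_gam B).
have := @solution_mvt X 0 (T + k) gam 0 M s t solg sI tI.
rewrite scaler0 subr0; apply => u /andP[u1 u2]; rewrite subr0; apply: H.
case/andP: sI => ? ?; case/andP: tI => ? ?.
by rewrite (le_trans _ u1) ?le_min ?(le_trans u2)// ?ge_max; do ?(apply/andP; split).
Qed.

Variables (A : 'M[R]_3) (E : R -> 'M[R]_3).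
Hypothesis XA : forall p q, X p - X q = (p - q) *m A.
Hypothesis E0 : E 0 = 1%:M.
Hypothesis dE : forall (d : 'rV[R]_3) (t : R), is_derive t 1 (fun t => d *m E t) (d *m E t *m A).

Let AL (x : 'rV[R]_3) : `|x *m A| <= L * `|x|.
Proof. by have := ab_lip B x 0; rewrite XA subr0. Qed.

Lemma fundamental_bound (d : 'rV[R]_3) t : 0 <= t <= T + k -> `|d *m E t| <= C0 * `|d|.
Proof.
move=> /andP[t0 tT].
have := @gronwall R 3 (fun t => d *m E t) (fun t => d *m E t *m A) 0 t L 0 t0 (ab_L0 B) (lexx _).
rewrite E0 mulmx1 subr0 addr0 => H; apply: le_trans (H _ _ _) _.
- by apply: derivable_within_continuous => u _; case: (dE d u).
- by move=> u _; rewrite addr0.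
- rewrite ler_wpM2r// /C0 /gconst ler_wpM2l// ler_expR; apply: ler_pM => //.
  + by have := ab_L0 B; lra.
  + by have := ab_L0 B; lra.
Qed.

(** The bound is relative to [`|q - p|], which is what a contraction estimate
    needs: the two arcs follow the linearization along [gam] up to
    [d + eps] times their distance, and both the hitting times and the velocities
    at the hits differ by a multiple of it. *)
Lemma landing_linearized : exists2 C, 0 <= C & forall eps F d p q phi psi tau sig,
  near_field X gam T k r m eps F -> 0 <= d -> C0 * (d + eps) < r ->
  arc_start gam T k d 0 p -> arc_start gam T k d 0 q ->
  is_arc F gam T k r 0 p phi tau -> is_arc F gam T k r 0 q psi sig ->
  `|psi sig - phi tau - proj_along (X (gam T)) ((q - p) *m E T)| <=
    C * (d + eps) * `|q - p|.
Proof.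
have [G G0 [Gs Gl]] := gam_speed.
have m0 := ab_m0 B; have k0 := ab_k0 B; have L0 := ab_L0 B.
pose P := 1 + `|X (gam T)| / m.
have P0 : 0 <= P by rewrite addr_ge0// divr_ge0// ltW.
pose C1 := 1 + L * C0 + L * G * (C0 / m).
have C10 : 0 <= C1 by rewrite !addr_ge0// !mulr_ge0// ?invr_ge0 ltW.
pose C := P * (C1 * (C0 / m)) + P * (C0 * C0 + L * C0 * (C0 / m)).
have C'0 : 0 <= C by rewrite addr_ge0// ?mulr_ge0// ?addr_ge0// ?mulr_ge0// ?invr_ge0 ltW.
exists C => // eps F d p q phi psi tau sig N d0 Cr sp sq A1 A2.
have e0 := nf_eps0 N.
have de0 : 0 <= d + eps by rewrite addr_ge0.
have [_ pd _] := sp; have [_ qd _] := sq.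
have /andP[t1 t2] := arc_tau A1; have /andP[s1 s2] := arc_tau A2.
have hitT x f s : arc_start gam T k d 0 x -> is_arc F gam T k r 0 x f s ->
    `|s - T| <= C0 / m * (d + eps).
  move=> sx Ax; have := arc_hit_near B N Cr sx Ax (ltW T0).
  have [_ xd _] := sx.
  rewrite -/C0 mulrC -ler_pdivlMr// => H; apply: le_trans H _.
  rewrite [leRHS]mulrAC ler_wpM2r ?invr_ge0 ?(ltW m0)// ler_wpM2l// lerD2r//.
have hT1 := hitT _ _ _ sp A1; have hT2 := hitT _ _ _ sq A2.
have wm : zc (X (gam T)) <= - m.
  apply: (@le_trans _ _ (- (2 * m))); last by lra.
  by apply: (ab_down B (t := T)); [lra|rewrite subrr normr0 ltW// (ab_r0 B)].
have velF u : Num.min tau sig <= u <= Num.max tau sig ->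
    `|F (psi u) - X (gam T)| <= C1 * (d + eps).
  move=> /andP[u1 u2].
  have u0 : 0 <= u <= T + k.
    rewrite (le_trans _ u1) ?le_min ?(ltW t1) ?(ltW s1)//=.
    by rewrite (le_trans u2)// ge_max !ltW.
  have uT : `|u - T| <= C0 / m * (d + eps).
    move: hT1 hT2; rewrite !ler_norml => /andP[a1 a2] /andP[a3 a4].
    apply/andP; split.
      by move: u1; case: (leP tau sig) => _ h; lra.
    by move: u2; case: (leP tau sig) => _ h; lra.
  have nu := arc_near B N Cr sq A2 u0.
  have nu' : `|psi u - gam u| <= C0 * (d + eps) by apply: le_trans nu _; rewrite ler_wpM2l// lerD2r.
  have psr : `|psi u - gam u| <= r by exact/ltW/(arc_tube A2).
  have [_ FXu _] := nf_close N u0 psr.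
  rewrite -(subrKA (X (psi u))); apply: le_trans (ler_normD _ _) _.
  rewrite /C1 mulrDl mulrDl mul1r -addrA lerD//; first by apply: le_trans FXu _; rewrite lerDr.
  rewrite -(subrKA (X (gam u))); apply: le_trans (ler_normD _ _) _; rewrite lerD//.
    by apply: le_trans (ab_lip B _ _) _; rewrite -mulrA ler_wpM2l.
  apply: le_trans (ab_lip B _ _) _.
  have -> : L * G * (C0 / m) * (d + eps) = L * (G * (C0 / m * (d + eps))) by ring.
  rewrite ler_wpM2l//.
  apply: le_trans (Gl _ _ _ u0) _; first by rewrite (ltW T0) lerDl ltW.
  by rewrite ler_wpM2l.
have Cde : 0 <= C1 * (d + eps) by rewrite mulr_ge0.
have H1 := hit_linearized (lexx 0) N A1 A2 wm Cde velF.
have hd := hit_time_dist B N (lexx 0) A2 A1.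
have hd' : `|sig - tau| <= C0 / m * `|q - p|.
  by rewrite mulrAC ler_pdivlMr// mulrC.
have tauI : 0 <= tau <= T + k by rewrite !ltW.
have dist s : 0 <= s <= tau -> `|psi s - phi s| <= C0 * `|q - p|.
  move=> /andP[s3 s4]; apply: (arc_dist B N (lexx 0) A2 A1).
  by rewrite s3 (le_trans s4)// ltW.
have sub F' f : solution F' 0 (T + k) f -> solution F' 0 tau f.
  by move=> sol s /andP[h1 h2]; apply: sol; rewrite h1 (le_trans h2)// ltW.
have H2 : `|psi tau - phi tau - (q - p) *m E tau| <= C0 * (eps * (C0 * `|q - p|)).
  have HL := @solution_linearized R 3 F (fun=> A) phi psi (fun t => (q - p) *m E t) 0 tau eps
     (C0 * `|q - p|) L (ltW t1) e0 (mulr_ge0 C00 (normr_ge0 _)) L0 (sub _ _ (arc_sol A1)) (sub _ _ (arc_sol A2)).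
  apply: le_trans (HL _ _ _ _ _) _.
  - by move=> s x _; exact: AL.
  - move=> s /andP[s3 s4]; rewrite -XA.
    have sI : 0 <= s <= T + k by rewrite s3 (le_trans s4)// ltW.
    have r1 : `|psi s - gam s| <= r by apply/ltW/(arc_tube A2).
    have r2 : `|phi s - gam s| <= r by apply/ltW/(arc_tube A1).
    have [_ _ /(_ _ r2)] := nf_close N sI r1.
    by congr (`|_| <= _); apply/rowP => j; rewrite !mxE; ring.
  - exact: dist.
  - by rewrite E0 mulmx1 (arc0 A1) (arc0 A2).
  rewrite subr0 ler_wpM2r ?mulr_ge0// /C0 /gconst ler_wpM2l// ler_expR; apply: ler_pM => //.
  + by lra.
  + by apply: ltW.
  + by lra.
  + by apply: ltW.
have H3 : `|(q - p) *m E tau - (q - p) *m E T| <= L * C0 * (C0 / m) * (d + eps) * `|q - p|.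
  have solE : forall s, 0 <= s <= T + k -> is_derive s 1 (fun t => (q - p) *m E t) ((fun x => x *m A) ((q - p) *m E s)).
    by move=> s _; exact: dE.
  have := @solution_mvt (fun x => x *m A) 0 (T + k) (fun t => (q - p) *m E t) 0 (L * (C0 * `|q - p|)) T tau solE.
  rewrite (ltW T0) lerDl (ltW k0) tauI => /(_ isT isT).
  rewrite scaler0 subr0 => H; apply: le_trans (H _) _.
    move=> u /andP[u1 u2]; rewrite subr0; apply: le_trans (AL _) _; rewrite ler_wpM2l//.
    apply: fundamental_bound; rewrite (le_trans _ u1) ?le_min ?(ltW T0) ?(ltW t1)//=.
    by rewrite (le_trans u2)// ge_max lerDl (ltW k0) ltW.
  have := mulr_ge0 L0 (mulr_ge0 C00 (normr_ge0 (q - p))) => h0.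
  apply: le_trans (ler_wpM2l h0 hT1) _; rewrite le_eqVlt; apply/orP; left; apply/eqP; ring.
rewrite -(subrKA (proj_along (X (gam T)) (psi tau - phi tau))).
apply: le_trans (ler_normD _ _) _; rewrite -proj_alongB.
have -> : C * (d + eps) * `|q - p| = P * (C1 * (d + eps) * (C0 / m * `|q - p|)) +
   P * ((C0 * C0 + L * C0 * (C0 / m)) * (d + eps) * `|q - p|) by rewrite /C; ring.
rewrite lerD//.
  by apply: le_trans H1 _; rewrite -/P ler_wpM2l// ler_wpM2l.
apply: le_trans (proj_along_le _ m0 wm) _; rewrite -/P ler_wpM2l//.
rewrite -(subrKA ((q - p) *m E tau)); apply: le_trans (ler_normD _ _) _.
rewrite mulrDl mulrDl lerD//; apply: le_trans H2 _.
have -> : C0 * (eps * (C0 * `|q - p|)) = C0 * C0 * `|q - p| * eps by ring.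
by rewrite [leRHS]mulrAC ler_wpM2l ?mulr_ge0// lerDr.
Qed.

Lemma landing_near : exists2 C, 0 <= C & forall eps F d t0 p phi tau,
  near_field X gam T k r m eps F -> C0 * (d + eps) < r ->
  arc_start gam T k d t0 p -> t0 <= T -> is_arc F gam T k r t0 p phi tau ->
  `|phi tau - gam T| <= C * (`|p - gam t0| + eps).
Proof.
have [G G0 [Gs Gl]] := gam_speed.
have m0 := ab_m0 B; have k0 := ab_k0 B.
exists (C0 + G * (C0 / m)) => [|eps F d t0 p phi tau N Cr sp t0T A1].
  by rewrite addr_ge0// !mulr_ge0// invr_ge0 ltW.
have /andP[t1 t2] := arc_tau A1.
have t00 : 0 <= t0 by case: sp => /andP[].
have := arc_hit_near B N Cr sp A1 t0T; rewrite -/C0 mulrC -ler_pdivlMr// => hT.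
have near := arc_near B N Cr sp A1 (t := tau); rewrite (ltW t1) (ltW t2) in near.
rewrite -(subrKA (gam tau)); apply: le_trans (ler_normD _ _) _.
rewrite mulrDl lerD//; first exact: near.
apply: le_trans (Gl _ _ _ _) _.
- by rewrite (ltW T0) lerDl ltW.
- by rewrite (le_trans t00 (ltW t1)) ltW.
by rewrite -mulrA ler_wpM2l// mulrAC.
Qed.

End HalfMap.

Section Differentiability.
Variable R : realType.

Lemma differentiable_near (V W : normedModType R) (f : V -> W) a (df : {linear V -> W}) :
  continuous df ->
  (forall e, 0 < e -> \forall h \near (0 : V), `|f (h + a) - (f a + df h)| <= e * `|h|) ->
  differentiable f a.
Proof.
move=> dfc H.
have Ho : f \o shift a = cst (f a) + df +o_ 0 id.
  by apply/eqaddoP => e e0; have := H e e0.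
have dE := diff_unique dfc Ho.
by apply/diff_locallyP; rewrite dE.
Qed.

Lemma differentiable_est n k (f : 'rV[R]_n -> 'rV[R]_k) a (M : 'M[R]_(n, k)) :
  (forall e, 0 < e -> exists2 d, 0 < d & forall x, `|x - a| <= d ->
     `|f x - f a - (x - a) *m M| <= e * `|x - a|) ->
  differentiable f a.
Proof.
move=> H.
have Mc : continuous (mulmxr M : 'rV[R]_n -> 'rV[R]_k).
  move=> x; apply/(@cvgrPdist_le _ _ _ _ (nbhs_filter x)) => e e0.
  have M0 : 0 < n%:R * `|M| + 1 by rewrite ltr_wpDl// mulr_ge0.
  near=> y; rewrite /= -mulmxBl; apply: le_trans (norm_mulmx_le _ _) _.
  apply: (@le_trans _ _ ((n%:R * `|M| + 1) * `|x - y|)); first by rewrite ler_wpM2r// lerDl.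
  rewrite -ler_pdivlMl// mulrC; near: y.
  have /(@cvgrPdist_le _ _ _ _ (nbhs_filter x)) := @cvg_id _ (nbhs x); apply; exact: divr_gt0.
apply: (@differentiable_near _ _ f a (mulmxr M)) => // e e0; have [d d0 Hd] := H e e0.
have : \forall h \near (0 : 'rV[R]_n), `|h| < d.
  have := @nbhsx_ballx _ 'rV[R]_n 0 d d0; rewrite -ball_normE /ball_/=.
  by apply: filterS => h /=; rewrite sub0r normrN.
apply: filterS => h hd /=.
have := Hd (h + a); rewrite addrK => /(_ (ltW hd)).
by rewrite opprD addrA.
Unshelve. all: by end_near. Qed.

Lemma jacobianE n k (f : 'rV[R]_n -> 'rV[R]_k) p v : 'd f p v = v *m jacobian f p.
Proof. by rewrite /jacobian mul_rV_lin1. Qed.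

Lemma proj_along_mx (w : 'rV[R]_3) : exists P : 'M[R]_3, forall v, proj_along w v = v *m P.
Proof.
exists (1%:M - (zc w)^-1 *: ((delta_mx (inord 2) 0 : 'cV[R]_3) *m w)) => v.
rewrite mulmxBr mulmx1 -scalemxAr mulmxA -colE.
have -> : col (inord 2) v = (zc v)%:M.
  by apply/matrixP => i j; rewrite !ord1 !mxE.
by rewrite mul_scalar_mx scalerA /proj_along mulrC.
Qed.

Definition smooth_field (gam : R -> 'rV[R]_3) (T k r L : R) (F : 'rV[R]_3 -> 'rV[R]_3) :=
  forall t, 0 <= t <= T + k -> forall p, `|p - gam t| <= r ->
  [/\ differentiable F p, {for p, continuous (jacobian F)} &
      forall v, `|'d F p v| <= (L + 1) * `|v|].

(** Heine-Cantor along a compact piece of a curve, for the points around it. *)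
Lemma uniform_along (a b : R) (phi : R -> 'rV[R]_3) (J : 'rV[R]_3 -> 'M[R]_3) :
  (forall t, a <= t <= b -> {for t, continuous phi}) ->
  (forall t, a <= t <= b -> {for (phi t), continuous J}) ->
  forall e, 0 < e -> exists2 d, 0 < d & forall t x, a <= t <= b -> `|x - phi t| <= d ->
    `|J x - J (phi t)| <= e.
Proof.
move=> phic Jc e e0.
have /compact_near_coveringP cpt : compact `[a, b] by exact: segment_compact.
pose P (d : R) (t : R) := forall x, `|x - phi t| <= d -> `|J x - J (phi t)| <= e.
have e2 : 0 < e / 2 by rewrite divr_gt0.
have [|d /= d0 Hd] := cpt R (0 : R)^'+ P _.
  move=> t /=; rewrite in_itv/= => tab.
  have /(@cvgrPdist_le _ _ _ _ (nbhs_filter (phi t)))/(_ _ e2) := Jc t tab.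
  rewrite -nbhs_ballE => -[d d0]; rewrite -ball_normE => Hd.
  have d2 : 0 < d / 2 by rewrite divr_gt0.
  have /(@cvgrPdist_lt _ _ _ _ (nbhs_filter t))/(_ _ d2) Hphi := phic t tab.
  exists ([set s | `|phi t - phi s| < d / 2], [set i | i < d / 2]); first split => //=.
    by exists (d / 2) => //= i; rewrite /= sub0r normrN => + i0; rewrite gtr0_norm.
  move=> [s i] /= [s1 i1] x xs.
  have xd : `|phi t - x| < d.
    rewrite -(subrKA (phi s)); apply: le_lt_trans (ler_normD _ _) _.
    rewrite [d]splitr ltrD// distrC; exact: le_lt_trans i1.
  have sd : `|phi t - phi s| < d by apply: lt_trans s1 _; rewrite gtr_pMr// invf_lt1// ltr1n.
  rewrite -(subrKA (J (phi t))); apply: le_trans (ler_normD _ _) _.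
  by rewrite [leRHS]splitr lerD//; [rewrite distrC|]; apply: Hd.
have d2 : 0 < d / 2 by rewrite divr_gt0.
exists (d / 2) => // t x tab xt.
have := Hd (d / 2); rewrite /= sub0r normrN gtr0_norm// => /(_ _ d2 t); apply => //.
  by rewrite gtr_pMr// invf_lt1// ltr1n.
Qed.

Variables (X : 'rV[R]_3 -> 'rV[R]_3) (L : R) (gam : R -> 'rV[R]_3) (T k r m eps : R).
Hypothesis B : arc_base X L gam T k r m.
Variable F : 'rV[R]_3 -> 'rV[R]_3.
Hypotheses (N : near_field X gam T k r m eps F) (SF : smooth_field gam T k r L F).

Let C0 := gconst 3 (L + 1) (T + k).

(** The landing point of an arc is differentiable in the starting point: the
    displacement of the arc follows the variational equation. *)
Lemma landing_differentiable p phi tau :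
  is_arc F gam T k r 0 p phi tau ->
  (exists2 r', r' < r & forall t, 0 <= t <= T + k -> `|phi t - gam t| <= r') ->
  exists M : 'M[R]_3, forall e, 0 < e -> exists2 d, 0 < d &
    forall q psi sig, `|q - p| <= d -> is_arc F gam T k r 0 q psi sig ->
    `|psi sig - phi tau - (q - p) *m M| <= e * `|q - p|.
Proof.
move=> A1 [r' r'r near].
have m0 := ab_m0 B; have k0 := ab_k0 B; have kT := ab_kT B; have L0 := ab_L0 B.
have Tk : 0 <= T + k by lra.
have C01 : 1 <= C0 by apply: gconst_ge1 => //; rewrite addr_ge0.
have C00 : 0 < C0 by apply: lt_le_trans C01.
have L1 : 0 < L + 1 by rewrite ltr_wpDl.
have /andP[t1 t2] := arc_tau A1; have tl := arc_late A1.
have tauI : 0 <= tau <= T + k by rewrite !ltW.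
pose c (t : R) := Num.max 0 (Num.min (T + k) t).
have cI t : 0 <= c t <= T + k by rewrite /c le_max lexx/= ge_max Tk ge_min lexx.
have cid t : 0 <= t <= T + k -> c t = t.
  by move=> /andP[h1 h2]; rewrite /c (min_idPr h2) (max_idPr h1).
have cc : continuous c.
  move=> t; rewrite /c; apply: continuous_max; first exact: cst_continuous.
  by apply: continuous_min; [exact: cst_continuous|exact: cvg_id].
have phic t : 0 <= t <= T + k -> {for t, continuous phi}.
  by move=> /(arc_sol A1) [+ _]; move=> /derivable1_diffP/differentiable_continuous.
have tube t : 0 <= t <= T + k -> `|phi t - gam t| <= r by move=> /(arc_tube A1)/ltW.
pose A t := jacobian F (phi (c t)).
have AC t (x : 'rV[R]_3) : `|x *m A t| <= (L + 1) * `|x|.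
  by rewrite /A -jacobianE; have [_ _] := SF (cI t) (tube _ (cI t)).
have Ac : continuous A.
  move=> t; apply: (@continuous_comp _ _ _ (phi \o c) (jacobian F)).
    by apply: continuous_comp; [exact: cc|exact: phic].
  by have [] := SF (cI t) (tube _ (cI t)).
have [E [E0 dE]] := fundamental_matrix 0 (ltW L1) AC Ac.
have [Pm PmE] := proj_along_mx (F (phi tau)).
exists (E tau *m Pm) => e e0.
have wm : zc (F (phi tau)) <= - m.
  by apply: (field_down B N (t := tau)); [rewrite !ltW|exact: tube].
pose P := 1 + `|F (phi tau)| / m.
have P0 : 0 <= P by rewrite addr_ge0// divr_ge0// ltW.
pose K := P * (C0 / m + C0 * C0).
have K0 : 0 <= K by rewrite mulr_ge0// addr_ge0// ?divr_ge0// ?mulr_ge0// ltW.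
have K1 : 0 < K + 1 by rewrite ltr_wpDl.
pose e1 := e / (K + 1).
have e10 : 0 < e1 by rewrite divr_gt0.
have e12 : 0 < e1 / 2 by rewrite divr_gt0.
have e13 : 0 < e1 / 3 by rewrite divr_gt0.
have [d1 d10 Hd1] := @uniform_along 0 (T + k) phi (jacobian F) phic
  (fun t tI => let: And3 _ h _ := SF tI (tube t tI) in h) _ e13.
have Fphic : {for tau, continuous (F \o phi)}.
  apply: continuous_comp; first exact: phic.
  by have [/differentiable_continuous] := SF tauI (tube _ tauI).
have /(@cvgrPdist_le _ _ _ _ (nbhs_filter tau))/(_ _ e12) := Fphic.
move=> -[d2 /= d20 Hd2].
pose D := Num.min (Num.min (d1 / C0) ((r - r') / C0)) (Num.min (e1 / 2 / ((L + 1) * C0)) (d2 / 2 / (C0 / m))).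
have Cm : 0 < C0 / m by rewrite divr_gt0.
have LC : 0 < (L + 1) * C0 by rewrite mulr_gt0.
exists D.
  by rewrite !lt_min !divr_gt0// subr_gt0.
move=> q psi sig; rewrite !le_min => /andP[/andP[q1 q2] /andP[q3 q4]] A2.
rewrite ler_pdivlMr// in q1; rewrite ler_pdivlMr// in q2.
rewrite ler_pdivlMr// in q3; rewrite ler_pdivlMr// in q4.
have /andP[s1 s2] := arc_tau A2.
have hd := hit_time_dist B N (lexx 0) A2 A1.
have hd' : `|sig - tau| <= C0 / m * `|q - p|.
  by rewrite mulrAC ler_pdivlMr// mulrC.
have dist s : 0 <= s <= T + k -> `|psi s - phi s| <= C0 * `|q - p|.
  exact: (arc_dist B N (lexx 0) A2 A1).
have velF u : Num.min tau sig <= u <= Num.max tau sig -> `|F (psi u) - F (phi tau)| <= e1.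
  move=> /andP[u1 u2].
  have u0 : 0 <= u <= T + k.
    rewrite (le_trans _ u1) ?le_min ?(ltW t1) ?(ltW s1)//=.
    by rewrite (le_trans u2)// ge_max !ltW.
  have uT : `|u - tau| <= `|sig - tau|.
    have [h|/ltW h] := leP tau sig.
      by move: u1 u2; rewrite (min_idPl h) (max_idPr h) => ? ?; rewrite !ger0_norm; lra.
    by move: u1 u2; rewrite (min_idPr h) (max_idPl h) => ? ?; rewrite !ler0_norm; lra.
  rewrite -(subrKA (F (phi u))); apply: le_trans (ler_normD _ _) _.
  rewrite [leRHS]splitr lerD//.
    have psr : `|psi u - gam u| <= r by exact/ltW/(arc_tube A2).
    have e01 : 0 <= eps <= 1 by rewrite (nf_eps0 N) (nf_eps1 N).
    have H := tube_lipschitz (ab_lip B) e01 (nf_close N) u0 psr (tube u u0).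
    apply: le_trans H _.
    apply: le_trans q3; rewrite [leRHS]mulrC -[leRHS]mulrA ler_wpM2l ?(ltW L1)//; exact: dist.
  rewrite distrC; apply: Hd2; rewrite /= distrC.
  apply: le_lt_trans uT _; apply: le_lt_trans hd' _; rewrite mulrC.
  by apply: le_lt_trans q4 _; rewrite gtr_pMr// invf_lt1// ltr1n.
have H1 := hit_linearized B (lexx 0) N A1 A2 wm (ltW e10) velF.
have sub f : solution F 0 (T + k) f -> solution F 0 tau f.
  by move=> sol s /andP[h1 h2]; apply: sol; rewrite h1 (le_trans h2)// ltW.
have H2 : `|psi tau - phi tau - (q - p) *m E tau| <= C0 * (e1 * (C0 * `|q - p|)).
  have HL := @solution_linearized R 3 F A phi psi (fun t => (q - p) *m E t) 0 tau e1
     (C0 * `|q - p|) (L + 1) (ltW t1) (ltW e10) (mulr_ge0 (ltW C00) (normr_ge0 _)) (ltW L1)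
     (sub _ (arc_sol A1)) (sub _ (arc_sol A2)).
  apply: le_trans (HL _ _ _ _ _) _.
  - by move=> s x _; exact: AC.
  - move=> s /andP[s3 s4].
    have sI : 0 <= s <= T + k by rewrite s3 (le_trans s4)// ltW.
    have dr : C0 * `|q - p| <= r - r' by rewrite mulrC.
    have ball_r x : `|x - phi s| <= C0 * `|q - p| -> `|x - gam s| <= r.
      move=> xs; rewrite -(subrKA (phi s)); apply: le_trans (ler_normD _ _) _.
      by apply: le_trans (lerD (le_trans xs dr) (near s sI)) _; rewrite subrK.
    apply: (@diff_close_ball R 3 3 F (A s) (phi s) (C0 * `|q - p|) e1).
    + by move=> x /ball_r xr; have [] := SF sI xr.
    + move=> x v xs; rewrite jacobianE /A (cid s sI) -mulmxBr.
      apply: le_trans (norm_mulmx_le _ _) _; rewrite ler_wpM2r//.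
      rewrite -ler_pdivlMl// mulrC; apply: Hd1 => //.
      by apply: le_trans xs _; rewrite mulrC.
    + exact: dist.
    + by rewrite subrr normr0 mulr_ge0// ltW.
  - by move=> s /andP[s3 s4]; apply: dist; rewrite s3 (le_trans s4)// ltW.
  - by rewrite E0 mulmx1 (arc0 A1) (arc0 A2).
  have hC : gconst 3 (L + 1) (tau - 0) <= C0.
    by rewrite subr0; apply: gconst_mono; exact: ltW.
  have h0 : 0 <= e1 * (C0 * `|q - p|) by rewrite mulr_ge0 ?(ltW e10)// mulr_ge0// ltW.
  exact: ler_wpM2r h0 _ _ hC.
rewrite mulmxA -PmE.
rewrite -(subrKA (proj_along (F (phi tau)) (psi tau - phi tau))).
apply: le_trans (ler_normD _ _) _; rewrite -proj_alongB.
apply: (@le_trans _ _ (K * e1 * `|q - p|)); last first.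
  rewrite ler_wpM2r// /e1 mulrCA ger_pMr// ler_pdivrMr// mul1r; lra.
have -> : K * e1 * `|q - p| = P * (e1 * (C0 / m * `|q - p|)) +
   P * (C0 * (e1 * (C0 * `|q - p|))) by rewrite /K; ring.
rewrite lerD//.
  by apply: le_trans H1 _; rewrite -/P ler_wpM2l// ler_wpM2l// ltW.
by apply: le_trans (proj_along_le _ m0 wm) _; rewrite -/P ler_wpM2l.
Qed.

End Differentiability.

(** * Trajectories of piecewise systems *)

Section RealInduction.
Variable R : realType.

(** Continuous induction: solutions are compared on a time interval whose end
    is not known beforehand, because the tube may be left. *)
Lemma real_induction (P : R -> Prop) (a b : R) : a <= b -> P a ->
  (forall t, a <= t < b -> (forall u, a <= u <= t -> P u) ->
     exists2 h, 0 < h & forall u, t < u <= t + h -> u <= b -> P u) ->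
  (forall t, a < t <= b -> (forall u, a <= u < t -> P u) -> P t) ->
  forall t, a <= t <= b -> P t.
Proof.
move=> ab Pa Hs Hl.
pose A := [set t : R | a <= t <= b /\ forall u, a <= u <= t -> P u].
have Aa : A a.
  by split=> [|u /andP[u1 u2]]; [rewrite lexx|have -> : u = a by apply/eqP; rewrite eq_le u1 u2].
have hsA : has_sup A by split; [exists a|exists b => t [/andP[]]].
pose s := sup A.
have as_ : a <= s by apply: ub_le_sup => //; case: hsA.
have sb : s <= b by apply: ge_sup; [exists a|move=> t [/andP[]]].
have below u : a <= u < s -> P u.
  move=> /andP[au us]; have [t At ut] := sup_gt (ex_intro _ a Aa) us.
  by case: At => _; apply; rewrite au ltW.
have Ps : P s.
  case: (ltgtP a s) as_ => // [as_ _|<- //].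
  by apply: Hl; rewrite ?as_ ?sb.
have Pse u : a <= u <= s -> P u.
  by move=> /andP[au]; rewrite le_eqVlt => /predU1P[->//|us]; apply: below; rewrite au.
move=> t /andP[at_ tb]; have [ts|st] := leP t s; first by apply: Pse; rewrite at_.
have sb' : s < b := lt_le_trans st tb.
have [|h h0 Hh] := Hs s _ Pse; first by rewrite as_.
pose v := Num.min (s + h) b.
have sv : s < v by rewrite lt_min ltrDl h0 sb'.
have Av : A v.
  split; first by rewrite (le_trans as_ (ltW sv)) ge_min lexx orbT.
  move=> u /andP[au uv]; have [us|su] := leP u s; first by apply: Pse; rewrite au.
  apply: Hh; first by rewrite su (le_trans uv)// ge_min lexx.
  by rewrite (le_trans uv)// ge_min lexx orbT.
have := ub_le_sup (proj2 hsA) Av; rewrite -/s => vs.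
by have := lt_le_trans sv vs; rewrite ltxx.
Qed.

End RealInduction.

Section OneSided.
Variable R : realType.
Implicit Types (phi : R -> 'rV[R]_3) (t e : R) (v : 'rV[R]_3).

Lemma right_derivP phi t v : right_deriv phi t v <->
  forall e, 0 < e -> exists2 d, 0 < d & forall h, 0 < h -> h < d ->
    `|phi (t + h) - phi t - h *: v| <= e * h.
Proof.
have key h : 0 < h -> `|v - h^-1 *: (phi (t + h) - phi t)| * h = `|phi (t + h) - phi t - h *: v|.
  move=> h0; rewrite [LHS]mulrC -[X in X * _ = _](gtr0_norm h0) -normrZ scalerBr scalerA.
  by rewrite divff ?gt_eqF// scale1r distrC.
split.
  move=> /(@cvgrPdist_le _ _ _ _ (within_filter _ (nbhs_filter _))) H e e0.
  have [d /= d0 Hd] := H e e0; exists d => // h h0 hd; rewrite -key// ler_wpM2r ?(ltW h0)//.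
  by apply: Hd => //=; rewrite sub0r normrN gtr0_norm.
move=> H; apply/(@cvgrPdist_le _ _ _ _ (within_filter _ (nbhs_filter _))) => e e0.
have [d d0 Hd] := H e e0; exists d => //= h; rewrite /= sub0r normrN => hd h0.
rewrite -(ler_pM2r h0) key//; apply: Hd => //; move: hd; by rewrite gtr0_norm.
Qed.

Lemma left_derivP phi t v : left_deriv phi t v <->
  forall e, 0 < e -> exists2 d, 0 < d & forall h, 0 < h -> h < d ->
    `|phi (t - h) - phi t + h *: v| <= e * h.
Proof.
have key h : 0 < h -> `|v - (- h)^-1 *: (phi (t - h) - phi t)| * h = `|phi (t - h) - phi t + h *: v|.
  move=> h0; rewrite [LHS]mulrC -[X in X * _ = _](gtr0_norm h0) -normrZ invrN scaleNr opprK scalerDr.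
  by rewrite scalerA divff ?gt_eqF// scale1r addrC.
split.
  move=> /(@cvgrPdist_le _ _ _ _ (within_filter _ (nbhs_filter _))) H e e0.
  have [d /= d0 Hd] := H e e0; exists d => // h h0 hd; rewrite -key// ler_wpM2r ?(ltW h0)//.
  by apply: Hd => //=; [rewrite sub0r normrN normrN gtr0_norm|rewrite oppr_lt0].
move=> H; apply/(@cvgrPdist_le _ _ _ _ (within_filter _ (nbhs_filter _))) => e e0.
have [d d0 Hd] := H e e0; exists d => //= h; rewrite /= sub0r normrN => hd h0.
have h0' : 0 < - h by rewrite oppr_gt0.
have := key _ h0'; rewrite !opprK => Hk.
rewrite -(ler_pM2r h0') Hk; have := Hd (- h); rewrite opprK; apply => //.
by move: hd; rewrite ltr0_norm.
Qed.

Lemma is_derive_est (f : R -> 'rV[R]_3) t v : is_derive t 1 f v ->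
  forall e, 0 < e -> exists2 d, 0 < d & forall h, `|h| < d ->
    `|f (t + h) - f t - h *: v| <= e * `|h|.
Proof.
move=> [df <-] e e0; move: df; rewrite /derivable => df.
have /(@cvgrPdist_le _ _ _ _ (dnbhs_filter _))/(_ _ e0) := df.
move=> -[d /= d0 Hd]; exists d => // h hd.
have [->|h0] := eqVneq h 0; first by rewrite addr0 subrr scale0r subr0 !normr0 mulr0.
have := Hd h; rewrite /= sub0r normrN => /(_ hd h0).
rewrite -(ler_pM2l (x := `|h|)) ?normr_gt0// -normrZ scalerBr scalerA divff// scale1r distrC.
by rewrite [h *: 1]mulr1 [h + t]addrC mulrC.
Qed.

Lemma is_derive_right phi t v : is_derive t 1 phi v -> right_deriv phi t v.
Proof.
move=> /is_derive_est H; apply/right_derivP => e e0.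
have [d d0 Hd] := H e e0; exists d => // h h0 hd.
by have := Hd h; rewrite gtr0_norm// => /(_ hd).
Qed.

Lemma is_derive_left phi t v : is_derive t 1 phi v -> left_deriv phi t v.
Proof.
move=> /is_derive_est H; apply/left_derivP => e e0.
have [d d0 Hd] := H e e0; exists d => // h h0 hd.
have := Hd (- h); rewrite normrN gtr0_norm// => /(_ hd).
by rewrite scaleNr opprK.
Qed.

Lemma two_sided_derive phi t v : left_deriv phi t v -> right_deriv phi t v ->
  is_derive t 1 phi v.
Proof.
move=> /left_derivP Hl /right_derivP Hr; apply: is_deriveP => e e0.
have [d1 d10 H1] := Hl e e0; have [d2 d20 H2] := Hr e e0.
exists (Num.min d1 d2) => [|h]; first by rewrite lt_min d10.
rewrite lt_min => /andP[h1 h2]; have [h0|h0|->] := ltgtP h 0.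
- rewrite ltr0_norm// in h1 *; have := H1 (- h); rewrite oppr_gt0 => /(_ h0 h1).
  by rewrite opprK scaleNr.
- by rewrite gtr0_norm// in h2 *; exact: H2.
- by rewrite addr0 subrr scale0r subr0 !normr0 mulr0.
Qed.

Lemma right_deriv_cont phi t v : right_deriv phi t v ->
  forall e, 0 < e -> exists2 d, 0 < d & forall h, 0 < h -> h < d -> `|phi (t + h) - phi t| < e.
Proof.
move=> /right_derivP H e e0; have [d d0 Hd] := H 1 ltr01.
have v1 : 0 < `|v| + 2 by rewrite ltr_wpDl.
exists (Num.min d (e / (`|v| + 2))) => [|h h0]; first by rewrite lt_min d0 divr_gt0.
rewrite lt_min ltr_pdivlMr// => /andP[hd he]; apply: le_lt_trans he.
rewrite -[phi (t + h) - phi t](subrK (h *: v)); apply: le_trans (ler_normD _ _) _.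
by have := Hd h h0 hd; rewrite normrZ (gtr0_norm h0); nra.
Qed.

Lemma left_deriv_cont phi t v : left_deriv phi t v ->
  forall e, 0 < e -> exists2 d, 0 < d & forall h, 0 < h -> h < d -> `|phi (t - h) - phi t| < e.
Proof.
move=> /left_derivP H e e0; have [d d0 Hd] := H 1 ltr01.
have v1 : 0 < `|v| + 2 by rewrite ltr_wpDl.
exists (Num.min d (e / (`|v| + 2))) => [|h h0]; first by rewrite lt_min d0 divr_gt0.
rewrite lt_min ltr_pdivlMr// => /andP[hd he]; apply: le_lt_trans he.
rewrite -[phi (t - h) - phi t](addrK (h *: v)); apply: le_trans (ler_normB _ _) _.
by have := Hd h h0 hd; rewrite normrZ (gtr0_norm h0); nra.
Qed.

End OneSided.

Section Trajectories.
Variable R : realType.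
Implicit Types (Z : pwsys R) (J : set R) (phi psi : R -> 'rV[R]_3) (t a b : R).

Lemma trajectory_sub Z J J' phi : J' `<=` J -> trajectory Z J phi -> trajectory Z J' phi.
Proof.
move=> JJ H t J't; have [h1 h2 h3 h4] := H t (JJ _ J't); split => //.
- by move=> [s /JJ Js ts]; apply: h3; exists s.
- by move=> [s /JJ Js ts]; apply: h4; exists s.
Qed.

Lemma trajectory_shift Z J phi c : trajectory Z J phi ->
  trajectory Z [set t | J (t - c)] (fun t => phi (t - c)).
Proof.
move=> H t /= Jt; have [h1 h2 h3 h4] := H _ Jt; split => //.
- move=> [s Js ts]; have /right_derivP Hd : right_deriv phi (t - c) (vel_out Z (phi (t - c))).
    by apply: h3; exists (s - c) => //; rewrite ltrD2r.
  apply/right_derivP => e e0; have [d d0 Hd'] := Hd e e0; exists d => // h h0 hd.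
  by have := Hd' h h0 hd; rewrite (_ : t - c + h = t + h - c)// addrAC.
- move=> [s Js ts]; have /left_derivP Hd : left_deriv phi (t - c) (vel_in Z (phi (t - c))).
    by apply: h4; exists (s - c) => //; rewrite ltrD2r.
  apply/left_derivP => e e0; have [d d0 Hd'] := Hd e e0; exists d => // h h0 hd.
  by have := Hd' h h0 hd; rewrite (_ : t - c - h = t - h - c)// addrAC.
Qed.

Lemma trajectory_right Z a b phi t : trajectory Z `[a, b]%classic phi -> a <= t < b ->
  right_deriv phi t (vel_out Z (phi t)).
Proof.
move=> H /andP[at_ tb]; have [|_ _ h _] := H t; first by rewrite /= in_itv/= at_ ltW.
by apply: h; exists b => //; rewrite /= in_itv/= lexx andbT (le_trans at_)// ltW.
Qed.

Lemma trajectory_left Z a b phi t : trajectory Z `[a, b]%classic phi -> a < t <= b ->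
  left_deriv phi t (vel_in Z (phi t)).
Proof.
move=> H /andP[at_ tb]; have [|_ _ _ h] := H t; first by rewrite /= in_itv/= ltW.
by apply: h; exists a => //; rewrite /= in_itv/= lexx/= (le_trans (ltW at_)).
Qed.

Lemma trajectory_above Z a b phi t : trajectory Z `[a, b]%classic phi -> a < t < b ->
  0 < zc (phi t) -> is_derive t 1 phi (upper Z (phi t)).
Proof.
move=> H /andP[at_ tb] z0.
have := trajectory_right H (t := t); rewrite (ltW at_) tb /vel_out z0/= => /(_ isT) h1.
have := trajectory_left H (t := t); rewrite at_ (ltW tb) /vel_in z0/= => /(_ isT) h2.
exact: two_sided_derive.
Qed.

Lemma trajectory_within Z a b c d phi : trajectory Z `[a, b]%classic phi ->
  a <= c -> c < d -> d <= b -> {within `[c, d], continuous phi}.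
Proof.
move=> H ac cd db.
have rc t : a <= t < b -> forall e, 0 < e -> exists2 d, 0 < d & forall h, 0 < h -> h < d -> `|phi (t + h) - phi t| < e.
  by move=> tI; apply: right_deriv_cont (trajectory_right H tI).
have lc t : a < t <= b -> forall e, 0 < e -> exists2 d, 0 < d & forall h, 0 < h -> h < d -> `|phi (t - h) - phi t| < e.
  by move=> tI; apply: left_deriv_cont (trajectory_left H tI).
have rcv t : a <= t < b -> phi x @[x --> t^'+] --> phi t.
  move=> tI; apply/(@cvgrPdist_le _ _ _ _ (within_filter _ (nbhs_filter _))) => e e0.
  have [d1 d10 H1] := rc t tI e e0; exists d1 => //= x xd tx.
  rewrite distrC; apply: ltW; have := H1 (x - t).
  rewrite (_ : t + (x - t) = x); last by rewrite addrC subrK.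
  by rewrite subr_gt0 => /(_ tx); apply; move: xd; rewrite /= distrC gtr0_norm ?subr_gt0.
have lcv t : a < t <= b -> phi x @[x --> t^'-] --> phi t.
  move=> tI; apply/(@cvgrPdist_le _ _ _ _ (within_filter _ (nbhs_filter _))) => e e0.
  have [d1 d10 H1] := lc t tI e e0; exists d1 => //= x xd tx.
  rewrite distrC ltW//; have := H1 (t - x); rewrite subr_gt0 => /(_ tx).
  by rewrite subKr; apply; move: xd; rewrite /= gtr0_norm ?subr_gt0.
apply/continuous_within_itvP => //; split.
- move=> t; rewrite in_itv/= => /andP[ct td].
  apply/left_right_continuousP; split.
    by apply: lcv; rewrite (le_lt_trans ac ct) (le_trans (ltW td)).
  by apply: rcv; rewrite (le_trans ac (ltW ct)) (lt_le_trans td).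
- by apply: rcv; rewrite ac (lt_le_trans cd).
- by apply: lcv; rewrite db (le_lt_trans ac).
Qed.

Lemma solution_trajectory Z a b phi : a < b -> solution (upper Z) a b phi ->
  (forall t, a <= t <= b -> dom Z (phi t)) ->
  (forall t, a < t < b -> 0 < zc (phi t)) ->
  0 < zc (phi a) \/ (crossing Z (phi a) /\ 0 < lief (upper Z) (phi a)) ->
  0 < zc (phi b) \/ (crossing Z (phi b) /\ lief (upper Z) (phi b) < 0) ->
  trajectory Z `[a, b]%classic phi.
Proof.
move=> ab sol domP pos Ha Hb t; rewrite /= in_itv/= => /andP[at_ tb].
have dphi : is_derive t 1 phi (upper Z (phi t)) by apply: sol; rewrite at_.
split.
- by apply: domP; rewrite at_.
- rewrite /Sigma/= => z0.
  have [ta|ta] := eqVneq t a; first by case: Ha => [|[]]; rewrite -ta// z0 ltxx.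
  have [tb'|tb'] := eqVneq t b; first by case: Hb => [|[]]; rewrite -tb'// z0 ltxx.
  have := pos t; rewrite !lt_neqAle at_ tb tb' eq_sym ta/= => /(_ isT).
  by rewrite z0 eqxx.
- move=> [s]; rewrite /= in_itv/= => /andP[_ sb] ts.
  rewrite (_ : vel_out _ _ = upper Z (phi t)); first exact: is_derive_right.
  rewrite /vel_out; have [ta|ta] := eqVneq t a.
    by case: Ha => [z0|[[z0 _] l0]]; rewrite ta; rewrite /Sigma/= in z0; rewrite z0// eqxx l0 orbT.
  by rewrite pos// lt_neqAle eq_sym ta at_ (lt_le_trans ts).
- move=> [s]; rewrite /= in_itv/= => /andP[as_ _] ts.
  rewrite (_ : vel_in _ _ = upper Z (phi t)); first exact: is_derive_left.
  rewrite /vel_in; have [tb'|tb'] := eqVneq t b.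
    by case: Hb => [z0|[[z0 _] l0]]; rewrite tb'; rewrite /Sigma/= in z0; rewrite z0// eqxx l0 orbT.
  by rewrite pos// [t < b]lt_neqAle tb' tb (le_lt_trans as_).
Qed.

End Trajectories.

Section ArcUniqueness.
Variable R : realType.
Variables (X : 'rV[R]_3 -> 'rV[R]_3) (L : R) (gam : R -> 'rV[R]_3) (T k r m eps : R).
Hypothesis B : arc_base X L gam T k r m.
Variable Z : pwsys R.
Hypothesis N : near_field X gam T k r m eps (upper Z).

(** A trajectory that starts together with an arc follows it until the arc
    reaches the plane: they agree as long as both are above the plane and in
    the tube, and this can be prolonged by Gronwall's inequality. *)
Lemma trajectory_follows_arc t0 p phi tau psi s1 : 0 <= t0 -> t0 <= s1 ->
  is_arc (upper Z) gam T k r t0 p phi tau ->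
  0 < zc p \/ zc p = 0 /\ 0 < lief (upper Z) p ->
  trajectory Z `[t0, s1]%classic psi -> psi t0 = p ->
  forall t, t0 <= t -> t <= s1 -> t <= tau -> psi t = phi t.
Proof.
move=> t00 t0s A zp tr psi0 t t0t ts ttau.
have /andP[tau1 tau2] := arc_tau A.
have L0 := ab_L0 B.
have Tk : 0 <= T + k by apply: (le_trans t00); apply: ltW; apply: lt_trans tau2.
pose e := Num.min s1 tau.
have es : e <= s1 by rewrite /e ge_min lexx.
have etau : e <= tau by rewrite /e ge_min lexx orbT.
have t0e : t0 <= e by rewrite /e le_min t0s ltW.
have phic u : t0 <= u <= T + k -> {for u, continuous phi}.
  by move=> /(arc_sol A) [+ _]; move=> /derivable1_diffP/differentiable_continuous.
apply: (real_induction (P := fun u => psi u = phi u) t0e); last by rewrite t0t le_min ts ttau.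
- by rewrite psi0 (arc0 A).
- move=> u /andP[t0u ue] Hu.
  have psiu : psi u = phi u by apply: Hu; rewrite t0u lexx.
  have us : u < s1 := lt_le_trans ue es.
  have utau : u < tau := lt_le_trans ue etau.
  have uI : t0 <= u <= T + k by rewrite t0u (le_trans (ltW utau) (ltW tau2)).
  have rd : right_deriv psi u (vel_out Z (psi u)) by apply: (trajectory_right tr); rewrite t0u us.
  have [d1 d10 H1] : exists2 d, 0 < d & forall h, 0 < h -> h < d -> 0 < zc (psi (u + h)).
    have [z0|z0] := ltP 0 (zc (psi u)).
      have [d d0 Hd] := right_deriv_cont rd z0; exists d => // h h0 hd.
      have := le_lt_trans (zc_norm _) (Hd h h0 hd); rewrite zcB ltr_norml => /andP[+ _]; lra.
    have ut0 : u = t0.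
      apply/eqP; rewrite eq_le t0u andbT leNgt; apply/negP => t0u'.
      by move: z0; rewrite psiu leNgt (arc_pos A)// t0u'.
    have [z1 z2] : zc p = 0 /\ 0 < lief (upper Z) p.
      by case: zp => // zp; move: z0; rewrite ut0 psi0 leNgt zp.
    have vu : vel_out Z (psi u) = upper Z p.
      by rewrite ut0 psi0 /vel_out z1 eqxx ltxx z2.
    have z22 : 0 < lief (upper Z) p / 2 by rewrite divr_gt0.
    move: rd; rewrite vu => /right_derivP/(_ _ z22) [d d0 Hd]; exists d => // h h0 hd.
    have := le_trans (zc_norm _) (Hd h h0 hd); rewrite !zcB zcZ ut0 psi0 z1 subr0.
    rewrite ler_norml => /andP[+ _]; rewrite /lief in z2 *.
    by have := mulr_gt0 h0 z2; lra.
  have rr : 0 < (r - `|phi u - gam u|) / 2 by rewrite divr_gt0// subr_gt0 (arc_tube A).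
  have [d2 d20 H2] := right_deriv_cont rd rr.
  have gr := right_deriv_cont (is_derive_right (ab_gam B u)).
  have [d3 d30 H3] := gr _ rr.
  pose d := Num.min (Num.min d1 d2) d3.
  have d0 : 0 < d by rewrite !lt_min d10 d20.
  have dd1 : d <= d1 by rewrite /d !ge_min lexx.
  have dd2 : d <= d2 by rewrite /d !ge_min lexx !orbT.
  have dd3 : d <= d3 by rewrite /d !ge_min lexx !orbT.
  exists (d / 2); first by rewrite divr_gt0.
  have d2d : d / 2 < d by rewrite gtr_pMr// invf_lt1// ltr1n.
  move=> w /andP[uw wd] we.
  have near x : u < x < w -> 0 < zc (psi x) /\ `|psi x - gam x| <= r.
    move=> /andP[ux xw]; have x0 : 0 < x - u by rewrite subr_gt0.
    have xd : x - u < d by rewrite ltrBlDl (lt_trans xw)// (le_lt_trans wd)// ltrD2l.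
    have e1 : u + (x - u) = x by rewrite addrC subrK.
    have := H1 _ x0 (lt_le_trans xd dd1); rewrite e1 => ->; split=> //.
    have h2 := H2 _ x0 (lt_le_trans xd dd2); have h3 := H3 _ x0 (lt_le_trans xd dd3).
    rewrite e1 psiu in h2; rewrite e1 in h3.
    have -> : psi x - gam x = (psi x - phi u) + ((phi u - gam u) - (gam x - gam u)).
      by apply/rowP => j; rewrite !mxE; ring.
    have := ler_normD (psi x - phi u) ((phi u - gam u) - (gam x - gam u)).
    by have := ler_normB (phi u - gam u) (gam x - gam u); lra.
  have wT : w <= T + k by rewrite (le_trans we)// (le_trans etau)// ltW.
  have := @tube_solution_dist R 3 X L gam (T + k) r eps L0 (ab_lip B) _ (upper Z) u phi psi w (nf_close N)
    (le_trans t00 t0u) (ltW uw) wT.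
  rewrite (nf_eps0 N) (nf_eps1 N) psiu subrr normr0 mulr0 normr_le0 subr_eq0.
  move=> H; apply/esym/eqP; apply: H => //.
  + by apply: (solution_within (arc_sol A)).
  + by apply: (trajectory_within tr) => //; exact: le_trans we es.
  + move=> x /andP[ux xw]; apply: (arc_sol A).
    by rewrite (le_trans t0u (ltW ux)) (le_trans (ltW xw)).
  + move=> x xI; apply: (trajectory_above tr); last by case: (near x xI).
    by case/andP: xI => ux xw; rewrite (le_lt_trans t0u ux) (lt_le_trans xw) // (le_trans we).
  + move=> x /andP[ux xw]; apply/ltW/(arc_tube A).
    by rewrite (le_trans t0u (ltW ux)) (le_trans (ltW xw)).
  + by move=> x xI; case: (near x xI).
- move=> u /andP[t0u ue] Hu; apply/subr0_eq/normr0_eq0/eqP; rewrite eq_le normr_ge0 andbT.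
  apply/ler_addgt0Pr => x x0; rewrite add0r.
  have x2 : 0 < x / 2 by rewrite divr_gt0.
  have uI : t0 <= u <= T + k by rewrite (ltW t0u) (le_trans ue (le_trans etau (ltW tau2))).
  have ld : left_deriv psi u (vel_in Z (psi u)).
    by apply: (trajectory_left tr); rewrite t0u (le_trans ue).
  have [d1 d10 H1] := left_deriv_cont ld x2.
  have [d2 d20 H2] := left_deriv_cont (is_derive_left (arc_sol A uI)) x2.
  pose h := Num.min (Num.min d1 d2) (u - t0) / 2.
  have h'0 : 0 < Num.min (Num.min d1 d2) (u - t0) by rewrite !lt_min d10 d20 subr_gt0.
  have h0 : 0 < h by rewrite divr_gt0.
  have hh : h < Num.min (Num.min d1 d2) (u - t0) by rewrite gtr_pMr// invf_lt1// ltr1n.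
  move: hh; rewrite !lt_min => /andP[/andP[h1 h2] h3].
  have k1 := H1 h h0 h1; have k2 := H2 h h0 h2.
  rewrite (Hu (u - h)) in k1; last by rewrite lerBrDl addrC -lerBrDl (ltW h3) ltrBlDr ltrDl.
  have -> : psi u - phi u = (phi (u - h) - phi u) - (phi (u - h) - psi u).
    by apply/rowP => j; rewrite !mxE; ring.
  by apply: le_trans (ler_normB _ _) _; lra.
Qed.

End ArcUniqueness.

(** * The symmetry exchanging the two sides *)

Section Symmetry.
Variable R : realType.
Implicit Types (p q v : 'rV[R]_3) (Z : pwsys R) (phi : R -> 'rV[R]_3).
Local Notation S := (@canonS R).

Lemma vec3_inj p q : xc p = xc q -> yc p = yc q -> zc p = zc q -> p = q.
Proof.
move=> hx hy hz; apply/rowP => -[[|[|[|//]]] i].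
- by move: hx; rewrite /xc (_ : inord 0 = Ordinal i)//; apply/val_inj; rewrite /= inordK.
- by move: hy; rewrite /yc (_ : inord 1 = Ordinal i)//; apply/val_inj; rewrite /= inordK.
- by move: hz; rewrite /zc (_ : inord 2 = Ordinal i)//; apply/val_inj; rewrite /= inordK.
Qed.

Lemma xcB p q : xc (p - q) = xc p - xc q. Proof. by rewrite /xc !mxE. Qed.
Lemma ycB p q : yc (p - q) = yc p - yc q. Proof. by rewrite /yc !mxE. Qed.
Lemma xcZ (a : R) p : xc (a *: p) = a * xc p. Proof. by rewrite /xc !mxE. Qed.
Lemma ycZ (a : R) p : yc (a *: p) = a * yc p. Proof. by rewrite /yc !mxE. Qed.
Lemma xcD p q : xc (p + q) = xc p + xc q. Proof. by rewrite /xc !mxE. Qed.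
Lemma ycD p q : yc (p + q) = yc p + yc q. Proof. by rewrite /yc !mxE. Qed.

Lemma canonS_x p : xc (S p) = - yc p. Proof. exact: xc_vec3. Qed.
Lemma canonS_y p : yc (S p) = - xc p. Proof. exact: yc_vec3. Qed.
Lemma canonS_z p : zc (S p) = - zc p. Proof. exact: zc_vec3. Qed.

Lemma canonSK : involutive S.
Proof. by move=> p; apply: vec3_inj; rewrite !(canonS_x, canonS_y, canonS_z) opprK. Qed.

Lemma canonSB p q : S (p - q) = S p - S q.
Proof.
by apply: vec3_inj; rewrite !(xcB, ycB, zcB) !(canonS_x, canonS_y, canonS_z) !(xcB, ycB, zcB) opprB addrC opprK.
Qed.

Lemma canonSD p q : S (p + q) = S p + S q.
Proof.
by apply: vec3_inj; rewrite !(xcD, ycD, zcD) !(canonS_x, canonS_y, canonS_z) !(xcD, ycD, zcD) opprD.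
Qed.

Lemma canonSZ (a : R) p : S (a *: p) = a *: S p.
Proof.
by apply: vec3_inj; rewrite !(xcZ, ycZ, zcZ) !(canonS_x, canonS_y, canonS_z) !(xcZ, ycZ, zcZ) mulrN.
Qed.

Lemma norm3_le p (e : R) : `|xc p| <= e -> `|yc p| <= e -> `|zc p| <= e -> `|p| <= e.
Proof.
move=> hx hy hz; apply: norm_rV_le; first exact: le_trans hx.
move=> -[[|[|[|//]]] i].
- by move: hx; rewrite /xc (_ : inord 0 = Ordinal i)//; apply/val_inj; rewrite /= inordK.
- by move: hy; rewrite /yc (_ : inord 1 = Ordinal i)//; apply/val_inj; rewrite /= inordK.
- by move: hz; rewrite /zc (_ : inord 2 = Ordinal i)//; apply/val_inj; rewrite /= inordK.
Qed.

Lemma canonS_norm p : `|S p| = `|p|.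
Proof.
have key q : `|S q| <= `|q|.
  by apply: norm3_le; rewrite ?canonS_x ?canonS_y ?canonS_z normrN; exact: coord_le_norm.
by apply/eqP; rewrite eq_le key -{1}[p]canonSK key.
Qed.

Lemma canonS_dist p q : `|S p - S q| = `|p - q|.
Proof. by rewrite -canonSB canonS_norm. Qed.

Lemma canonS_continuous : continuous S.
Proof.
move=> x; apply/(@cvgrPdist_le _ _ _ _ (nbhs_filter x)) => e e0; near=> y.
rewrite canonS_dist; near: y.
by have /(@cvgrPdist_le _ _ _ _ (nbhs_filter x)) := @cvg_id _ (nbhs x); apply.
Unshelve. all: by end_near. Qed.

Definition conjZ Z : pwsys R :=
  PwSys (S @^-1` dom Z) (S \o lower Z \o S) (S \o upper Z \o S).

Lemma conjZK Z : conjZ (conjZ Z) = Z.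
Proof.
case: Z => D U V; rewrite /conjZ /=; congr PwSys.
- by apply/funext => p; rewrite /preimage/= canonSK.
- by apply/funext => p; rewrite /= !canonSK.
- by apply/funext => p; rewrite /= !canonSK.
Qed.

Lemma crossing_conj Z p : crossing Z p -> crossing (conjZ Z) (S p).
Proof.
rewrite /crossing /Sigma/= => -[z0 h]; split; first by rewrite canonS_z z0 oppr0.
by rewrite /lief/= !canonSK !canonS_z mulrNN mulrC.
Qed.

Lemma right_deriv_S phi (t : R) v : right_deriv phi t v -> right_deriv (S \o phi) t (S v).
Proof.
move=> /right_derivP H; apply/right_derivP => e e0; have [d d0 Hd] := H e e0.
by exists d => // h h0 hd; rewrite /= -!canonSB -canonSZ -canonSB canonS_norm; exact: Hd.
Qed.

Lemma left_deriv_S phi (t : R) v : left_deriv phi t v -> left_deriv (S \o phi) t (S v).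
Proof.
move=> /left_derivP H; apply/left_derivP => e e0; have [d d0 Hd] := H e e0.
by exists d => // h h0 hd; rewrite /= -!canonSB -canonSZ -canonSD canonS_norm; exact: Hd.
Qed.

Lemma vel_out_conj Z p : (Sigma p -> crossing Z p) -> vel_out (conjZ Z) (S p) = S (vel_out Z p).
Proof.
move=> H; rewrite /vel_out canonS_z /= /lief/= !canonSK canonS_z oppr_eq0 oppr_gt0.
have [z0|z0|z0] := ltgtP (zc p) 0; rewrite //=.
have [_] := H z0; rewrite /lief oppr_gt0.
case: (ltP 0 (zc (upper Z p))) => h1 h2; first by rewrite ifF// ltNge -(pmulr_rge0 _ h1) (ltW h2).
rewrite ifT//; rewrite ltNge; apply/negP => h3; move: h2; rewrite ltNge => /negP; apply.
exact: mulr_le0_ge0.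
Qed.

Lemma vel_in_conj Z p : (Sigma p -> crossing Z p) -> vel_in (conjZ Z) (S p) = S (vel_in Z p).
Proof.
move=> H; rewrite /vel_in canonS_z /= /lief/= !canonSK canonS_z oppr_eq0 oppr_gt0.
have [z0|z0|z0] := ltgtP (zc p) 0; rewrite //=.
have [_] := H z0; rewrite /lief oppr_lt0.
case: (ltP (zc (upper Z p)) 0) => h1 h2.
  by rewrite ifF//; apply/negbTE; rewrite -leNgt; move: h2; rewrite nmulr_rgt0// => /ltW.
have U0 : 0 < zc (upper Z p).
  by rewrite lt_neqAle h1 andbT eq_sym; apply/eqP => e; move: h2; rewrite e mul0r ltxx.
by rewrite ifT// -(pmulr_rgt0 _ U0).
Qed.

Lemma trajectory_conj Z J phi : trajectory Z J phi -> trajectory (conjZ Z) J (S \o phi).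
Proof.
move=> H t Jt; have [h1 h2 h3 h4] := H t Jt; split => /=.
- by rewrite canonSK.
- by rewrite /Sigma/= canonS_z => /eqP; rewrite oppr_eq0 => /eqP /h2; exact: crossing_conj.
- by move=> /h3; rewrite vel_out_conj//; exact: right_deriv_S.
- by move=> /h4; rewrite vel_in_conj//; exact: left_deriv_S.
Qed.

Lemma forward_conj Z p phi : forward_trajectory Z p phi ->
  forward_trajectory (conjZ Z) (S p) (S \o phi).
Proof. by move=> [h1 h2]; split; [exact: trajectory_conj|rewrite /= h2]. Qed.

Lemma forward_shift Z p phi c : 0 <= c -> forward_trajectory Z p phi ->
  forward_trajectory Z (phi c) (fun t => phi (t + c)).
Proof.
move=> c0 [h1 h2]; split; last by rewrite add0r.
have h3 := trajectory_shift (c := - c) h1; rewrite opprK in h3.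
by apply: trajectory_sub h3 => t; rewrite /= !in_itv/= !andbT => t0; rewrite addr_ge0.
Qed.

End Symmetry.

Section Glue.
Variable R : realType.
Implicit Types (phi psi : R -> 'rV[R]_3) (Z : pwsys R).

Lemma right_deriv_ext phi psi (t d : R) v : 0 < d -> (forall s, t <= s <= t + d -> phi s = psi s) ->
  right_deriv phi t v -> right_deriv psi t v.
Proof.
move=> d0 H /right_derivP Hp; apply/right_derivP => e e0; have [d1 d10 Hd] := Hp e e0.
exists (Num.min d d1) => [|h h0]; first by rewrite lt_min d0.
rewrite lt_min => /andP[h1 h2]; rewrite -!H; first exact: Hd.
  by rewrite lexx lerDl ltW.
by rewrite lerDl (ltW h0) lerD2l ltW.
Qed.

Lemma left_deriv_ext phi psi (t d : R) v : 0 < d -> (forall s, t - d <= s <= t -> phi s = psi s) ->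
  left_deriv phi t v -> left_deriv psi t v.
Proof.
move=> d0 H /left_derivP Hp; apply/left_derivP => e e0; have [d1 d10 Hd] := Hp e e0.
exists (Num.min d d1) => [|h h0]; first by rewrite lt_min d0.
rewrite lt_min => /andP[h1 h2]; rewrite -!H; first exact: Hd.
  by rewrite lexx andbT lerBlDr lerDl ltW.
by rewrite lerD2l lerN2 (ltW h1) lerBlDr lerDl ltW.
Qed.

Variables (a : nat -> R) (c : R) (f : nat -> R -> 'rV[R]_3).
Hypotheses (a0 : a 0%N = 0) (c0 : 0 < c) (aS : forall i, a i + c <= a i.+1).

Lemma glue_mono i j : (i <= j)%N -> a i <= a j.
Proof.
elim: j => [|j IH]; first by rewrite leqn0 => /eqP ->.
rewrite leq_eqVlt => /predU1P[->//|]; rewrite ltnS => /IH h.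
by apply: le_trans h (le_trans _ (aS j)); rewrite lerDl ltW.
Qed.

Lemma glue_lower i : i%:R * c <= a i.
Proof.
elim: i => [|i IH]; first by rewrite mul0r a0.
by apply: le_trans (aS i); rewrite -natr1 mulrDl mul1r lerD2r.
Qed.

Lemma glue_index t : 0 <= t -> exists i, a i <= t < a i.+1.
Proof.
move=> t0; have exb : exists n, t < a n.
  exists (Num.bound (t / c)); apply: lt_le_trans (glue_lower _).
  by rewrite -ltr_pdivrMr//; apply: archi_boundP; rewrite divr_ge0// ltW.
case: (ex_minnP exb) => -[|n] tn Hn; first by move: tn; rewrite a0 ltNge t0.
by exists n; rewrite tn andbT leNgt; apply/negP => /Hn; rewrite ltnn.
Qed.

Hypothesis fS : forall i, f i (a i.+1) = f i.+1 (a i.+1).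

(** Every piece lasts at least [c], hence they exhaust the half-line. *)
Lemma glue : exists psi, forall i t, a i <= t <= a i.+1 -> psi t = f i t.
Proof.
pose psi t := f (get [set i | a i <= t < a i.+1]) t.
exists psi => i t /andP[t1 t2].
have it : a i < a i.+1 by apply: lt_le_trans (aS i); rewrite ltrDl.
have uniq j j' : a j <= t < a j.+1 -> a j' <= t < a j'.+1 -> (j <= j')%N.
  move=> /andP[h1 h2] /andP[h3 h4]; rewrite leqNgt; apply/negP => jj.
  by have := le_lt_trans (le_trans (glue_mono jj) h1) h4; rewrite ltxx.
have eq_get j : a j <= t < a j.+1 -> get [set i | a i <= t < a i.+1] = j.
  move=> jt; case: xgetP => [x _ xt|/(_ j)//].
  by apply/eqP; rewrite eqn_leq !uniq.
have [ti|] := ltP t (a i.+1); first by rewrite /psi (eq_get i)// t1.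
move=> ti; have -> : t = a i.+1 by apply/eqP; rewrite eq_le t2.
rewrite /psi; case: xgetP => [x _ /andP[h1 h2]|/(_ i.+1)]; last first.
  by rewrite /= lexx (lt_le_trans _ (aS _))// ltrDl.
have xi : x = i.+1.
  have h3 : (i.+1 <= x)%N.
    rewrite leqNgt ltnS; apply/negP => xi'.
    by have := le_lt_trans (glue_mono (xi' : (x.+1 <= i.+1)%N)) h2; rewrite ltxx.
  apply/eqP; rewrite eqn_leq h3 andbT leqNgt; apply/negP => h4.
  have := glue_mono h4; apply/negP; rewrite -ltNge.
  by apply: le_lt_trans h1 (lt_le_trans _ (aS _)); rewrite ltrDl.
by rewrite xi fS.
Qed.

Lemma glue_trajectory Z psi : (forall i t, a i <= t <= a i.+1 -> psi t = f i t) ->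
  (forall i, trajectory Z `[a i, a i.+1]%classic (f i)) ->
  trajectory Z `[0, +oo[%classic psi.
Proof.
move=> psiE tr t; rewrite /= in_itv/= andbT => t0.
have [i /andP[t1 t2]] := glue_index t0.
have ti : a i <= t <= a i.+1 by rewrite t1 ltW.
have [h1 h2 h3 h4] : [/\ dom Z (f i t), Sigma (f i t) -> crossing Z (f i t),
      (exists2 s, `[a i, a i.+1]%classic s & t < s) -> right_deriv (f i) t (vel_out Z (f i t)) &
      (exists2 s, `[a i, a i.+1]%classic s & s < t) -> left_deriv (f i) t (vel_in Z (f i t))].
  by apply: tr; rewrite /= in_itv.
split; rewrite ?(psiE i t)//.
- move=> _; apply: (@right_deriv_ext (f i) _ t (a i.+1 - t)); first by rewrite subr_gt0.
    by move=> s /andP[s1 s2]; rewrite (psiE i)// (le_trans t1 s1) (le_trans s2)// addrC subrK.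
  by apply: h3; exists (a i.+1) => //; rewrite /= in_itv/= lexx andbT (le_trans t1)// ltW.
- move=> [s]; rewrite /= in_itv/= andbT => s0 st.
  have [ait|] := ltP (a i) t.
    apply: (@left_deriv_ext (f i) _ t (t - a i)); first by rewrite subr_gt0.
      by move=> u; rewrite subKr => /andP[u1 u2]; rewrite (psiE i)// u1 (le_trans u2)// ltW.
    by apply: h4; exists (a i) => //; rewrite /= in_itv/= lexx/= (le_trans t1)// ltW.
  move=> tai; have ta : t = a i by apply/eqP; rewrite eq_le tai t1.
  case: i t1 t2 ti h1 h2 h3 h4 tai ta => [|i] t1 t2 ti h1 h2 h3 h4 tai ta.
    by move: st; rewrite ta a0 ltNge s0.
  rewrite ta -fS.
  have lt_i : a i < a i.+1 by apply: lt_le_trans (aS i); rewrite ltrDl.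
  apply: (@left_deriv_ext (f i) _ _ (a i.+1 - a i)); first by rewrite subr_gt0.
    by move=> u; rewrite subKr => u12; rewrite (psiE i).
  have [|_ _ _] := tr i (a i.+1); first by rewrite /= in_itv/= lexx ltW.
  by apply; exists (a i) => //; rewrite /= in_itv/= lexx ltW.
Qed.

End Glue.

Section Eigenvalue.
Variable R : realType.

(** An eigenvector for an eigenvalue of modulus one would not tend to zero
    under iteration, while its real and imaginary parts do. *)
Lemma contracting_eigenvalue n (J : 'M[R]_n) (nu : 'rV[R]_n -> R) (c th : R) :
  0 <= th -> th < 1 -> 0 < c -> (forall v, c * `|v| <= nu v) ->
  (forall v, nu (v *m J) <= th * nu v) ->
  forall l : R[i], eigenvalue (map_mx (real_complex R) J) l -> `|l| != 1.
Proof.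
move=> th0 th1 c0 nuc nuJ l /eigenvalueP[v vJ v0]; apply/eqP => l1.
have iter_nu w i : nu (iter i (mulmxr J) w) <= th ^+ i * nu w.
  elim: i => [|i IH]; first by rewrite mul1r.
  by rewrite iterS exprS -mulrA; apply: le_trans (nuJ _) _; rewrite ler_wpM2l.
pose a := map_mx (@complex.Re R) v; pose b := map_mx (@complex.Im R) v.
have vab : v = map_mx (real_complex R) a + 'i%C *: map_mx (real_complex R) b.
  by apply/rowP => j; rewrite !mxE; case: (v ord0 j) => x y; simpc.
have key i : l ^+ i *: v = map_mx (real_complex R) (iter i (mulmxr J) a) +
   'i%C *: map_mx (real_complex R) (iter i (mulmxr J) b).
  elim: i => [|i IH]; first by rewrite expr0 scale1r -vab.
  rewrite exprSr -scalerA -vJ scalemxAl IH mulmxDl -scalemxAl.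
  by rewrite -!map_mxM.
have [j vj] : exists j, v ord0 j != 0.
  apply/not_existsP => H; move/eqP: v0; apply; apply/rowP => j; rewrite mxE.
  by apply/eqP/negPn/negP; exact: H.
have vj0 : 0 < `|v ord0 j| by rewrite normr_gt0.
have norm_v i : `|v ord0 j| <= ((th ^+ i * ((nu a + nu b) / c))%:C)%C.
  have -> : `|v ord0 j| = `|(l ^+ i *: v) ord0 j|.
    by rewrite mxE normrM normrX l1 expr1n mul1r.
  rewrite key !mxE; apply: le_trans (ler_normD _ _) _.
  rewrite normrM (_ : `|'i%C| = 1 :> R[i]) ?mul1r; last first.
    by rewrite normc_def /= expr0n expr1n add0r sqrtr1.
  have nC (x : R) : `|x%:C%C| = (`|x|)%:C%C.
    by rewrite normc_def /= expr0n addr0 sqrtr_sqr.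
  rewrite !nC -rmorphD /= lecR mulrA mulrDr mulrDl lerD//.
    rewrite ler_pdivlMr// mulrC; apply: le_trans (iter_nu a i); apply: le_trans (nuc _).
    by rewrite ler_wpM2l ?(ltW c0)// coord_le_norm.
  rewrite ler_pdivlMr// mulrC; apply: le_trans (iter_nu b i); apply: le_trans (nuc _).
  by rewrite ler_wpM2l ?(ltW c0)// coord_le_norm.
have [x xE] : exists x : R, `|v ord0 j| = x%:C%C by rewrite normc_def; eexists.
have x0 : 0 < x by move: vj0; rewrite xE ltcR.
have [N /(_ _ (leqnn _))] := powers_small ((nu a + nu b) / c) th0 th1 x0.
by rewrite mulrC ltNge; move: (norm_v N); rewrite xE lecR => ->.
Qed.

End Eigenvalue.

(** * Dynamics near the symmetric cycle *)

Section Plane.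
Variable R : realType.
Implicit Types (u v : 'rV[R]_2) (p q : 'rV[R]_3).

Definition fromSigma p : 'rV[R]_2 := \row_j [:: xc p; yc p]`_j.

Lemma row2_inj u v : u ord0 (inord 0) = v ord0 (inord 0) ->
  u ord0 (inord 1) = v ord0 (inord 1) -> u = v.
Proof.
move=> h0 h1; apply/rowP => -[[|[|//]] i].
- by move: h0; rewrite (_ : inord 0 = Ordinal i)//; apply/val_inj; rewrite /= inordK.
- by move: h1; rewrite (_ : inord 1 = Ordinal i)//; apply/val_inj; rewrite /= inordK.
Qed.

Lemma toSigma_z u : zc (toSigma u) = 0. Proof. exact: zc_vec3. Qed.

Lemma toSigmaK u : fromSigma (toSigma u) = u.
Proof. by apply: row2_inj; rewrite /fromSigma mxE inordK//= ?xc_vec3 ?yc_vec3. Qed.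

Lemma fromSigmaK p : zc p = 0 -> toSigma (fromSigma p) = p.
Proof.
move=> z0; apply: vec3_inj; rewrite /toSigma ?xc_vec3 ?yc_vec3 ?zc_vec3 ?z0//.
  by rewrite mxE inordK.
by rewrite mxE inordK.
Qed.

Lemma toSigmaB u v : toSigma (u - v) = toSigma u - toSigma v.
Proof.
by apply: vec3_inj; rewrite ?(xcB, ycB, zcB) /toSigma ?xc_vec3 ?yc_vec3 ?zc_vec3 ?mxE ?subrr.
Qed.

Lemma fromSigmaB p q : fromSigma (p - q) = fromSigma p - fromSigma q.
Proof. by apply: row2_inj; rewrite !mxE inordK//= ?xcB ?ycB. Qed.

Lemma norm2_le u (e : R) : `|u ord0 (inord 0)| <= e -> `|u ord0 (inord 1)| <= e -> `|u| <= e.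
Proof.
move=> hx hy; apply: norm_rV_le; first exact: le_trans hx.
move=> -[[|[|//]] i].
- by move: hx; rewrite (_ : inord 0 = Ordinal i)//; apply/val_inj; rewrite /= inordK.
- by move: hy; rewrite (_ : inord 1 = Ordinal i)//; apply/val_inj; rewrite /= inordK.
Qed.

Lemma toSigma_norm u : `|toSigma u| = `|u|.
Proof.
apply/eqP; rewrite eq_le; apply/andP; split.
  apply: norm3_le; rewrite /toSigma ?xc_vec3 ?yc_vec3 ?zc_vec3 ?normr0 ?coord_le_norm//.
apply: norm2_le.
  by have := coord_le_norm (toSigma u) (inord 0); rewrite -/(xc _) xc_vec3.
by have := coord_le_norm (toSigma u) (inord 1); rewrite -/(yc _) yc_vec3.
Qed.

Lemma fromSigma_norm p : `|fromSigma p| <= `|p|.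
Proof. by apply: norm2_le; rewrite mxE inordK//=; exact: coord_le_norm. Qed.

Lemma toSigma_dist u v : `|toSigma u - toSigma v| = `|u - v|.
Proof. by rewrite -toSigmaB toSigma_norm. Qed.

End Plane.

(** The derivative of the half-return map at the cycle is a contraction in a
    suitable norm only; estimates in the plane of crossing points are made in it. *)
Record adapted_norm (R : realType) (N : 'rV[R]_2 -> R) (cN CN : R) : Prop := AdaptedNorm {
  an_tri : forall a b, N (a + b) <= N a + N b;
  an_hom : forall (h : R) a, N (h *: a) = `|h| * N a;
  an_c0 : 0 < cN;
  an_lower : forall v, cN * `|v| <= N v;
  an_upper : forall v, N v <= CN * `|v| }.

Section Dynamics.
Variable R : realType.
Implicit Types (Z : pwsys R) (F : 'rV[R]_3 -> 'rV[R]_3) (u v : 'rV[R]_2) (p q x : 'rV[R]_3).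
Implicit Types (phi psi : R -> 'rV[R]_3) (t s : R).
Local Notation S := (@canonS R).

Variables (X : 'rV[R]_3 -> 'rV[R]_3) (L : R) (gam : R -> 'rV[R]_3) (T k r m : R).
Hypothesis B : arc_base X L gam T k r m.
Variable u0 : 'rV[R]_2.
Hypotheses (gam0 : gam 0 = toSigma u0) (gamT : S (gam T) = gam 0).

(** Arcs with given starting point are unique up to their landing, so that the
    choice is immaterial. *)
Definition arc_pair F t0 p : (R -> 'rV[R]_3) * R :=
  get [set y | is_arc F gam T k r t0 p y.1 y.2].
Definition flow F t0 p := (arc_pair F t0 p).1.
Definition hit F t0 p := (arc_pair F t0 p).2.
(** Landing points are returned to the upper side by the symmetry, so that both
    half turns become maps of one section to itself. *)
Definition land F t0 p := fromSigma (S (flow F t0 p (hit F t0 p))).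
Definition halfmap F u := land F 0 (toSigma u).

(** The lower field is measured through the conjugate system: its arcs below
    the plane are arcs above the plane of [conjZ Z]. *)
Record near_system eps Z : Prop := NearSystem {
  ns_up : near_field X gam T k r m eps (upper Z);
  ns_low : near_field X gam T k r m eps (upper (conjZ Z));
  ns_smooth_up : smooth_field gam T k r L (upper Z);
  ns_smooth_low : smooth_field gam T k r L (upper (conjZ Z));
  ns_dom_up : forall t p, 0 <= t <= T + k -> `|p - gam t| <= r -> dom Z p;
  ns_dom_low : forall t p, 0 <= t <= T + k -> `|p - gam t| <= r -> dom (conjZ Z) p }.

Lemma near_system_conj eps Z : near_system eps Z -> near_system eps (conjZ Z).
Proof. by case=> *; split; rewrite ?conjZK. Qed.

Variables (N : 'rV[R]_2 -> R) (cN CN : R).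
Hypothesis AN : adapted_norm N cN CN.

Let C0 := gconst 3 (L + 1) (T + k).

Lemma an_opp v : N (- v) = N v.
Proof. by rewrite -scaleN1r (an_hom AN) normrN normr1 mul1r. Qed.

Lemma an_ge0 v : 0 <= N v.
Proof. by apply: le_trans (an_lower AN v); rewrite mulr_ge0// ltW// (an_c0 AN). Qed.

Lemma an_eq0 v : N v <= 0 -> v = 0.
Proof.
move=> h; apply/eqP; rewrite -normr_eq0 eq_le normr_ge0 andbT.
by have := le_trans (an_lower AN v) h; rewrite pmulr_rle0// (an_c0 AN).
Qed.

Lemma an_norm v : `|v| <= N v / cN.
Proof. by rewrite ler_pdivlMr ?(an_c0 AN)// mulrC (an_lower AN). Qed.

Lemma flow_spec eps d F t0 p : near_field X gam T k r m eps F -> C0 * (d + eps) < r ->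
  arc_start gam T k d t0 p -> is_arc F gam T k r t0 p (flow F t0 p) (hit F t0 p).
Proof.
move=> nF dr st; have [phi [tau [A _]]] := arc_exists B nF dr st.
by rewrite /flow /hit /arc_pair; case: xgetP => [[f t] _ //|/(_ (phi, tau))].
Qed.

(** [d] is the size of the section on which half-return maps are compared, [d1]
    a larger one for which arcs still exist; [rho] is the radius of an invariant
    [N]-ball, [sg] bounds the distance of the fixed points from the unperturbed
    one, and [dU] is the size of the tube of attraction. *)
Record small_data (eps d1 d rho sg dU th : R) : Prop := SmallData {
  sd_d0 : 0 < d;
  sd_dr : C0 * (d1 + eps) < r;
  sd_dd1 : C0 * (d + eps) < d1;
  sd_rho0 : 0 < rho;
  sd_rho : forall v, N v <= rho -> `|v| <= d;
  sd_th0 : 0 <= th;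
  sd_th1 : th < 1;
  sd_contr : forall F u v, near_field X gam T k r m eps F ->
    `|u - u0| <= d -> `|v - u0| <= d ->
    N (halfmap F u - halfmap F v) <= th * N (u - v);
  sd_sg0 : 0 <= sg;
  sd_sg : sg <= rho / 2;
  sd_self : forall F, near_field X gam T k r m eps F ->
    N (halfmap F u0 - u0) <= (1 - th) * sg;
  sd_dU0 : 0 < dU;
  sd_dUd : dU <= d;
  sd_U : forall F t0 p, near_field X gam T k r m eps F -> t0 <= T ->
    arc_start gam T k dU t0 p -> N (land F t0 p - u0) <= rho;
  sd_orbit : forall F u t, near_field X gam T k r m eps F -> N (u - u0) <= sg ->
    0 <= t <= hit F 0 (toSigma u) -> exists2 t0, 0 <= t0 <= T /\ (t = 0 -> t0 = 0) &
      `|flow F 0 (toSigma u) t - gam t0| <= dU }.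

Variables (eps d1 d rho sg dU th : R).
Hypothesis D : small_data eps d1 d rho sg dU th.

Let Tk : 0 < T - k.
Proof. have := ab_k0 B; have := ab_kT B; lra. Qed.
Let T0 : 0 < T.
Proof. have := ab_k0 B; have := ab_kT B; lra. Qed.
Let Tk0 : 0 < T + k.
Proof. have := ab_k0 B; have := ab_kT B; lra. Qed.

Lemma flowP F t0 p : near_field X gam T k r m eps F -> arc_start gam T k d1 t0 p ->
  is_arc F gam T k r t0 p (flow F t0 p) (hit F t0 p).
Proof. by move=> nF; exact: flow_spec nF (sd_dr D). Qed.

Lemma landE F t0 p : near_field X gam T k r m eps F -> arc_start gam T k d1 t0 p ->
  toSigma (land F t0 p) = S (flow F t0 p (hit F t0 p)).
Proof.
move=> nF st; rewrite fromSigmaK// canonS_z (arc_hit (flowP nF st)) oppr0 //.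
Qed.

Let C01 : 1 <= C0.
Proof. by apply: gconst_ge1; [rewrite addr_ge0// (ab_L0 B)|exact: ltW]. Qed.

Lemma plane_start u : `|u - u0| <= d1 -> arc_start gam T k d1 0 (toSigma u).
Proof.
move=> ud; split; first by rewrite lexx ltW.
  by rewrite gam0 toSigma_dist.
by right; rewrite toSigma_z.
Qed.

Lemma d1_le_r F : near_field X gam T k r m eps F -> d1 <= r.
Proof.
move=> nF; have e0 := nf_eps0 nF; have d0 := sd_d0 D.
have d10 : 0 <= d1.
  apply: le_trans (ltW (sd_dd1 D)); apply: mulr_ge0; first exact: le_trans ler01 C01.
  by rewrite addr_ge0// ltW.
apply: le_trans (ltW (sd_dr D)); apply: le_trans (_ : d1 + eps <= _); first by rewrite lerDl.
by rewrite ler_peMl// addr_ge0.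
Qed.

Lemma d_le_d1 F (x : R) : near_field X gam T k r m eps F -> x <= d -> x <= d1.
Proof.
move=> nF xd; have e0 := nf_eps0 nF; have d0 := sd_d0 D.
apply: le_trans xd (le_trans _ (ltW (sd_dd1 D))).
apply: le_trans (_ : d + eps <= _); first by rewrite lerDl.
by rewrite ler_peMl// addr_ge0// ltW.
Qed.

Lemma ball_start F u : near_field X gam T k r m eps F -> N (u - u0) <= rho -> arc_start gam T k d1 0 (toSigma u).
Proof. by move=> nF ur; apply/plane_start/(d_le_d1 nF)/(sd_rho D). Qed.

Lemma halfmap_center F u : near_field X gam T k r m eps F -> N (u - u0) <= rho ->
  N (halfmap F u - u0) <= th * N (u - u0) + (1 - th) * sg.
Proof.
move=> nF ur; have ud := sd_rho D ur.
have u0d : `|u0 - u0| <= d by rewrite subrr normr0 ltW// (sd_d0 D).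
have := an_tri AN (halfmap F u - halfmap F u0) (halfmap F u0 - u0); rewrite subrKA => h.
by apply: le_trans h _; rewrite lerD ?(sd_contr D)// (sd_self D).
Qed.

Lemma halfmap_ball F u : near_field X gam T k r m eps F -> N (u - u0) <= rho ->
  N (halfmap F u - u0) <= rho.
Proof.
move=> nF ur; apply: le_trans (halfmap_center nF ur) _.
have th1 := sd_th1 D; have th0 := sd_th0 D; have r0 := sd_rho0 D.
have h1 : th * N (u - u0) <= th * rho by rewrite ler_wpM2l.
have h2 : (1 - th) * sg <= (1 - th) * rho.
  by rewrite ler_wpM2l ?subr_ge0 ?(ltW th1)//; have := sd_sg D; lra.
by apply: le_trans (lerD h1 h2) _; rewrite -mulrDl addrC subrK mul1r.
Qed.

Lemma start_crossing Z u : near_system eps Z -> `|u - u0| <= d1 ->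
  crossing Z (toSigma u) /\ m <= lief (upper Z) (toSigma u).
Proof.
move=> nZ ud; have dr := d1_le_r (ns_up nZ).
have k0 := ab_k0 B; have m0 := ab_m0 B.
have h1 : m <= lief (upper Z) (toSigma u).
  by apply: (field_up B (ns_up nZ) (t := 0)); [rewrite lexx ltW|rewrite gam0 toSigma_dist (le_trans ud)].
have h2 : zc (upper (conjZ Z) (S (toSigma u))) <= - m.
  apply: (field_down B (ns_low nZ) (t := T)); first by lra.
  by rewrite -[gam T](canonSK) gamT canonS_dist gam0 toSigma_dist (le_trans ud).
split=> //; split; first exact: toSigma_z.
move: h2; rewrite /= canonSK canonS_z => h2.
rewrite mulr_gt0//; first exact: lt_le_trans h1.
by rewrite /lief; lra.
Qed.

Lemma land_crossing Z p u : near_system eps Z -> S p = toSigma u -> `|u - u0| <= d1 ->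
  crossing Z p /\ lief (upper Z) p <= - m.
Proof.
move=> nZ pu ud; have dr := d1_le_r (ns_up nZ).
have [c1 _] := start_crossing (near_system_conj nZ) ud.
split; first by have := crossing_conj c1; rewrite conjZK -pu canonSK.
have k0 := ab_k0 B; apply: (field_down B (ns_up nZ) (t := T)); first by lra.
by rewrite -canonS_dist gamT pu gam0 toSigma_dist (le_trans ud).
Qed.

Lemma start_side Z t0 p : near_system eps Z -> arc_start gam T k d1 t0 p ->
  0 < zc p \/ zc p = 0 /\ 0 < lief (upper Z) p.
Proof.
move=> nZ [_ pd [|[z0 t00]]]; first by left.
right; split=> //; move: pd; rewrite t00 gam0 -[p]fromSigmaK// toSigma_dist => ud.
have [_ h] := start_crossing nZ ud; exact: lt_le_trans (ab_m0 B) h.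
Qed.

Lemma arc_trajectory Z t0 p : near_system eps Z -> arc_start gam T k d1 t0 p ->
  N (land (upper Z) t0 p - u0) <= rho ->
  trajectory Z `[t0, hit (upper Z) t0 p]%classic (flow (upper Z) t0 p).
Proof.
move=> nZ st lr; have nF := ns_up nZ; have A := flowP nF st.
have /andP[t1 t2] := arc_tau A.
have t00 : 0 <= t0 by case: st => /andP[].
apply: solution_trajectory => //.
- by move=> t /andP[h1 h2]; apply: (arc_sol A); rewrite h1 (le_trans h2)// ltW.
- move=> t /andP[h1 h2]; apply: (ns_dom_up nZ (t := t)).
    by rewrite (le_trans t00 h1) (le_trans h2)// ltW.
  by apply/ltW/(arc_tube A); rewrite h1 (le_trans h2)// ltW.
- exact: (arc_pos A).
- rewrite (arc0 A); have [|[z0 l0]] := start_side nZ st; first by left.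
  right; split => //; case: st => _ pd [|[_ t0e]]; first by rewrite z0 ltxx.
  move: pd; rewrite t0e gam0 -[p]fromSigmaK// toSigma_dist => ud.
  by have [] := start_crossing nZ ud.
- right; have [] := land_crossing nZ (esym (landE nF st)) (d_le_d1 nF (sd_rho D lr)).
  by move=> c1 c2; split => //; apply: le_lt_trans c2 _; rewrite oppr_lt0 (ab_m0 B).
Qed.

Lemma forward_follows_arc Z t0 p phi tau psi : near_system eps Z -> 0 <= t0 ->
  is_arc (upper Z) gam T k r t0 p phi tau ->
  0 < zc p \/ zc p = 0 /\ 0 < lief (upper Z) p ->
  forward_trajectory Z p psi ->
  (forall t, t0 <= t <= tau -> psi (t - t0) = phi t) /\
  forward_trajectory (conjZ Z) (S (phi tau)) (fun t => S (psi (t + (tau - t0)))).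
Proof.
move=> nZ t00 A side fw; have /andP[t1 t2] := arc_tau A.
have tr : trajectory Z `[t0, tau]%classic (fun t => psi (t - t0)).
  apply: trajectory_sub (trajectory_shift (c := t0) fw.1) => t.
  by rewrite /= !in_itv/= andbT subr_ge0 => /andP[].
have key t : t0 <= t <= tau -> psi (t - t0) = phi t.
  move=> /andP[h1 h2].
  apply: (trajectory_follows_arc B (ns_up nZ) t00 (ltW t1) A side tr) => //.
  by rewrite subrr fw.2.
split=> //.
rewrite -key ?lexx ?(ltW t1)//.
have t10 : 0 <= tau - t0 by rewrite subr_ge0 ltW.
exact: forward_conj (forward_shift t10 fw).
Qed.

Lemma forward_follows Z t0 p psi : near_system eps Z -> arc_start gam T k d1 t0 p ->
  forward_trajectory Z p psi ->
  (forall t, t0 <= t <= hit (upper Z) t0 p -> psi (t - t0) = flow (upper Z) t0 p t) /\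
  forward_trajectory (conjZ Z) (toSigma (land (upper Z) t0 p))
    (fun t => S (psi (t + (hit (upper Z) t0 p - t0)))).
Proof.
move=> nZ st fw; have t00 : 0 <= t0 by case: st => /andP[].
rewrite (landE (ns_up nZ) st).
exact: (forward_follows_arc nZ t00 (flowP (ns_up nZ) st) (start_side nZ st) fw).
Qed.

Lemma iter_conj_trajectory n Z J phi :
  trajectory (iter n (@conjZ R) Z) J phi -> trajectory Z J (fun t => iter n S (phi t)).
Proof.
elim: n Z phi => [//|n IH] Z phi; rewrite iterSr => /IH /trajectory_conj; rewrite conjZK.
by apply: trajectory_sub.
Qed.

(** From every admissible start a trajectory exists for all times: arcs above
    and below the plane are concatenated, each being an arc above the plane of
    the original or of the conjugate system. *)
Lemma forward_exists Z t0 p : near_system eps Z -> arc_start gam T k d1 t0 p ->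
  N (land (upper Z) t0 p - u0) <= rho -> exists psi, forward_trajectory Z p psi.
Proof.
move=> nZ st lr.
pose Zn n := iter n (@conjZ R) Z.
have nZn n : near_system eps (Zn n) by elim: n => [//|n IH]; exact: near_system_conj.
pose fix state n : R * 'rV[R]_3 :=
  if n is n'.+1 then (0, toSigma (land (upper (Zn n')) (state n').1 (state n').2)) else (t0, p).
pose t_ n := (state n).1; pose p_ n := (state n).2.
pose hit_ n := hit (upper (Zn n)) (t_ n) (p_ n).
pose flow_ n := flow (upper (Zn n)) (t_ n) (p_ n).
have inv n : arc_start gam T k d1 (t_ n) (p_ n) /\ N (land (upper (Zn n)) (t_ n) (p_ n) - u0) <= rho.
  elim: n => [//|n [h1 h2]]; rewrite /t_ /p_ /=; split; first exact: (ball_start (ns_up (nZn n))).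
  exact: halfmap_ball (ns_up (nZn n.+1)) h2.
have A n : is_arc (upper (Zn n)) gam T k r (t_ n) (p_ n) (flow_ n) (hit_ n).
  by apply: flowP (ns_up (nZn n)) _; case: (inv n).
pose a n := \sum_(i < n) (hit_ i - t_ i).
have a0 : a 0%N = 0 by rewrite /a big_ord0.
have aSE n : a n.+1 = a n + (hit_ n - t_ n) by rewrite /a big_ord_recr.
pose c := Num.min (T - k) (hit_ 0%N - t_ 0%N).
have c0 : 0 < c by rewrite lt_min Tk subr_gt0; case/andP: (arc_tau (A 0%N)).
have aS n : a n + c <= a n.+1.
  rewrite aSE lerD2l /c; case: n => [|n]; first by rewrite ge_min lexx orbT.
  by rewrite ge_min [t_ n.+1]/= subr0 (ltW (arc_late (A n.+1))).
pose f n t := iter n S (flow_ n (t - a n + t_ n)).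
have fS n : f n (a n.+1) = f n.+1 (a n.+1).
  rewrite /f subrr iterSr; congr (iter n _ _).
  rewrite (_ : a n.+1 - a n + t_ n = hit_ n); last by rewrite aSE; ring.
  rewrite [flow_ n.+1 _](_ : _ = p_ n.+1); last by rewrite add0r (arc0 (A n.+1)).
  rewrite /p_ /= (landE (ns_up (nZn n))) ?canonSK//.
  by case: (inv n).
have [psi psiE] := glue c0 aS fS.
exists psi; split.
  apply: (glue_trajectory a0 c0 aS fS psiE) => n.
  apply: (@iter_conj_trajectory n Z _ (fun t => flow_ n (t - a n + t_ n))).
  have [h1 h2] := inv n.
  have tr := trajectory_shift (c := a n - t_ n) (arc_trajectory (nZn n) h1 h2).
  have eqf : (fun t => flow_ n (t - a n + t_ n)) = (fun t => flow_ n (t - (a n - t_ n))).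
    by apply/funext => t; rewrite opprB addrA addrAC.
  rewrite eqf; apply: trajectory_sub tr => t; rewrite /= !in_itv/= => /andP[h3 h4].
  rewrite -/(hit_ n); move: h4; rewrite aSE => h4.
  by apply/andP; split; lra.
have := psiE 0%N 0; rewrite a0 lexx aSE a0 add0r subr_ge0.
have /andP[h1 _] := arc_tau (A 0%N); rewrite (ltW h1) => /(_ isT) ->.
by rewrite /f /= a0 subr0 add0r (arc0 (A 0%N)).
Qed.

(** At equal times the arcs are close by Gronwall's inequality. After the first
    landing the other arc lasts for a time of the order of [`|p - q|], because
    hitting times are Lipschitz. *)
Lemma arc_compare : exists2 K, 0 <= K & forall F t0 p q,
  near_field X gam T k r m eps F -> arc_start gam T k d1 t0 p -> arc_start gam T k d1 t0 q ->
  (forall t, t0 <= t <= hit F t0 p -> exists2 s, t0 <= s <= hit F t0 q &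
     `|flow F t0 p t - flow F t0 q s| <= K * `|p - q|) /\
  `|land F t0 p - land F t0 q| <= K * `|p - q|.
Proof.
have [G G0 [Gs _]] := gam_speed B.
have m0 := ab_m0 B; have L0 := ab_L0 B; have r0 := ab_r0 B.
pose V := G + L * r + 1.
have V0 : 0 <= V by rewrite !addr_ge0// mulr_ge0// ltW.
have C00 : 0 <= C0 by apply: le_trans ler01 (gconst_ge1 _ _ _); [rewrite addr_ge0|exact: ltW].
exists (C0 + V * (C0 / m)).
  by rewrite addr_ge0// mulr_ge0// divr_ge0// ltW.
move=> F t0 p q nF sp sq.
have A1 := flowP nF sp; have A2 := flowP nF sq.
have t00 : 0 <= t0 by case: sp => /andP[].
have /andP[t1 t2] := arc_tau A1; have /andP[s1 s2] := arc_tau A2.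
have hd : `|hit F t0 p - hit F t0 q| <= C0 / m * `|p - q|.
  rewrite mulrAC ler_pdivlMr// mulrC; exact: (hit_time_dist B nF t00 A1 A2).
have speed f x tau s t : is_arc F gam T k r t0 x f tau -> t0 <= s <= T + k -> t0 <= t <= T + k ->
    `|f t - f s| <= V * `|t - s|.
  move=> A sI tI; have := solution_mvt (w := 0) (c := V) (arc_sol A) sI tI.
  rewrite scaler0 subr0; apply => y /andP[y1 y2]; rewrite subr0.
  have yI : t0 <= y <= T + k.
    case/andP: sI => ? ?; case/andP: tI => ? ?.
    by rewrite (le_trans _ y1) ?le_min ?(le_trans y2)// ?ge_max; do ?(apply/andP; split).
  have yI' : 0 <= y <= T + k by case/andP: yI => h1 h2; rewrite (le_trans t00 h1).
  have yr := ltW (arc_tube A yI).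
  have [_ h _] := nf_close nF yI' yr.
  rewrite -[F (f y)](subrK (X (f y))) addrC; apply: le_trans (ler_normD _ _) _.
  rewrite /V lerD//; last by apply: le_trans h (nf_eps1 nF).
  rewrite -[X (f y)](subrK (X (gam y))) addrC; apply: le_trans (ler_normD _ _) _.
  by rewrite lerD ?Gs//; apply: le_trans (ab_lip B _ _) _; rewrite ler_wpM2l.
have main t : t0 <= t <= hit F t0 p -> forall s, (s = t /\ t <= hit F t0 q) \/ (s = hit F t0 q /\ `|t - s| <= C0 / m * `|p - q|) ->
    `|flow F t0 p t - flow F t0 q s| <= (C0 + V * (C0 / m)) * `|p - q|.
  move=> /andP[h1 h2] s; rewrite mulrDl => -[[-> tq]|[-> tq]].
    apply: le_trans (arc_dist B nF t00 A1 A2 _) _; first by rewrite h1 (le_trans h2)// ltW.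
    by rewrite lerDl mulr_ge0// mulr_ge0// divr_ge0// ltW.
  rewrite -(subrKA (flow F t0 p (hit F t0 q))) addrC; apply: le_trans (ler_normD _ _) _.
  rewrite lerD//; first by apply: (arc_dist B nF t00 A1 A2); rewrite !ltW.
  apply: le_trans (speed _ _ _ _ _ A1 _ _) _.
  - by rewrite !ltW.
  - by rewrite h1 (le_trans h2)// ltW.
  by rewrite -mulrA ler_wpM2l.
split.
  move=> t /andP[h1 h2]; have [tq|/ltW qt] := leP t (hit F t0 q).
    by exists t; [rewrite h1|apply: main; [rewrite h1|left]].
  exists (hit F t0 q); first by rewrite lexx ltW.
  apply: main; first by rewrite h1.
  right; split=> //; apply: le_trans hd.
  by rewrite !ger0_norm ?subr_ge0// ?(le_trans qt)// lerD2r.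
rewrite /land -fromSigmaB; apply: le_trans (fromSigma_norm _) _; rewrite canonS_dist.
apply: main; last by right.
by rewrite lexx ltW.
Qed.

(** A perturbed system has no symmetry left, so its two half-return maps differ
    and its cycle is a pair of points that they exchange, not a fixed point of
    either of them. *)
Record fixed_pair Z u v : Prop := FixedPair {
  fp_u : N (u - u0) <= sg;
  fp_v : N (v - u0) <= sg;
  fp_uv : halfmap (upper Z) u = v;
  fp_vu : halfmap (upper (conjZ Z)) v = u }.

Lemma fixed_pair_conj Z u v : fixed_pair Z u v -> fixed_pair (conjZ Z) v u.
Proof. by case=> *; split; rewrite ?conjZK. Qed.

Lemma half_rho (x : R) : x <= sg -> x <= rho.
Proof. by have := sd_sg D; have := sd_rho0 D; lra. Qed.

(** Banach's fixed point theorem for the composition of the two half-return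
    maps on the [N]-ball of radius [rho]. The distances [s] and [s'] of the two
    points to [u0] then satisfy [s - sg <= th * (s' - sg)] and conversely, so
    that both are at most [sg]. *)
Lemma fixed_pair_exists Z : near_system eps Z -> exists u v, fixed_pair Z u v.
Proof.
move=> nZ; have th0 := sd_th0 D; have th1 := sd_th1 D; have r0 := sd_rho0 D.
pose Q := halfmap (upper Z); pose Q' := halfmap (upper (conjZ Z)).
pose P u := Q' (Q u).
have nU := ns_up nZ; have nL := ns_low nZ.
have Qb u : N (u - u0) <= rho -> N (Q u - u0) <= rho by exact: halfmap_ball.
have Qb' u : N (u - u0) <= rho -> N (Q' u - u0) <= rho by exact: halfmap_ball.
have Qc u v : N (u - u0) <= rho -> N (v - u0) <= rho -> N (Q u - Q v) <= th * N (u - v).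
  by move=> /(sd_rho D) h1 /(sd_rho D) h2; exact: (sd_contr D).
have Qc' u v : N (u - u0) <= rho -> N (v - u0) <= rho -> N (Q' u - Q' v) <= th * N (u - v).
  by move=> /(sd_rho D) h1 /(sd_rho D) h2; exact: (sd_contr D).
have Pc u v : N (u - u0) <= rho -> N (v - u0) <= rho -> N (P u - P v) <= th * N (u - v).
  move=> hu hv; apply: le_trans (Qc' _ _ (Qb _ hu) (Qb _ hv)) _.
  rewrite ler_wpM2l//; apply: le_trans (Qc _ _ hu hv) _.
  by rewrite ler_piMl ?an_ge0// ltW.
pose w i := iter i P u0.
have wb i : N (w i - u0) <= rho.
  elim: i => [|i IH]; last by apply/Qb'/Qb.
  by rewrite subrr; apply: le_trans (an_upper AN _) _; rewrite normr0 mulr0 ltW.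
have c0 := an_c0 AN.
have ws i : N (w i.+1 - w i) <= th ^+ i * N (w 1%N - w 0%N).
  elim: i => [|i IH]; first by rewrite mul1r.
  rewrite exprS -mulrA; apply: le_trans (Pc _ _ (wb i.+1) (wb i)) _.
  by rewrite ler_wpM2l.
have [u Hu] : exists u, forall i, `|u - w i| <= (N (w 1%N - w 0%N) / cN) / (1 - th) * th ^+ i.
  apply: geometric_limit => // i; apply: le_trans (an_norm _) _.
  by rewrite [leRHS]mulrAC ler_wpM2r ?invr_ge0 ?(ltW c0)// mulrC.
have Nu e : 0 < e -> exists I, forall i, (I <= i)%N -> N (u - w i) < e.
  move=> e0; have C1 : 0 < `|CN| + 1 by rewrite ltr_wpDl.
  have [I HI] := powers_small ((N (w 1%N - w 0%N) / cN) / (1 - th)) th0 th1 (divr_gt0 e0 C1).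
  exists I => i Ii; apply: le_lt_trans (an_upper AN _) _.
  apply: (@le_lt_trans _ _ ((`|CN| + 1) * `|u - w i|)).
    by rewrite ler_wpM2r//; have := ler_norm CN; lra.
  by rewrite mulrC -ltr_pdivlMr//; apply: le_lt_trans (Hu i) (HI _ Ii).
have ub : N (u - u0) <= rho.
  apply/ler_addgt0Pr => e /Nu[i /(_ _ (leqnn _)) hi].
  have := an_tri AN (u - w i) (w i - u0); rewrite subrKA => h; apply: le_trans h _.
  by rewrite addrC lerD// ltW.
have Pu : P u = u.
  apply/subr0_eq/an_eq0/ler_addgt0Pr => e e0; rewrite add0r.
  have e2 : 0 < e / 2 by rewrite divr_gt0.
  have [i Hi] := Nu _ e2.
  have := an_tri AN (P u - P (w i)) (w i.+1 - u); rewrite subrKA => h; apply: le_trans h _.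
  rewrite [leRHS]splitr lerD//.
    apply: le_trans (Pc _ _ ub (wb i)) _; apply: le_trans _ (ltW (Hi i (leqnn _))).
    by rewrite ler_piMl ?an_ge0// ltW.
  by rewrite -an_opp opprB ltW// Hi.
have h1 := halfmap_center nU ub; have h2 := halfmap_center nL (Qb _ ub).
rewrite -/(Q u) in h1; rewrite -/(Q u) -/(Q' (Q u)) -/(P u) Pu in h2.
have two a b : a <= th * b -> b <= th * a -> a <= 0.
  move=> ab ba; rewrite leNgt; apply/negP => a0.
  have : th * b <= th * (th * a) by rewrite ler_wpM2l.
  have : th * (th * a) <= th * a by rewrite ler_wpM2l// ler_piMl// ltW.
  have : th * a < a by rewrite gtr_pMl.
  by move: ab; lra.
have e1 : N (Q u - u0) - sg <= th * (N (u - u0) - sg) by lra.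
have e2 : N (u - u0) - sg <= th * (N (Q u - u0) - sg) by lra.
have := two _ _ e1 e2; have := two _ _ e2 e1; rewrite !subr_le0 => h3 h4.
by exists u, (Q u).
Qed.

Definition orbit Z u v : set 'rV[R]_3 :=
  [set x | (exists2 t, 0 <= t <= hit (upper Z) 0 (toSigma u) & x = flow (upper Z) 0 (toSigma u) t) \/
   (exists2 t, 0 <= t <= hit (upper (conjZ Z)) 0 (toSigma v) &
      S x = flow (upper (conjZ Z)) 0 (toSigma v) t)].

Definition near_orbit Z u v (e : R) x := exists2 y, orbit Z u v y & `|x - y| <= e.

Lemma orbit_conj Z u v x : orbit Z u v x -> orbit (conjZ Z) v u (S x).
Proof.
by move=> [|] [t h1 h2]; [right|left]; exists t; rewrite ?conjZK ?canonSK.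
Qed.

Lemma near_orbit_conj Z u v e x : near_orbit Z u v e x -> near_orbit (conjZ Z) v u e (S x).
Proof.
by move=> [y /orbit_conj h xy]; exists (S y) => //; rewrite canonS_dist.
Qed.

Lemma near_orbit_conjK Z u v e x : near_orbit (conjZ Z) v u e (S x) -> near_orbit Z u v e x.
Proof. by move=> /near_orbit_conj; rewrite conjZK canonSK. Qed.

Lemma near_orbit_le Z u v e e' x : e <= e' -> near_orbit Z u v e x -> near_orbit Z u v e' x.
Proof. by move=> ee [y h xy]; exists y => //; exact: le_trans ee. Qed.

(** Estimates along the forward trajectories that start on the section near
    the fixed point, by recursion on the arcs they are made of. *)
Lemma forward_near : exists2 K, 0 <= K & forall n Z u v w psi, near_system eps Z -> fixed_pair Z u v ->
  N (w - u0) <= rho -> forward_trajectory Z (toSigma w) psi ->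
  (forall t, 0 <= t <= n%:R * (T - k) -> near_orbit Z u v (K * N (w - u)) (psi t)) /\
  (forall t, n%:R * (T + k) <= t -> near_orbit Z u v (K * (th ^+ n * N (w - u))) (psi t)).
Proof.
have [K K0 HK] := arc_compare; have c0 := an_c0 AN.
have th0 := sd_th0 D; have th1 := sd_th1 D.
have K'0 : 0 <= K / cN by rewrite divr_ge0// ltW.
exists (K / cN) => //.
have first_arc Z u v w psi : near_system eps Z -> fixed_pair Z u v ->
  N (w - u0) <= rho -> forward_trajectory Z (toSigma w) psi ->
  forall t, 0 <= t <= hit (upper Z) 0 (toSigma w) -> near_orbit Z u v (K / cN * N (w - u)) (psi t).
  move=> nZ fp wr fw t tI; have su := ball_start (ns_up nZ) (half_rho (fp_u fp)).
  have [h1 _] := forward_follows nZ (ball_start (ns_up nZ) wr) fw.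
  have := h1 t tI; rewrite subr0 => ->.
  have [H _] := HK _ _ _ _ (ns_up nZ) (ball_start (ns_up nZ) wr) su.
  have [s sI Hs] := H t tI.
  exists (flow (upper Z) 0 (toSigma u) s); first by left; exists s.
  apply: le_trans Hs _; rewrite toSigma_dist -mulrA ler_wpM2l//.
  by rewrite mulrC; exact: an_norm.
have next Z u v w psi : near_system eps Z -> fixed_pair Z u v ->
  N (w - u0) <= rho -> forward_trajectory Z (toSigma w) psi ->
  exists w' psi' tau, [/\ N (w' - u0) <= rho, N (w' - v) <= th * N (w - u),
     forward_trajectory (conjZ Z) (toSigma w') psi', T - k <= tau <= T + k &
     (forall t, tau <= t -> psi t = S (psi' (t - tau))) /\ tau = hit (upper Z) 0 (toSigma w)].
  move=> nZ fp wr fw.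
  have [_ h2] := forward_follows nZ (ball_start (ns_up nZ) wr) fw.
  have A := flowP (ns_up nZ) (ball_start (ns_up nZ) wr).
  exists (halfmap (upper Z) w), (fun t => S (psi (t + (hit (upper Z) 0 (toSigma w) - 0)))), (hit (upper Z) 0 (toSigma w)).
  split=> //.
  - exact: halfmap_ball (ns_up nZ) wr.
  - rewrite -(fp_uv fp); apply: (sd_contr D (ns_up nZ)); first exact: (sd_rho D).
    exact/(sd_rho D)/half_rho/(fp_u fp).
  - by rewrite (ltW (arc_late A)); case/andP: (arc_tau A) => _ /ltW.
  - by split=> // t ht; rewrite subr0 subrK canonSK.
elim=> [|n IH] Z u v w psi nZ fp wr fw.
  have near0 : forall t, 0 <= t -> near_orbit Z u v (K / cN * N (w - u)) (psi t).
    suff H : forall j, forall Z u v w psi, near_system eps Z -> fixed_pair Z u v ->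
        N (w - u0) <= rho -> forward_trajectory Z (toSigma w) psi ->
        forall t, 0 <= t -> t <= j%:R * (T - k) -> near_orbit Z u v (K / cN * N (w - u)) (psi t).
      move=> t t0; apply: (H (Num.bound (t / (T - k)))) => //.
      by rewrite -ler_pdivrMr//; apply/ltW/archi_boundP; rewrite divr_ge0// ltW.
    move=> {}j; elim: j => [|j IH] {}Z {}u {}v {}w {}psi {}nZ {}fp {}wr {}fw t t0 tj.
      apply: (first_arc _ _ _ _ _ nZ fp wr fw); rewrite t0 (le_trans tj)// mul0r.
      have A := flowP (ns_up nZ) (ball_start (ns_up nZ) wr).
      by case/andP: (arc_tau A) => /ltW.
    have [w' [psi' [tau [h1 h2 h3 /andP[h4 h5] [h6 h7]]]]] := next _ _ _ _ _ nZ fp wr fw.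
    have [tt|/ltW tt] := leP t tau.
      by apply: (first_arc _ _ _ _ _ nZ fp wr fw); rewrite t0 -h7.
    rewrite h6//; apply: near_orbit_conjK; rewrite canonSK.
    apply: (@near_orbit_le _ _ _ (K / cN * N (w' - v))).
      by rewrite ler_wpM2l// (le_trans h2)// ler_piMl ?an_ge0// ltW.
    apply: (IH _ _ _ _ _ (near_system_conj nZ) (fixed_pair_conj fp) h1 h3); first by rewrite subr_ge0.
    by move: tj; rewrite -natr1 mulrDl mul1r => tj; lra.
  split=> t; first by move=> /andP[t0 _]; exact: near0.
  by rewrite mul0r mul1r; exact: near0.
have [w' [psi' [tau [h1 h2 h3 /andP[h4 h5] [h6 h7]]]]] := next _ _ _ _ _ nZ fp wr fw.
have [IH1 IH2] := IH _ _ _ _ _ (near_system_conj nZ) (fixed_pair_conj fp) h1 h3.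
split=> t.
  move=> /andP[t0 tn]; have [tt|/ltW tt] := leP t tau.
    by apply: (first_arc _ _ _ _ _ nZ fp wr fw); rewrite t0 -h7.
  rewrite h6//; apply: near_orbit_conjK; rewrite canonSK.
  apply: (@near_orbit_le _ _ _ (K / cN * N (w' - v))).
    by rewrite ler_wpM2l// (le_trans h2)// ler_piMl ?an_ge0// ltW.
  apply: IH1; rewrite subr_ge0 tt/=.
  by move: tn; rewrite -natr1 mulrDl mul1r => tn; lra.
rewrite -natr1 mulrDl mul1r => tn.
have n0 : 0 <= n%:R * (T + k) by rewrite mulr_ge0// ltW.
have tt : tau <= t by lra.
rewrite h6//; apply: near_orbit_conjK; rewrite canonSK.
apply: (@near_orbit_le _ _ _ (K / cN * (th ^+ n * N (w' - v)))).
  by rewrite ler_wpM2l// exprSr -mulrA ler_wpM2l// exprn_ge0.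
by apply: IH2; lra.
Qed.

(** ** The orbit through the fixed points *)

Lemma flow_within F p : is_arc F gam T k r 0 p (flow F 0 p) (hit F 0 p) ->
  {within `[0, hit F 0 p], continuous (flow F 0 p)}.
Proof.
move=> A; case/andP: (arc_tau A) => t1 t2.
exact: (solution_within (arc_sol A) (lexx _) (ltW t2)).
Qed.

Lemma fixed_arc Z u v : near_system eps Z -> fixed_pair Z u v ->
  is_arc (upper Z) gam T k r 0 (toSigma u) (flow (upper Z) 0 (toSigma u)) (hit (upper Z) 0 (toSigma u)).
Proof. by move=> nZ fp; apply/(flowP (ns_up nZ))/(ball_start (ns_up nZ))/half_rho/(fp_u fp). Qed.

Lemma fixed_land Z u v : near_system eps Z -> fixed_pair Z u v ->
  S (flow (upper Z) 0 (toSigma u) (hit (upper Z) 0 (toSigma u))) = toSigma v.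
Proof.
move=> nZ fp; have nF := ns_up nZ.
by rewrite -(landE nF (ball_start nF (half_rho (fp_u fp)))) -(fp_uv fp).
Qed.

Lemma orbit_compact Z u v : near_system eps Z -> fixed_pair Z u v -> compact (orbit Z u v).
Proof.
move=> nZ fp; have A1 := fixed_arc nZ fp; have A2 := fixed_arc (near_system_conj nZ) (fixed_pair_conj fp).
have -> : orbit Z u v =
  (flow (upper Z) 0 (toSigma u)) @` `[0, hit (upper Z) 0 (toSigma u)] `|`
  S @` ((flow (upper (conjZ Z)) 0 (toSigma v)) @` `[0, hit (upper (conjZ Z)) 0 (toSigma v)]).
  apply/seteqP; split=> x.
    move=> [[t tI ->]|[t tI Sx]]; [left; exists t => //; by rewrite /= in_itv/=|].
    right; exists (S x); last by rewrite canonSK.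
    by exists t => //; rewrite /= in_itv.
  move=> [[t /= tI <-]|[y [t /= tI <-] <-]]; rewrite in_itv/= in tI.
    by left; exists t.
  by right; exists t => //; rewrite canonSK.
apply: compactU.
  by apply: continuous_compact; [exact: flow_within|exact: segment_compact].
apply: continuous_compact; first by apply: continuous_subspaceT; exact: canonS_continuous.
by apply: continuous_compact; [exact: flow_within|exact: segment_compact].
Qed.

Lemma near_orbit_in Z u v x : near_system eps Z -> fixed_pair Z u v ->
  (forall e, 0 < e -> near_orbit Z u v e x) -> orbit Z u v x.
Proof.
move=> nZ fp H; have cl : closed (orbit Z u v).
  by apply: compact_closed; [exact: norm_hausdorff|exact: orbit_compact].
apply: cl => V /nbhs_ballP[e /= e0 Ve].
have [y oy xy] := H _ (divr_gt0 e0 (ltr0n R 2)).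
exists y; split=> //; apply: Ve; rewrite -ball_normE /=.
by apply: le_lt_trans xy _; rewrite gtr_pMr// invf_lt1// ltr1n.
Qed.

(** By compactness of the orbit a neighborhood contains a uniform one. *)
Lemma orbit_nbhs_near Z u v V : near_system eps Z -> fixed_pair Z u v -> set_nbhs (orbit Z u v) V ->
  exists2 e, 0 < e & forall x, near_orbit Z u v e x -> V x.
Proof.
move=> nZ fp oV; have /compact_near_coveringP cpt := orbit_compact nZ fp.
have [|e /= e0 He] := cpt R (0 : R)^'+ (fun e y => forall x, `|x - y| <= e -> V x) _.
  move=> y oy; have /nbhs_ballP[e /= e0 Ve] := oV y oy.
  have e2 : 0 < e / 2 by rewrite divr_gt0.
  exists ([set z | `|y - z| < e / 2], [set i | i < e / 2]); first split => /=.
  - by apply/nbhs_ballP; exists (e / 2) => // z; rewrite -ball_normE.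
  - by exists (e / 2) => //= i; rewrite /= sub0r normrN => + i0; rewrite gtr0_norm.
  move=> [z i] /= [z1 i1] x xz; apply: Ve; rewrite -ball_normE /=.
  rewrite -(subrKA z); apply: le_lt_trans (ler_normD _ _) _.
  by rewrite [e]splitr ltrD// distrC; exact: le_lt_trans i1.
have e2 : 0 < e / 2 by rewrite divr_gt0.
exists (e / 2) => // x [y oy xy].
have := He (e / 2); rewrite /= sub0r normrN gtr0_norm// => /(_ _ e2 y oy x xy); apply.
by rewrite gtr_pMr// invf_lt1// ltr1n.
Qed.

Lemma arc_restrict F t0 t1 p phi tau : is_arc F gam T k r t0 p phi tau ->
  t0 <= t1 < tau -> is_arc F gam T k r t1 (phi t1) phi tau.
Proof.
move=> A /andP[h1 h2]; case/andP: (arc_tau A) => h3 h4; split => //.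
- by move=> t /andP[h5 h6]; apply: (arc_sol A); rewrite (le_trans h1).
- by move=> t /andP[h5 h6]; apply: (arc_tube A); rewrite (le_trans h1).
- by rewrite h2.
- exact: (arc_late A).
- exact: (arc_hit A).
- by move=> t /andP[h5 h6]; apply: (arc_pos A); rewrite (le_lt_trans h1 h5).
Qed.

Lemma plane_side Z u : near_system eps Z -> `|u - u0| <= d1 ->
  0 < zc (toSigma u) \/ zc (toSigma u) = 0 /\ 0 < lief (upper Z) (toSigma u).
Proof.
move=> nZ ud; right; rewrite toSigma_z; split=> //.
by have [_ h] := start_crossing nZ ud; apply: lt_le_trans h; exact: (ab_m0 B).
Qed.

Lemma forward_covers Z u v psi : near_system eps Z -> fixed_pair Z u v ->
  forward_trajectory Z (toSigma u) psi -> forall y, orbit Z u v y -> exists2 t, 0 <= t & psi t = y.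
Proof.
move=> nZ fp fw; have nF := ns_up nZ.
have su := ball_start nF (half_rho (fp_u fp)).
have A := fixed_arc nZ fp.
have [h1 h2] := forward_follows nZ su fw.
have tau0 : 0 <= hit (upper Z) 0 (toSigma u) by case/andP: (arc_tau A) => /ltW.
move=> y [[t tI ->]|[t tI Sy]].
  by exists t; [case/andP: tI|rewrite -h1// subr0].
have := forward_follows (near_system_conj nZ) (ball_start (ns_low nZ) (half_rho (fp_v fp))).
rewrite -(fp_uv fp) => /(_ _ h2)[h3 _].
have := h3 t; rewrite -/(halfmap _ _) (fp_uv fp) => /(_ tI); rewrite -Sy !subr0 => h4.
exists (t + hit (upper Z) 0 (toSigma u)); first by rewrite addr_ge0//; case/andP: tI.
by rewrite -[RHS]canonSK -h4 canonSK.
Qed.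

(** Whatever its starting point on the orbit, a forward trajectory first
    completes its arc and then runs through the whole orbit. *)
Lemma orbit_covers Z u v x psi : near_system eps Z -> fixed_pair Z u v -> orbit Z u v x ->
  forward_trajectory Z x psi -> forall y, orbit Z u v y -> exists2 t, 0 <= t & psi t = y.
Proof.
suff key Z' u' v' x' psi' : near_system eps Z' -> fixed_pair Z' u' v' ->
    (exists2 t, 0 <= t <= hit (upper Z') 0 (toSigma u') & x' = flow (upper Z') 0 (toSigma u') t) ->
    forward_trajectory Z' x' psi' -> forall y, orbit Z' u' v' y -> exists2 t, 0 <= t & psi' t = y.
  move=> nZ fp [h|h] fw; first exact: key fw.
  move=> y oy; have [] := key _ _ _ _ _ (near_system_conj nZ) (fixed_pair_conj fp) h (forward_conj fw) (S y).
    exact: orbit_conj.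
  by move=> t t0 h'; exists t => //; rewrite -[LHS]canonSK -[RHS]canonSK; congr S.
move=> nZ fp [t1 /andP[t10 t1h] ->] fw y oy.
have A := fixed_arc nZ fp; have sl := fixed_land nZ fp.
have to_conj : forall c, 0 <= c ->
   forward_trajectory (conjZ Z') (toSigma v') (fun t => S (psi' (t + c))) -> exists2 t, 0 <= t & psi' t = y.
  move=> c c0 fw'; have [t t0 h] := forward_covers (near_system_conj nZ) (fixed_pair_conj fp) fw' (orbit_conj oy).
  by exists (t + c); [rewrite addr_ge0|rewrite -[LHS]canonSK h canonSK].
move: t1h; rewrite le_eqVlt => /predU1P[t1e|t1h].
  apply: (to_conj 0) => //; rewrite -sl -t1e.
  have -> : (fun t => S (psi' (t + 0))) = S \o psi' by apply/funext => t; rewrite addr0.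
  exact: forward_conj.
have A1 : is_arc (upper Z') gam T k r t1 (flow (upper Z') 0 (toSigma u') t1) (flow (upper Z') 0 (toSigma u')) (hit (upper Z') 0 (toSigma u')).
  by apply: arc_restrict A _; rewrite t10.
have side : 0 < zc (flow (upper Z') 0 (toSigma u') t1) \/ zc (flow (upper Z') 0 (toSigma u') t1) = 0 /\ 0 < lief (upper Z') (flow (upper Z') 0 (toSigma u') t1).
  move: t10; rewrite le_eqVlt => /predU1P[<-|t10].
    rewrite (arc0 A); apply: (plane_side nZ); apply: (d_le_d1 (ns_up nZ)); apply: (sd_rho D).
    exact: half_rho (fp_u fp).
  by left; apply: (arc_pos A); rewrite t10.
have [_ h2] := forward_follows_arc nZ t10 A1 side fw.
by apply: (to_conj (hit (upper Z') 0 (toSigma u') - t1)); rewrite ?subr_ge0 ?ltW// -sl.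
Qed.

Lemma forward_unique Z w psi psi' : near_system eps Z -> N (w - u0) <= rho ->
  forward_trajectory Z (toSigma w) psi -> forward_trajectory Z (toSigma w) psi' ->
  forall t, 0 <= t -> psi t = psi' t.
Proof.
suff H n : forall Z w psi psi', near_system eps Z -> N (w - u0) <= rho ->
    forward_trajectory Z (toSigma w) psi -> forward_trajectory Z (toSigma w) psi' ->
    forall t, 0 <= t -> t <= n%:R * (T - k) -> psi t = psi' t.
  move=> nZ wr f1 f2 t t0; apply: (H (Num.bound (t / (T - k))) _ _ _ _ nZ wr f1 f2) => //.
  by rewrite -ler_pdivrMr//; apply/ltW/archi_boundP; rewrite divr_ge0// ltW.
elim: n => [|n IH] {}Z {}w {}psi {}psi' nZ wr f1 f2 t t0 tn.
  have -> : t = 0 by apply/eqP; rewrite eq_le t0 andbT (le_trans tn)// mul0r.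
  by rewrite f1.2 f2.2.
have sw := ball_start (ns_up nZ) wr.
have [h1 h2] := forward_follows nZ sw f1; have [h3 h4] := forward_follows nZ sw f2.
have A := flowP (ns_up nZ) sw.
have [th'|/ltW ht] := leP t (hit (upper Z) 0 (toSigma w)).
  by have := h1 t; have := h3 t; rewrite t0 th' !subr0 => -> // ->.
have := IH _ _ _ _ (near_system_conj nZ) (halfmap_ball (ns_up nZ) wr) h2 h4 (t - hit (upper Z) 0 (toSigma w)).
rewrite subr_ge0 ht => /(_ isT); rewrite !subr0 !subrK => H.
rewrite -[LHS]canonSK -[RHS]canonSK; congr S; apply: H.
by have := arc_late A; move: tn; rewrite -natr1 mulrDl mul1r; lra.
Qed.

(** ** The orbit is a simple crossing cycle *)

Lemma orbit_plane Z u v x : near_system eps Z -> fixed_pair Z u v -> orbit Z u v x -> zc x = 0 ->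
  x = toSigma u \/ x = S (toSigma v).
Proof.
suff key Z' u' v' : near_system eps Z' -> fixed_pair Z' u' v' -> forall t, 0 <= t <= hit (upper Z') 0 (toSigma u') ->
    zc (flow (upper Z') 0 (toSigma u') t) = 0 ->
    flow (upper Z') 0 (toSigma u') t = toSigma u' \/ flow (upper Z') 0 (toSigma u') t = S (toSigma v').
  move=> nZ fp [[t tI ->]|[t tI Sx]] z0; first exact: key.
  have := key _ _ _ (near_system_conj nZ) (fixed_pair_conj fp) t tI; rewrite -Sx canonS_z z0 oppr0.
  move=> /(_ erefl) [h|h]; [right|left].
    by rewrite -h canonSK.
  by rewrite -[LHS]canonSK h canonSK.
move=> nZ fp t /andP[t0 th'] z0; have A := fixed_arc nZ fp.
move: t0; rewrite le_eqVlt => /predU1P[<-|t0]; first by left; rewrite (arc0 A).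
move: th'; rewrite le_eqVlt => /predU1P[->|th']; first by right; rewrite -(fixed_land nZ fp) canonSK.
by have := arc_pos A (t := t); rewrite t0 th' z0 ltxx => /(_ isT).
Qed.

Lemma orbit_start Z u v : near_system eps Z -> fixed_pair Z u v -> orbit Z u v (toSigma u).
Proof.
move=> nZ fp; have A := fixed_arc nZ fp; left; exists 0; last by rewrite (arc0 A).
by rewrite lexx; case/andP: (arc_tau A) => /ltW.
Qed.

Lemma fixed_crossing Z u v : near_system eps Z -> fixed_pair Z u v ->
  [/\ crossing Z (toSigma u), m <= lief (upper Z) (toSigma u),
      crossing Z (S (toSigma v)) & lief (upper Z) (S (toSigma v)) <= - m].
Proof.
move=> nZ fp; have nF := ns_up nZ.
have [h1 h2] := start_crossing nZ (d_le_d1 nF (sd_rho D (half_rho (fp_u fp)))).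
have [h3 h4] := land_crossing nZ (canonSK (toSigma v)) (d_le_d1 nF (sd_rho D (half_rho (fp_v fp)))).
by [].
Qed.

(** Negative times are reached by adding multiples of the period. *)
Lemma periodic_extension Z p psi P : 0 < P -> forward_trajectory Z p psi ->
  (forall t, 0 <= t -> psi (t + P) = psi t) ->
  exists phi, [/\ trajectory Z setT phi, forall t, phi (t + P) = phi t &
    (forall t, 0 <= t -> phi t = psi t) /\ range phi `<=` [set psi t | t in [set t | 0 <= t]]].
Proof.
move=> P0 [tr _] per.
have perN n t : 0 <= t -> psi (t + n%:R * P) = psi t.
  elim: n t => [|n IH] t t0; first by rewrite mul0r addr0.
  by rewrite -natr1 mulrDl mul1r addrA per ?IH// addr_ge0// mulr_ge0// ltW.
pose n_ t := Num.bound (`|t| / P).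
have nP t : 0 <= t + (n_ t)%:R * P.
  have : `|t| <= (n_ t)%:R * P.
    by rewrite -ler_pdivrMr//; apply/ltW/archi_boundP; rewrite divr_ge0// ltW.
  have := ler_norm (- t); rewrite normrN; lra.
pose phi t := psi (t + (n_ t)%:R * P).
have phiE n t : 0 <= t + n%:R * P -> phi t = psi (t + n%:R * P).
  move=> tn; rewrite /phi.
  have [nn|nn] := leqP n (n_ t).
    rewrite -(perN (n_ t - n)%N _ tn); congr psi.
    by rewrite natrB//; ring.
  rewrite -[LHS](perN (n - n_ t)%N _ (nP t)); congr psi.
  by rewrite natrB ?(ltnW nn)//; ring.
exists phi; split.
- move=> t _.
  pose n := (n_ t + 1)%N.
  have tn : P <= t + n%:R * P by have := nP t; rewrite /n natrD mulrDl mul1r; lra.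
  have shift := trajectory_shift (c := - (n%:R * P)) tr.
  have eqn s : t - P <= s -> phi s = psi (s - - (n%:R * P)).
    by move=> ts; rewrite opprK; apply: phiE; lra.
  have [|h1 h2 h3 h4] := shift t; first by rewrite /= in_itv/= opprK andbT; lra.
  have tt := eqn t; rewrite lerBlDr lerDl (ltW P0) in tt.
  split; rewrite ?tt//.
  + move=> _; apply: (@right_deriv_ext _ (fun s => psi (s - - (n%:R * P))) _ t P) => //.
      by move=> s /andP[s1 _]; rewrite eqn//; lra.
    by apply: h3; exists (t + 1); [rewrite /= in_itv/= opprK andbT; lra|rewrite ltrDl].
  + move=> _; apply: (@left_deriv_ext _ (fun s => psi (s - - (n%:R * P))) _ t P) => //.
      by move=> s /andP[s1 _]; rewrite eqn.
    by apply: h4; exists (t - P); [rewrite /= in_itv/= opprK andbT; lra|rewrite ltrBlDr ltrDl].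
- move=> t; rewrite (phiE (n_ t + 1)%N).
    rewrite (_ : t + P + _ = t + (n_ t)%:R * P + 2%:R * P); last by rewrite natrD; ring.
    by rewrite perN.
  have := nP t; rewrite natrD mulrDl; lra.
- split; first by move=> t t0; rewrite (phiE 0%N) mul0r addr0.
  by move=> _ [t _ <-]; exists (t + (n_ t)%:R * P) => //=.
Qed.

Lemma orbit_cycle Z u v : near_system eps Z -> fixed_pair Z u v ->
  crossing_periodic_orbit Z (orbit Z u v) /\ simple_period (orbit Z u v).
Proof.
move=> nZ fp; have nF := ns_up nZ.
have [c1 l1 c2 l2] := fixed_crossing nZ fp.
have m0 := ab_m0 B.
have ne : toSigma u <> S (toSigma v).
  by move=> e; move: l1 l2; rewrite e; lra.
have ou := orbit_start nZ fp.
have ov : orbit Z u v (S (toSigma v)).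
  by have := orbit_conj (orbit_start (near_system_conj nZ) (fixed_pair_conj fp)); rewrite conjZK.
have su := ball_start nF (half_rho (fp_u fp)).
have sv := ball_start (ns_low nZ) (half_rho (fp_v fp)).
have [psi fw] : exists psi, forward_trajectory Z (toSigma u) psi.
  apply: (forward_exists nZ su); exact: halfmap_ball nF (half_rho (fp_u fp)).
split; last first.
  exists (toSigma u), (S (toSigma v)); split => //.
  apply/seteqP; split => [x [ox zx]|x [->|->]]; first by case: (orbit_plane nZ fp ox zx) => ->; [left|right].
  - by split=> //; exact: toSigma_z.
  - by split=> //; rewrite /Sigma/= canonS_z toSigma_z oppr0.
have oc : orbit Z u v `&` Sigma `<=` crossing Z.
  by move=> x [ox zx]; case: (orbit_plane nZ fp ox zx) => ->.
split=> //; last by exists (toSigma u); split => //; exact: toSigma_z.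
have [_ fw1] := forward_follows nZ su fw.
rewrite -/(halfmap _ _) (fp_uv fp) in fw1.
have [_ fw2] := forward_follows (near_system_conj nZ) sv fw1.
rewrite conjZK -/(halfmap _ _) (fp_vu fp) !subr0 in fw2.
set h1 := hit (upper Z) _ _ in fw2; set h2 := hit _ _ _ in fw2.
pose P := h2 + h1.
have h10 : 0 < h1 by case/andP: (arc_tau (fixed_arc nZ fp)).
have h20 : 0 < h2 by case/andP: (arc_tau (fixed_arc (near_system_conj nZ) (fixed_pair_conj fp))).
have P0 : 0 < P by rewrite addr_gt0.
have fw3 : forward_trajectory Z (toSigma u) (fun t => psi (t + P)).
  move: fw2; congr (forward_trajectory _ _ _); apply/funext => t.
  by rewrite canonSK addrA.
have per t : 0 <= t -> psi (t + P) = psi t.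
  exact: (forward_unique nZ (half_rho (fp_u fp)) fw3 fw).
have [phi [ph1 ph2 [ph3 ph4]]] := periodic_extension P0 fw per.
have inorb t : 0 <= t -> orbit Z u v (psi t).
  move=> t0; apply: (near_orbit_in nZ fp) => e e0.
  have [K K0 HK] := forward_near.
  have [_ H] := HK 0%N _ _ _ _ _ nZ fp (half_rho (fp_u fp)) fw.
  apply: near_orbit_le (H t _); last by rewrite mul0r.
  rewrite subrr; have -> : N 0 = 0 by rewrite -(scale0r 0) (an_hom AN) normr0 mul0r.
  by rewrite !mulr0 ltW.
have cov := forward_covers nZ fp fw.
exists phi, P; split => //.
- have [s s0 hs] := cov _ ou; have [t t0 ht] := cov _ ov.
  by exists s, t; rewrite !ph3// hs ht.
- apply/seteqP; split => x.
    by move=> /cov[t t0 <-]; exists t => //; rewrite ph3.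
  by move=> /ph4[t t0 <-]; exact: inorb.
Qed.

(** ** Attraction and stability *)

Definition half_basin x := exists2 t0, t0 <= T & arc_start gam T k dU t0 x.
(** A tube around the unperturbed cycle: it does not depend on the perturbed
    system, hence is the same neighborhood for all of them. *)
Definition basin : set 'rV[R]_3 := [set x | half_basin x \/ half_basin (S x)].

Lemma basin_start F t0 x : near_field X gam T k r m eps F ->
  arc_start gam T k dU t0 x -> arc_start gam T k d1 t0 x.
Proof.
move=> nF [h1 h2 h3]; split => //.
by apply: (d_le_d1 nF); exact: le_trans (sd_dUd D).
Qed.

Lemma start_attracted Z u v t0 x psi : near_system eps Z -> fixed_pair Z u v ->
  arc_start gam T k d1 t0 x -> N (land (upper Z) t0 x - u0) <= rho ->
  forward_trajectory Z x psi ->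
  forall e, 0 < e -> exists c, forall t, c <= t -> near_orbit Z u v e (psi t).
Proof.
move=> nZ fp st lr fw e e0.
have [_ fw1] := forward_follows nZ st fw.
set w := land _ _ _ in lr fw1; set c := _ - t0 in fw1.
have [K K0 HK] := forward_near.
have [n Hn] := powers_small (K * N (w - v)) (sd_th0 D) (sd_th1 D) e0.
exists (n%:R * (T + k) + c) => t tc.
have [_ H] := HK n _ _ _ _ _ (near_system_conj nZ) (fixed_pair_conj fp) lr fw1.
have := H (t - c); rewrite lerBrDr => /(_ tc); rewrite subrK => /near_orbit_conjK.
apply: near_orbit_le; apply: le_trans (ltW (Hn n (leqnn _))).
by rewrite mulrA mulrAC.
Qed.

Lemma basin_attracted Z u v x psi : near_system eps Z -> fixed_pair Z u v -> basin x ->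
  forward_trajectory Z x psi ->
  forall e, 0 < e -> exists c, forall t, c <= t -> near_orbit Z u v e (psi t).
Proof.
suff key Z' u' v' x' psi' : near_system eps Z' -> fixed_pair Z' u' v' -> half_basin x' ->
    forward_trajectory Z' x' psi' ->
    forall e, 0 < e -> exists c, forall t, c <= t -> near_orbit Z' u' v' e (psi' t).
  move=> nZ fp [b|b] fw e e0; first exact: (key _ _ _ _ _ nZ fp b fw).
  have [c Hc] := key _ _ _ _ _ (near_system_conj nZ) (fixed_pair_conj fp) b (forward_conj fw) e e0.
  by exists c => t /Hc /near_orbit_conjK.
move=> nZ fp [t0 t0T st] fw; have nF := ns_up nZ.
apply: (start_attracted nZ fp (basin_start nF st)) fw.
exact: (sd_U D nF t0T st).
Qed.

(** A periodic trajectory comes back to each of its points at arbitrarily late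
    times, hence lies in the closed set to which it is attracted; it then covers
    that orbit. *)
Lemma periodic_attracted Z u v g V : near_system eps Z -> fixed_pair Z u v ->
  (forall x psi, V x -> forward_trajectory Z x psi ->
     forall e, 0 < e -> exists c, forall t, c <= t -> near_orbit Z u v e (psi t)) ->
  periodic_orbit Z g -> g `<=` V -> g = orbit Z u v.
Proof.
move=> nZ fp HV [phi [P [tr P0 per _ gE]]] gV.
have fw s : forward_trajectory Z (phi s) (fun t => phi (t + s)).
  split; last by rewrite add0r.
  have := trajectory_shift (c := - s) tr; rewrite opprK.
  exact: trajectory_sub.
have perN n t : phi (t + n%:R * P) = phi t.
  elim: n t => [|n IH] t; first by rewrite mul0r addr0.
  by rewrite -natr1 mulrDl mul1r addrA per IH.
have g_in : g `<=` orbit Z u v.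
  rewrite gE => x [s _ <-]; apply: (near_orbit_in nZ fp) => e e0.
  have Vx : V (phi s) by apply: gV; rewrite gE; exists s.
  have [c Hc] := HV _ _ Vx (fw s) e e0.
  pose n := Num.bound (`|c| / P).
  have nc : c <= n%:R * P.
    apply: le_trans (ler_norm _) _; rewrite -ler_pdivrMr//; apply/ltW/archi_boundP.
    by rewrite divr_ge0// ltW.
  by have := Hc _ nc; rewrite addrC perN.
apply/seteqP; split => // y oy.
have o0 : orbit Z u v (phi 0) by apply: g_in; rewrite gE; exists 0.
have [t _ <-] := orbit_covers nZ fp o0 (fw 0) oy.
by rewrite gE; exists (t + 0).
Qed.

Definition half_tube Z u e x := exists t1, [/\ 0 <= t1 < hit (upper Z) 0 (toSigma u),
  `|x - flow (upper Z) 0 (toSigma u) t1| < e & 0 < zc x \/ zc x = 0 /\ t1 = 0].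
(** The basin surrounds the unperturbed cycle and cannot be made small; stability
    and isolation are about neighborhoods of the perturbed one. *)
Definition orbit_tube Z u v e : set 'rV[R]_3 :=
  [set x | half_tube Z u e x \/ half_tube (conjZ Z) v e (S x)].

Lemma orbit_tube_conj Z u v e x : orbit_tube Z u v e x -> orbit_tube (conjZ Z) v u e (S x).
Proof. by rewrite /orbit_tube/= conjZK canonSK => -[]; [right|left]. Qed.

Lemma near_S (y : 'rV[R]_3) (A : set 'rV[R]_3) : nbhs (S y) A -> \forall x \near y, A (S x).
Proof. exact: canonS_continuous. Qed.

(** At the crossing points the two half-tubes fit together: a point near the
    take-off is above the plane, on it, or below it, and in the last case it is
    close to the end of the lower arc. *)
Lemma orbit_tube_nbhs Z u v e : near_system eps Z -> fixed_pair Z u v -> 0 < e ->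
  set_nbhs (orbit Z u v) (orbit_tube Z u v e).
Proof.
move=> nZ fp e0.
have dist_nbhs (y : 'rV[R]_3) c : 0 < c -> \forall x \near y, `|x - y| < c.
  move=> c0; apply/nbhs_ballP; exists c => // x; rewrite -ball_normE /= distrC //.
have zpos (y : 'rV[R]_3) : 0 < zc y -> \forall x \near y, 0 < zc x.
  move=> zy; near=> x.
  have : `|x - y| < zc y by near: x; exact: dist_nbhs.
  move/(le_lt_trans (zc_norm _)); rewrite zcB ltr_norml => /andP[+ _]; lra.
have key Z' u' v' t : near_system eps Z' -> fixed_pair Z' u' v' -> 0 <= t < hit (upper Z') 0 (toSigma u') ->
    nbhs (flow (upper Z') 0 (toSigma u') t) (orbit_tube Z' u' v' e).
  move=> nZ' fp' /andP[t0 th']; have A := fixed_arc nZ' fp'.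
  move: t0; rewrite le_eqVlt => /predU1P[te|t0]; last first.
    have z0 : 0 < zc (flow (upper Z') 0 (toSigma u') t) by apply: (arc_pos A); rewrite t0.
    near=> x; left; exists t; split; first by rewrite (ltW t0).
      by near: x; exact: dist_nbhs.
    by left; near: x; exact: zpos.
  rewrite -te (arc0 A).
  have A' := fixed_arc (near_system_conj nZ') (fixed_pair_conj fp').
  have sl := fixed_land (near_system_conj nZ') (fixed_pair_conj fp').
  have /andP[h1 h2] := arc_tau A'.
  set h := hit (upper (conjZ Z')) 0 (toSigma v') in sl h1 h2 *.
  have hI : 0 <= h <= T + k by rewrite !ltW.
  have e2 : 0 < e / 2 by rewrite divr_gt0.
  have [c c0 Hc] := left_deriv_cont (is_derive_left (arc_sol A' hI)) e2.
  pose b := Num.min c h / 2.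
  have mch : 0 < Num.min c h by rewrite lt_min c0.
  have b0 : 0 < b by rewrite divr_gt0.
  have : b < Num.min c h by rewrite gtr_pMr// invf_lt1// ltr1n.
  rewrite lt_min => /andP[bc bh].
  have Hb := Hc b b0 bc.
  near=> x.
  have xe : `|x - toSigma u'| < e / 2 by near: x; exact: dist_nbhs.
  have xe' : `|x - toSigma u'| < e by apply: lt_trans xe _; rewrite gtr_pMr// invf_lt1// ltr1n.
  case: (ltgtP (zc x) 0) => zx.
  - right; exists (h - b); split; first by rewrite subr_ge0 (ltW bh) ltrBlDr ltrDl.
      have -> : S x - flow (upper (conjZ Z')) 0 (toSigma v') (h - b) =
         S (x - toSigma u') - (flow (upper (conjZ Z')) 0 (toSigma v') (h - b) - flow (upper (conjZ Z')) 0 (toSigma v') h).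
        by rewrite canonSB -sl canonSK opprB addrA subrK.
      apply: le_lt_trans (ler_normB _ _) _; rewrite canonS_norm [e]splitr ltrD//.
    by left; rewrite canonS_z oppr_gt0.
  - by left; exists 0; rewrite (arc0 A) lexx -te in th' *; split => //; left.
  - by left; exists 0; rewrite (arc0 A) lexx -te in th' *; split => //; right.
have key2 Z' u' v' t : near_system eps Z' -> fixed_pair Z' u' v' -> 0 <= t <= hit (upper Z') 0 (toSigma u') ->
    nbhs (flow (upper Z') 0 (toSigma u') t) (orbit_tube Z' u' v' e).
  move=> nZ' fp' /andP[t0]; rewrite le_eqVlt => /predU1P[->|th']; last by apply: key; rewrite // t0.
  have A' := fixed_arc (near_system_conj nZ') (fixed_pair_conj fp').
  have := key _ _ _ 0 (near_system_conj nZ') (fixed_pair_conj fp').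
  rewrite lexx (arc0 A'); case/andP: (arc_tau A') => -> _ => /(_ isT).
  rewrite -(fixed_land nZ' fp') => H.
  by apply: filterS (near_S H) => x /orbit_tube_conj; rewrite conjZK canonSK.
move=> y [[t tI ->]|[t tI Sy]]; first exact: key2.
have := key2 _ _ _ t (near_system_conj nZ) (fixed_pair_conj fp) tI; rewrite -Sy => H.
by apply: filterS (near_S H) => x /orbit_tube_conj; rewrite conjZK canonSK.
Unshelve. all: by end_near. Qed.

Lemma fixed_flow_near Z u v t : near_system eps Z -> fixed_pair Z u v ->
  0 <= t <= hit (upper Z) 0 (toSigma u) ->
  `|flow (upper Z) 0 (toSigma u) t - gam t| <= C0 * (d + eps).
Proof.
move=> nZ fp /andP[t0 th']; have nF := ns_up nZ.
have su := ball_start nF (half_rho (fp_u fp)).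
have A := fixed_arc nZ fp; case/andP: (arc_tau A) => _ hT.
have := arc_near B nF (sd_dr D) su A (t := t).
rewrite t0 (le_trans th' (ltW hT)) => /(_ isT) h; apply: le_trans h _.
rewrite ler_wpM2l ?lerD2r//; first exact: le_trans ler01 C01.
by rewrite gam0 toSigma_dist; exact/(sd_rho D)/half_rho/(fp_u fp).
Qed.

Lemma half_tube_start Z u v e x t1 : near_system eps Z -> fixed_pair Z u v ->
  e <= d1 - C0 * (d + eps) ->
  0 <= t1 < hit (upper Z) 0 (toSigma u) ->
  `|x - flow (upper Z) 0 (toSigma u) t1| < e -> 0 < zc x \/ zc x = 0 /\ t1 = 0 ->
  arc_start gam T k d1 t1 x.
Proof.
move=> nZ fp ed /andP[t10 t1h] xe side.
have A := fixed_arc nZ fp; case/andP: (arc_tau A) => _ hT.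
split=> //; first by rewrite t10 (le_trans (ltW t1h) (ltW hT)).
rewrite -(subrKA (flow (upper Z) 0 (toSigma u) t1)); apply: le_trans (ler_normD _ _) _.
have := fixed_flow_near nZ fp (t := t1); rewrite t10 (ltW t1h) => /(_ isT) h.
by apply: le_trans (lerD (ltW xe) h) _; rewrite -lerBrDr.
Qed.

(** Points close to the perturbed cycle are compared with the piece of its arc
    that starts at the same time. *)
Lemma fixed_restart Z u v t1 : near_system eps Z -> fixed_pair Z u v ->
  0 <= t1 < hit (upper Z) 0 (toSigma u) ->
  let y := flow (upper Z) 0 (toSigma u) t1 in
  [/\ arc_start gam T k d1 t1 y, hit (upper Z) t1 y = hit (upper Z) 0 (toSigma u),
   forall t, t1 <= t <= T + k -> flow (upper Z) t1 y t = flow (upper Z) 0 (toSigma u) t &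
   land (upper Z) t1 y = v].
Proof.
move=> nZ fp tI /=; have nF := ns_up nZ; have A := fixed_arc nZ fp.
have /andP[t10 t1h] := tI.
have e0 : 0 < d1 - C0 * (d + eps) by rewrite subr_gt0 (sd_dd1 D).
set y := flow _ _ _ t1.
have st : arc_start gam T k d1 t1 y.
  apply: (half_tube_start (x := y) nZ fp (lexx _) tI); first by rewrite subrr normr0.
  move: t10; rewrite le_eqVlt => /predU1P[te|t10]; last by left; apply: (arc_pos A); rewrite t10.
  by right; split => //; rewrite /y -te (arc0 A) toSigma_z.
have [h1 h2] := arc_unique B nF t10 (flowP nF st) (arc_restrict A tI).
split=> //.
rewrite /land h1 h2; last by case/andP: (arc_tau A) => ? ?; rewrite !ltW.
by rewrite -/(land _ _ _) -/(halfmap _ _) (fp_uv fp).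
Qed.

(** The first landing is close to the fixed point; from then on each half turn
    contracts the distance. *)
Lemma orbit_stable Z u v : near_system eps Z -> fixed_pair Z u v ->
  orbitally_stable Z (orbit Z u v).
Proof.
move=> nZ fp V /(orbit_nbhs_near nZ fp)[e0 e00 Ve0].
have [K K0 HK] := arc_compare; have [K' K'0 HK'] := forward_near.
have CN0 : 0 <= `|CN| by [].
have rs : 0 < rho / 2 by rewrite divr_gt0// (sd_rho0 D).
have dd : 0 < d1 - C0 * (d + eps) by rewrite subr_gt0 (sd_dd1 D).
pose M1 := K + 1; pose M2 := K' * (`|CN| * K) + 1; pose M3 := `|CN| * K + 1.
have M10 : 0 < M1 by rewrite ltr_wpDl.
have M20 : 0 < M2 by rewrite ltr_wpDl// !mulr_ge0.
have M30 : 0 < M3 by rewrite ltr_wpDl// mulr_ge0.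
pose e := Num.min (Num.min (e0 / M1) (e0 / M2)) (Num.min (rho / 2 / M3) (d1 - C0 * (d + eps))).
have ep : 0 < e.
  by rewrite !lt_min dd andbT; apply/andP; split; [apply/andP; split|]; exact: divr_gt0.
have eM1 : K * e <= e0.
  have : e * M1 <= e0 by rewrite -ler_pdivlMr// /e !ge_min lexx.
  move=> h; apply: le_trans h; rewrite /M1.
  rewrite (_ : e * (K + 1) = K * e + e); last by ring.
  by rewrite lerDl ltW.
have eM2 : K' * (`|CN| * (K * e)) <= e0.
  have : e * M2 <= e0 by rewrite -ler_pdivlMr// /e !ge_min lexx orbT.
  move=> h; apply: le_trans h; rewrite /M2.
  rewrite (_ : e * (K' * (`|CN| * K) + 1) = K' * (`|CN| * (K * e)) + e); last by ring.
  by rewrite lerDl ltW.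
have eM3 : `|CN| * (K * e) <= rho / 2.
  have : e * M3 <= rho / 2 by rewrite -ler_pdivlMr// /e !ge_min lexx !orbT.
  move=> h; apply: le_trans h; rewrite /M3.
  rewrite (_ : e * (`|CN| * K + 1) = `|CN| * (K * e) + e); last by ring.
  by rewrite lerDl ltW.
have ed : e <= d1 - C0 * (d + eps) by rewrite /e !ge_min lexx !orbT.
exists (orbit_tube Z u v e); first exact: orbit_tube_nbhs.
suff key Z' u' v' x : near_system eps Z' -> fixed_pair Z' u' v' -> half_tube Z' u' e x ->
   (exists psi, forward_trajectory Z' x psi) /\
   (forall psi, forward_trajectory Z' x psi -> forall t, 0 <= t -> near_orbit Z' u' v' e0 (psi t)).
  move=> x [hx|hx].
    have [h1 h2] := key _ _ _ _ nZ fp hx; split=> // psi fw t t0; exact/Ve0/h2.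
  have [[psi fw] h2] := key _ _ _ _ (near_system_conj nZ) (fixed_pair_conj fp) hx; split.
    by exists (S \o psi); have := forward_conj fw; rewrite conjZK canonSK.
  move=> psi' fw' t t0; apply: Ve0; apply: near_orbit_conjK.
  exact: (h2 _ (forward_conj fw')).
move=> nZ' fp' [t1 [tI xe side]]; have nF := ns_up nZ'.
have st := half_tube_start nZ' fp' ed tI xe side.
have [sy hy fy ly] := fixed_restart nZ' fp' tI.
have t10 : 0 <= t1 by case/andP: tI.
have [H1 H2] := HK _ _ _ _ nF st sy.
have A := flowP nF st; case/andP: (arc_tau A) => t1h hT.
rewrite ly in H2.
have KE : K * `|x - flow (upper Z') 0 (toSigma u') t1| <= K * e by rewrite ler_wpM2l// ltW.
have Nw : N (land (upper Z') t1 x - v') <= `|CN| * (K * e).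
  apply: le_trans (an_upper AN _) _; apply: (@le_trans _ _ (`|CN| * `|land (upper Z') t1 x - v'|)).
    by rewrite ler_wpM2r// ler_norm.
  by rewrite ler_wpM2l//; exact: le_trans H2 KE.
have lr : N (land (upper Z') t1 x - u0) <= rho.
  have := an_tri AN (land (upper Z') t1 x - v') (v' - u0); rewrite subrKA => h.
  apply: le_trans h _; have := fp_v fp'; have := sd_sg D; lra.
split; first exact: (forward_exists nZ' st lr).
move=> psi fw t t0.
have [h1 h2] := forward_follows nZ' st fw.
have [tt|/ltW tt] := leP (t + t1) (hit (upper Z') t1 x).
  have tI1 : t1 <= t + t1 <= hit (upper Z') t1 x by rewrite lerDr t0.
  have := h1 _ tI1; rewrite addrK => ->.
  have [s /andP[s1 s2] Hs] := H1 _ tI1.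
  rewrite fy in Hs; last first.
    rewrite s1 (le_trans s2)// hy; case/andP: (arc_tau (fixed_arc nZ' fp')) => _ /ltW //.
  exists (flow (upper Z') 0 (toSigma u') s).
    by left; exists s => //; rewrite (le_trans t10 s1) -hy.
  exact: le_trans Hs (le_trans KE eM1).
have [_ H] := HK' 0%N _ _ _ _ _ (near_system_conj nZ') (fixed_pair_conj fp') lr h2.
have := H (t - (hit (upper Z') t1 x - t1)); rewrite mul0r subr_ge0 subrK.
rewrite lerBlDr tt => /(_ isT) /near_orbit_conjK; apply: near_orbit_le.
by apply: le_trans eM2; rewrite expr0 mul1r ler_wpM2l.
Qed.

Lemma linear_mx a b (f : 'rV[R]_a -> 'rV[R]_b) :
  (forall x y : 'rV[R]_a, f (x + y) = f x + f y) ->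
  (forall (c : R) (x : 'rV[R]_a), f (c *: x) = c *: f x) ->
  exists A : 'M[R]_(a, b), forall x : 'rV[R]_a, f x = x *m A.
Proof.
move=> fD fZ; exists (\matrix_i f (delta_mx 0 i)) => x.
have f0 : f 0 = 0 by rewrite -(scale0r 0) fZ scale0r.
rewrite mulmx_sum_row [in LHS](row_sum_delta x) (big_morph f fD f0).
by apply: eq_bigr => i _; rewrite fZ rowK.
Qed.

(** Difference quotients of a contraction about [a] satisfy the same bound. *)
Lemma jacobian_contraction (P : 'rV[R]_2 -> 'rV[R]_2) a nu (c C q : R) :
  adapted_norm nu c C -> 0 <= q -> differentiable P a ->
  (exists2 e, 0 < e & forall w, `|w - a| < e -> nu (P w - P a) <= q * nu (w - a)) ->
  forall w, nu (w *m jacobian P a) <= q * nu w.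
Proof.
move=> An q0 dP [e e0 He] w; rewrite -jacobianE.
have dw : derivable P a w by exact: diff_derivable.
apply/ler_addgt0Pr => x x0.
have C1 : 0 < `|C| + 1 by rewrite ltr_wpDl.
have w1 : 0 < `|w| + 1 by rewrite ltr_wpDl.
have /(@cvgrPdist_le _ _ _ _ (dnbhs_filter _))/(_ _ (divr_gt0 x0 C1)) := dw.
move=> -[b /= b0 Hb].
pose h := Num.min b (e / (`|w| + 1)) / 2.
have mb : 0 < Num.min b (e / (`|w| + 1)) by rewrite lt_min b0 divr_gt0.
have h0 : 0 < h by rewrite divr_gt0.
have : h < Num.min b (e / (`|w| + 1)) by rewrite gtr_pMr// invf_lt1// ltr1n.
rewrite lt_min => /andP[hb he].
have := Hb h; rewrite /= sub0r normrN gtr0_norm// => /(_ hb (lt0r_neq0 h0)).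
rewrite -/(derive P a w) deriveE//; set y := h^-1 *: _ => yd.
have hw : `|h *: w + a - a| < e.
  rewrite addrK normrZ gtr0_norm//; move: he; rewrite ltr_pdivlMr//; apply: le_lt_trans.
  by rewrite ler_wpM2l ?(ltW h0)// lerDl.
have ny : nu y <= q * nu w.
  rewrite /y (an_hom An) gtr0_norm ?invr_gt0// mulrC ler_pdivrMr//.
  by apply: le_trans (He _ hw) _; rewrite addrK (an_hom An) gtr0_norm// mulrCA mulrC.
have := an_tri An y ('d P a w - y); rewrite [y + _]addrC subrK => h'.
apply: le_trans h' _; rewrite lerD//; apply: le_trans (an_upper An _) _.
apply: (@le_trans _ _ ((`|C| + 1) * `|'d P a w - y|)).
  by rewrite ler_wpM2r//; have := ler_norm C; lra.
by rewrite mulrC -ler_pdivlMr.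
Qed.

Lemma halfmap_differentiable F u : near_field X gam T k r m eps F ->
  smooth_field gam T k r L F -> N (u - u0) <= sg -> differentiable (halfmap F) u.
Proof.
move=> nF sF us.
have su := ball_start nF (half_rho us).
have A := flowP nF su.
have [|M HM] := landing_differentiable B nF sF A.
  exists (C0 * (d1 + eps)); first exact: (sd_dr D).
  move=> t tI; apply: le_trans (arc_near B nF (sd_dr D) su A tI) _.
  rewrite ler_wpM2l ?lerD2r//; first exact: le_trans ler01 C01.
  by case: su.
have toD (x y : 'rV[R]_2) : toSigma (x + y) = toSigma x + toSigma y :> 'rV[R]_3.
  by apply: vec3_inj; rewrite ?(xcD, ycD, zcD) /toSigma ?xc_vec3 ?yc_vec3 ?zc_vec3 ?mxE ?addr0.
have toZ (c : R) (x : 'rV[R]_2) : toSigma (c *: x) = c *: toSigma x :> 'rV[R]_3.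
  by apply: vec3_inj; rewrite ?(xcZ, ycZ, zcZ) /toSigma ?xc_vec3 ?yc_vec3 ?zc_vec3 ?mxE ?mulr0.
have [A1 A1E] := linear_mx toD toZ.
have fsD (x y : 'rV[R]_3) : fromSigma (S (x + y)) = fromSigma (S x) + fromSigma (S y).
  by rewrite canonSD; apply: row2_inj; rewrite !mxE inordK//= ?xcD ?ycD.
have fsZ (c : R) (x : 'rV[R]_3) : fromSigma (S (c *: x)) = c *: fromSigma (S x).
  by rewrite canonSZ; apply: row2_inj; rewrite !mxE inordK//= ?xcZ ?ycZ.
have [A2 A2E] := linear_mx fsD fsZ.
apply: (@differentiable_est _ _ _ _ _ (A1 *m M *m A2)) => e e0.
have [c c0 Hc] := HM e e0.
have C1 : 0 < `|CN| + 1 by rewrite ltr_wpDl.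
have r2 : 0 < rho / 2 by rewrite divr_gt0// (sd_rho0 D).
exists (Num.min c (rho / 2 / (`|CN| + 1))) => [|w]; first by rewrite lt_min c0 divr_gt0.
rewrite le_min => /andP[wc wr].
have wb : N (w - u0) <= rho.
  have := an_tri AN (w - u) (u - u0); rewrite subrKA => h; apply: le_trans h _.
  have h1 : N (w - u) <= rho / 2.
    apply: le_trans (an_upper AN _) _; apply: (@le_trans _ _ ((`|CN| + 1) * `|w - u|)).
      by rewrite ler_wpM2r//; have := ler_norm CN; lra.
    by rewrite mulrC -ler_pdivlMr.
  by have := sd_sg D; lra.
have Aw := flowP nF (ball_start nF wb).
have := Hc _ _ _ _ Aw; rewrite toSigma_dist => /(_ wc) h.
have -> : halfmap F w - halfmap F u - (w - u) *m (A1 *m M *m A2) =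
  fromSigma (S (flow F 0 (toSigma w) (hit F 0 (toSigma w)) - flow F 0 (toSigma u) (hit F 0 (toSigma u)) -
    (toSigma w - toSigma u) *m M)).
  rewrite /halfmap /land 2!mulmxA -A1E -A2E -toSigmaB.
  by rewrite -fromSigmaB -canonSB -fromSigmaB -canonSB.
by apply: le_trans (fromSigma_norm _) _; rewrite canonS_norm.
Qed.

Definition returnP Z u := halfmap (upper (conjZ Z)) (halfmap (upper Z) u).

Lemma near_ball_rho u : N (u - u0) <= sg -> \forall w \near u, N (w - u0) <= rho.
Proof.
move=> us; have C1 : 0 < `|CN| + 1 by rewrite ltr_wpDl.
have r2 : 0 < rho / 2 by rewrite divr_gt0// (sd_rho0 D).
apply/nbhs_ballP; exists (rho / 2 / (`|CN| + 1)); first exact: divr_gt0.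
move=> w; rewrite -ball_normE /= distrC ltr_pdivlMr// => wu.
have := an_tri AN (w - u) (u - u0); rewrite subrKA => h; apply: le_trans h _.
have h1 : N (w - u) <= rho / 2.
  apply: le_trans (an_upper AN _) _; apply: le_trans (ltW wu); rewrite mulrC ler_wpM2l//.
  by have := ler_norm CN; lra.
by have := sd_sg D; lra.
Qed.

(** The section is the disc of radius [d1] in the plane. It is met by upward
    crossings only, because the vertical speed of the field is positive there,
    while landings arrive with negative speed. *)
Lemma return_map_fixed Z u v : near_system eps Z -> fixed_pair Z u v ->
  return_map Z (orbit Z u v) u (returnP Z).
Proof.
move=> nZ fp; have nF := ns_up nZ; have nL := ns_low nZ; have m0 := ab_m0 B.
have dd1 : d < d1.
  apply: le_lt_trans (sd_dd1 D); apply: le_trans (_ : d + eps <= _).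
    by rewrite lerDl (nf_eps0 nF).
  by rewrite ler_peMl// addr_ge0// ?(nf_eps0 nF)// ltW// (sd_d0 D).
have updown (q : 'rV[R]_2) p (w : 'rV[R]_2) : `|q - u0| <= d1 -> S p = toSigma w -> `|w - u0| <= d1 -> p <> toSigma q.
  move=> qd pw wd pq; have [_ h1] := start_crossing nZ qd; have [_ h2] := land_crossing nZ pw wd.
  by move: h1 h2; rewrite pq; lra.
exists [set q | `|q - u0| < d1]; split.
- rewrite openE => q /= qd; apply/nbhs_ballP; exists (d1 - `|q - u0|); first by rewrite /= subr_gt0.
  move=> w; rewrite -ball_normE /= => qw; rewrite -(subrKA q); apply: le_lt_trans (ler_normD _ _) _.
  by rewrite distrC; move: qw; lra.
- by apply: le_lt_trans (sd_rho D (half_rho (fp_u fp))) _.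
- move=> q qd oq; case: (orbit_plane nZ fp oq (toSigma_z q)) => h.
    by rewrite -[q]toSigmaK h toSigmaK.
  exfalso; apply: (updown q (S (toSigma v)) v (ltW qd) (canonSK _)) => //.
  by apply: (d_le_d1 nF); exact: (sd_rho D (half_rho (fp_v fp))).
- apply: filterS (near_ball_rho (fp_u fp)) => q qr.
  have sq := ball_start nF qr.
  have qr' := halfmap_ball nF qr; have qr'' := halfmap_ball nL qr'.
  have [psi fw] := forward_exists nZ sq qr'.
  have [h1 fw1] := forward_follows nZ sq fw.
  have sq' := ball_start nL qr'.
  have [h2 fw2] := forward_follows (near_system_conj nZ) sq' fw1.
  rewrite -/(halfmap _ _) in fw1 h2 fw2.
  have A := flowP nF sq; have A' := flowP nL sq'.
  set a1 := hit (upper Z) 0 (toSigma q) in h1 h2 fw1 fw2 A.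
  set a2 := hit (upper (conjZ Z)) 0 (toSigma (halfmap (upper Z) q)) in h2 fw2 A'.
  have /andP[p1 _] := arc_tau A; have /andP[p2 _] := arc_tau A'.
  exists psi, (a1 + a2); split.
  + split; first exact: addr_gt0.
    by apply: trajectory_sub fw.1 => t; rewrite /= !in_itv/= andbT => /andP[].
  + exact: fw.2.
  + by have := fw2.2; rewrite canonSK !subr0 add0r [a2 + a1]addrC.
  + by apply: le_lt_trans (sd_rho D qr'') _.
  + move=> t w /andP[t0 ta] /= wd tw.
    have zt : zc (psi t) = 0 by rewrite tw toSigma_z.
    have [ta1|a1t] := ltP t a1.
      have := h1 t; rewrite (ltW t0) (ltW ta1) subr0 => /(_ isT) e.
      by have := arc_pos A (t := t); rewrite t0 ta1 -e zt ltxx => /(_ isT).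
    move: a1t; rewrite le_eqVlt => /predU1P[a1t|a1t].
      apply: (updown w (psi t) (halfmap (upper Z) q) (ltW wd)) => //; last first.
        exact: (d_le_d1 nF (sd_rho D qr')).
      by have := fw1.2; rewrite subr0 add0r -a1t.
    have := h2 (t - a1); rewrite !subr0 subrK subr_ge0 (ltW a1t) lerBlDl (ltW ta) => /(_ isT) e.
    have := arc_pos A' (t := t - a1); rewrite subr_gt0 a1t ltrBlDl ta => /(_ isT).
    by rewrite -e canonS_z zt oppr0 ltxx.
Qed.

Lemma returnP_differentiable Z u v : near_system eps Z -> fixed_pair Z u v -> differentiable (returnP Z) u.
Proof.
move=> nZ fp; apply: differentiable_comp.
  exact: (halfmap_differentiable (ns_up nZ) (ns_smooth_up nZ) (fp_u fp)).
rewrite (fp_uv fp); exact: (halfmap_differentiable (ns_low nZ) (ns_smooth_low nZ) (fp_v fp)).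
Qed.

Lemma returnP_contracts Z u w : near_system eps Z -> N (u - u0) <= rho -> N (w - u0) <= rho ->
  N (returnP Z w - returnP Z u) <= th * N (w - u).
Proof.
move=> nZ ur wr; have th0 := sd_th0 D; have th1 := sd_th1 D.
have nF := ns_up nZ; have nL := ns_low nZ.
apply: le_trans (sd_contr D nL _ _) _.
- exact/(sd_rho D)/(halfmap_ball nF).
- exact/(sd_rho D)/(halfmap_ball nF).
rewrite ler_wpM2l//; apply: le_trans (sd_contr D nF (sd_rho D wr) (sd_rho D ur)) _.
by rewrite ler_piMl ?an_ge0// ltW.
Qed.

Definition swap u : 'rV[R]_2 := fromSigma (S (toSigma u)).

Lemma toSigma_swap u : toSigma (swap u) = S (toSigma u).
Proof. by rewrite fromSigmaK// canonS_z toSigma_z oppr0. Qed.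

Lemma swapK : involutive swap.
Proof. by move=> u; rewrite -[LHS]toSigmaK !toSigma_swap canonSK toSigmaK. Qed.

Lemma swapB u v : swap (u - v) = swap u - swap v.
Proof. by rewrite /swap toSigmaB canonSB fromSigmaB. Qed.

Lemma swap_norm u : `|swap u| = `|u|.
Proof. by rewrite -toSigma_norm toSigma_swap canonS_norm toSigma_norm. Qed.

Lemma swapZ (c : R) u : swap (c *: u) = c *: swap u.
Proof.
by apply: row2_inj; rewrite !mxE inordK//= ?canonS_x ?canonS_y /toSigma ?xc_vec3 ?yc_vec3 !mxE mulrN.
Qed.

Lemma swapD u v : swap (u + v) = swap u + swap v.
Proof.
have swapN w : swap (- w) = - swap w by rewrite -scaleN1r swapZ scaleN1r.
by rewrite -[v]opprK swapB opprK swapN opprK.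
Qed.

Lemma swap_differentiable u : differentiable swap u.
Proof.
have [A AE] := linear_mx swapD swapZ.
apply: (@differentiable_est _ _ _ _ _ A) => e e0; exists 1 => // x _.
by rewrite -AE swapB subrr normr0 mulr_ge0// ltW.
Qed.

(** At the downward crossing point the return map is the one at the upward
    crossing point of the conjugate system, read through the symmetry. *)
Lemma return_map_conj Z g u P : return_map (conjZ Z) (S @^-1` g) u P ->
  return_map Z g (swap u) (swap \o P \o swap).
Proof.
move=> [S0 [oS Su Sg H]].
have sc : continuous swap by move=> x; exact/differentiable_continuous/swap_differentiable.
exists (swap @^-1` S0); split.
- by apply: open_comp => // x _; exact: sc.
- by rewrite /preimage/= swapK.
- move=> q Sq gq; rewrite -[q]swapK; congr swap; apply: Sg => //.
  by rewrite /preimage/= toSigma_swap canonSK.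
- have H' : \forall q \near swap u, exists phi tau,
     [/\ 0 < tau /\ trajectory (conjZ Z) `[0, tau]%classic phi, phi 0 = toSigma (swap q),
         phi tau = toSigma (P (swap q)), S0 (P (swap q)) & forall t (x : 'rV[R]_2), 0 < t < tau -> S0 x -> phi t <> toSigma x].
    have := sc (swap u); rewrite /continuous_at swapK => h; exact: h H.
  apply: filterS H' => q [phi [tau [[tau0 tr] p0 pt SP Hn]]].
  exists (S \o phi), tau; split.
  + by split => //; have := trajectory_conj tr; rewrite conjZK.
  + by rewrite /= p0 toSigma_swap canonSK.
  + by rewrite /= pt toSigma_swap.
  + by rewrite /preimage/= swapK.
  + move=> t x tI Sx /= h; apply: (Hn t (swap x) tI Sx).
    by rewrite toSigma_swap -h canonSK.
Qed.

Lemma adapted_swap : adapted_norm (N \o swap) cN CN.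
Proof.
split=> /=.
- by move=> a b; rewrite swapD; exact: (an_tri AN).
- by move=> h a; rewrite swapZ (an_hom AN).
- exact: (an_c0 AN).
- by move=> v; rewrite -swap_norm; exact: (an_lower AN).
- by move=> v; rewrite -swap_norm; exact: (an_upper AN).
Qed.

Lemma orbit_hyperbolic Z u v : near_system eps Z -> fixed_pair Z u v -> hyperbolic Z (orbit Z u v).
Proof.
move=> nZ fp p op; have th0 := sd_th0 D; have th1 := sd_th1 D.
have zp := toSigma_z p.
case: (orbit_plane nZ fp op zp) => pe.
  have -> : p = u by rewrite -[p]toSigmaK pe toSigmaK.
  exists (returnP Z); split; first exact: return_map_fixed.
    exact: returnP_differentiable nZ fp.
  apply: (contracting_eigenvalue th0 th1 (an_c0 AN) (an_lower AN)).
  apply: (jacobian_contraction AN th0 (returnP_differentiable nZ fp)).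
  have /nbhs_ballP[e /= e0 He] := near_ball_rho (fp_u fp).
  exists e => // w we; apply: returnP_contracts => //; first exact: half_rho (fp_u fp).
  by apply: He; rewrite -ball_normE /= distrC.
have -> : p = swap v by rewrite -[p]toSigmaK pe.
have nZ' := near_system_conj nZ; have fp' := fixed_pair_conj fp.
have dP : differentiable (swap \o returnP (conjZ Z) \o swap) (swap v).
  apply: differentiable_comp; first exact: swap_differentiable.
  apply: differentiable_comp; last exact: swap_differentiable.
  rewrite swapK; exact: returnP_differentiable nZ' fp'.
exists (swap \o returnP (conjZ Z) \o swap); split => //.
  apply: return_map_conj.
  have -> : S @^-1` orbit Z u v = orbit (conjZ Z) v u.
    apply/seteqP; split => x; rewrite /preimage/=.
      by move=> /orbit_conj; rewrite canonSK.
    by move=> /orbit_conj; rewrite conjZK.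
  exact: return_map_fixed.
have An := adapted_swap.
apply: (contracting_eigenvalue th0 th1 (an_c0 An) (an_lower An)).
apply: (jacobian_contraction An th0 dP).
have /nbhs_ballP[e /= e0 He] := near_ball_rho (fp_v fp).
exists e => // w we /=; rewrite -!swapB !swapK.
rewrite [N (swap _)](_ : _ = N (swap w - v)); last by rewrite swapB swapK.
apply: returnP_contracts => //; first exact: half_rho (fp_v fp).
by apply: He; rewrite -ball_normE /= distrC -swap_norm swapB swapK.
Qed.

Lemma orbit_tube_attracted : exists2 e, 0 < e & forall Z u v x psi, near_system eps Z -> fixed_pair Z u v ->
  orbit_tube Z u v e x -> forward_trajectory Z x psi ->
  forall e, 0 < e -> exists c, forall t, c <= t -> near_orbit Z u v e (psi t).
Proof.
have [K K0 HK] := arc_compare.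
have rs : 0 < rho / 2 by rewrite divr_gt0// (sd_rho0 D).
have dd : 0 < d1 - C0 * (d + eps) by rewrite subr_gt0 (sd_dd1 D).
pose M3 := `|CN| * K + 1.
have M30 : 0 < M3 by rewrite ltr_wpDl// mulr_ge0.
pose e := Num.min (rho / 2 / M3) (d1 - C0 * (d + eps)).
have ep : 0 < e by rewrite lt_min dd andbT; exact: divr_gt0.
have eM3 : `|CN| * (K * e) <= rho / 2.
  have : e * M3 <= rho / 2 by rewrite -ler_pdivlMr// /e !ge_min lexx.
  move=> h; apply: le_trans h; rewrite /M3.
  rewrite (_ : e * (`|CN| * K + 1) = `|CN| * (K * e) + e); last by ring.
  by rewrite lerDl ltW.
have ed : e <= d1 - C0 * (d + eps) by rewrite /e !ge_min lexx !orbT.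
exists e => //.
suff key Z u v x psi : near_system eps Z -> fixed_pair Z u v -> half_tube Z u e x ->
    forward_trajectory Z x psi ->
    forall e, 0 < e -> exists c, forall t, c <= t -> near_orbit Z u v e (psi t).
  move=> Z u v x psi nZ fp [hx|hx] fw e' e'0; first exact: (key _ _ _ _ _ nZ fp hx fw).
  have [c Hc] := key _ _ _ _ _ (near_system_conj nZ) (fixed_pair_conj fp) hx (forward_conj fw) e' e'0.
  by exists c => t /Hc /near_orbit_conjK.
move=> nZ fp [t1 [tI xe side]]; have nF := ns_up nZ.
have st := half_tube_start nZ fp ed tI xe side.
have [sy hy fy ly] := fixed_restart nZ fp tI.
have [_ H2] := HK _ _ _ _ nF st sy; rewrite ly in H2.
apply: (start_attracted nZ fp st).
have Nw : N (land (upper Z) t1 x - v) <= rho / 2.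
  apply: le_trans (an_upper AN _) _; apply: (@le_trans _ _ (`|CN| * `|land (upper Z) t1 x - v|)).
    by rewrite ler_wpM2r// ler_norm.
  apply: le_trans eM3; rewrite ler_wpM2l//; apply: le_trans H2 _.
  by rewrite ler_wpM2l// ltW.
have := an_tri AN (land (upper Z) t1 x - v) (v - u0); rewrite subrKA => h.
by apply: le_trans h _; have := fp_v fp; have := sd_sg D; lra.
Qed.

Lemma orbit_in_basin Z u v : near_system eps Z -> fixed_pair Z u v -> orbit Z u v `<=` basin.
Proof.
move=> nZ fp.
have key Z' u' v' t : near_system eps Z' -> fixed_pair Z' u' v' -> 0 <= t < hit (upper Z') 0 (toSigma u') ->
    half_basin (flow (upper Z') 0 (toSigma u') t).
  move=> nZ' fp' /andP[t0 th']; have A := fixed_arc nZ' fp'.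
  have := sd_orbit D (ns_up nZ') (fp_u fp') (t := t); rewrite t0 (ltW th') => /(_ isT).
  move=> [s [/andP[s0 sT] ts] Hs]; exists s => //; split=> //.
    by rewrite s0 (le_trans sT)// lerDl ltW// (ab_k0 B).
  move: t0; rewrite le_eqVlt => /predU1P[te|t0]; last by left; apply: (arc_pos A); rewrite t0.
  by right; rewrite ts// -te (arc0 A) toSigma_z.
have key2 Z' u' v' t : near_system eps Z' -> fixed_pair Z' u' v' -> 0 <= t <= hit (upper Z') 0 (toSigma u') ->
    basin (flow (upper Z') 0 (toSigma u') t).
  move=> nZ' fp' /andP[t0]; rewrite le_eqVlt => /predU1P[->|th']; last by left; apply: (key _ _ v'); rewrite ?t0.
  right; rewrite (fixed_land nZ' fp').
  have A' := fixed_arc (near_system_conj nZ') (fixed_pair_conj fp').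
  rewrite -(arc0 A'); apply: (key _ _ u' 0 (near_system_conj nZ') (fixed_pair_conj fp')).
  by rewrite lexx; case/andP: (arc_tau A') => ->.
move=> x [[t tI ->]|[t tI Sx]]; first exact: (key2 _ _ v).
have := key2 _ _ _ _ (near_system_conj nZ) (fixed_pair_conj fp) tI; rewrite -Sx.
by rewrite /basin/= canonSK => -[]; [right|left].
Qed.

Hypothesis gam_pos : forall t, 0 < t < T -> 0 < zc (gam t).

(** Only the two crossing points require an argument. There a nearby point is
    above, on or below the plane, and belongs to the tube of the upper arc or to
    the image under the symmetry of that tube, the end of one arc being the
    beginning of the other. *)
Lemma basin_nbhs : set_nbhs [set x | exists2 t, 0 <= t <= T & x = gam t \/ S x = gam t] basin.
Proof.
have dU0 := sd_dU0 D; have k0 := ab_k0 B.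
have dist_nbhs (y : 'rV[R]_3) c : 0 < c -> \forall x \near y, `|x - y| < c.
  move=> c0; apply/nbhs_ballP; exists c => // x; rewrite -ball_normE /= distrC //.
have zpos (y : 'rV[R]_3) : 0 < zc y -> \forall x \near y, 0 < zc x.
  move=> zy; near=> x.
  have : `|x - y| < zc y by near: x; exact: dist_nbhs.
  move/(le_lt_trans (zc_norm _)); rewrite zcB ltr_norml => /andP[+ _]; lra.
have startU t x : 0 <= t <= T -> `|x - gam t| < dU -> 0 < zc x \/ zc x = 0 /\ t = 0 -> half_basin x.
  move=> /andP[t0 tT] xt side; exists t => //; split => //; last exact: ltW.
  by rewrite t0 (le_trans tT)// lerDl ltW.
have key t : 0 <= t <= T -> nbhs (gam t) basin.
  move=> /andP[t0 tT].
  move: t0; rewrite le_eqVlt => /predU1P[<-|t0].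
    near=> x; have xg : `|x - gam 0| < dU by near: x; exact: dist_nbhs.
    case: (ltgtP (zc x) 0) => zx.
    - right; apply: (startU T); [by rewrite lexx ltW| |by left; rewrite canonS_z oppr_gt0].
      by rewrite -[gam T]canonSK gamT canonS_dist.
    - by left; apply: (startU 0) => //; [rewrite lexx ltW|left].
    - by left; apply: (startU 0) => //; [rewrite lexx ltW|right].
  move: tT; rewrite le_eqVlt => /predU1P[->|tT].
    near=> x; have xg : `|x - gam T| < dU by near: x; exact: dist_nbhs.
    have Sxg : `|S x - gam 0| < dU by rewrite -gamT canonS_dist.
    case: (ltgtP (zc x) 0) => zx.
    - right; apply: (startU 0) => //; [by rewrite lexx ltW|by left; rewrite canonS_z oppr_gt0].
    - by left; apply: (startU T) => //; [rewrite lexx ltW|left].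
    - by right; apply: (startU 0) => //; [rewrite lexx ltW|right; rewrite canonS_z zx oppr0].
  near=> x; left; apply: (startU t); first by rewrite !ltW.
    by near: x; exact: dist_nbhs.
  by left; near: x; apply/zpos/gam_pos; rewrite t0.
move=> y [t tI [->|Sy]]; first exact: key.
have := key t tI; rewrite -Sy => /near_S; apply: filterS => x.
by rewrite /basin/= canonSK => -[]; [right|left].
Unshelve. all: by end_near. Qed.

Lemma perturbed_cycle Z : near_system eps Z -> exists gt, [/\ simple_crossing_limit_cycle Z gt, gt `<=` basin,
  forall g', simple_crossing_limit_cycle Z g' -> g' `<=` basin -> g' = gt,
  hyperbolic Z gt & orbitally_asymptotically_stable Z gt].
Proof.
move=> nZ; have [u [v fp]] := fixed_pair_exists nZ.
have [cyc simp] := orbit_cycle nZ fp.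
have [e e0 He] := orbit_tube_attracted.
have oN := orbit_tube_nbhs nZ fp e0.
exists (orbit Z u v); split.
- split => //; exists (orbit_tube Z u v e) => // g' pg' g'V.
  by apply: (periodic_attracted nZ fp _ pg' g'V) => x psi Vx; exact: He.
- exact: orbit_in_basin.
- move=> g' [[pg' _ _] _ _] g'U.
  by apply: (periodic_attracted nZ fp _ pg' g'U) => x psi Ux; exact: basin_attracted.
- exact: orbit_hyperbolic.
- split; first exact: orbit_stable.
  exists (orbit_tube Z u v e) => // p phi Wp fw e1 e10.
  have [c Hc] := He _ _ _ _ _ nZ fp Wp fw _ (divr_gt0 e10 (ltr0n R 2)).
  exists c; split; first exact: num_real.
  move=> t /ltW /Hc [y oy yd]; exists y => //.
  by apply: le_lt_trans yd _; rewrite gtr_pMr// invf_lt1// ltr1n.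
Qed.

End Dynamics.

(** * Choice of the constants *)

Section SmallData.
Variable R : realType.

(** Finitely many smallness requirements can be met at once. *)
Lemma small_scale (s : seq (R * R)) : (forall x, x \in s -> 0 < x.2) ->
  exists2 e, 0 < e & forall x, x \in s -> x.1 * e <= x.2.
Proof.
move=> s0; suff [e e0 He] : exists2 e, 0 < e & forall x, x \in s -> `|x.1| * e <= x.2.
  by exists e => // x /He; apply: le_trans; rewrite ler_wpM2r ?ler_norm// ltW.
elim: s s0 => [|x s IH] s0; first by exists 1.
have [|e e0 He] := IH; first by move=> y ys; apply: s0; rewrite inE ys orbT.
have x1 : 0 < `|x.1| + 1 by rewrite ltr_wpDl.
have x2 : 0 < x.2 by apply: s0; rewrite mem_head.
exists (Num.min e (x.2 / (`|x.1| + 1))) => [|y]; first by rewrite lt_min e0 divr_gt0.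
rewrite inE => /predU1P[->|ys].
  apply: (@le_trans _ _ ((`|x.1| + 1) * (x.2 / (`|x.1| + 1)))).
    apply: ler_pM; rewrite ?lerDl ?ge_min ?lexx ?orbT//.
    by rewrite le_min (ltW e0) ltW// divr_gt0.
  by rewrite mulrC divfK// gt_eqF.
by apply: le_trans (He y ys); rewrite ler_wpM2l// ge_min lexx.
Qed.

Variables (X : 'rV[R]_3 -> 'rV[R]_3) (L : R) (gam : R -> 'rV[R]_3) (T k r m : R).
Hypothesis B : arc_base X L gam T k r m.
Variable u0 : 'rV[R]_2.
Hypotheses (gam0 : gam 0 = toSigma u0) (gamT : canonS (gam T) = gam 0).
Variables (A : 'M[R]_3) (E : R -> 'M[R]_3).
Hypothesis XA : forall p q, X p - X q = (p - q) *m A.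
Hypothesis E0 : E 0 = 1%:M.
Hypothesis dE : forall (d : 'rV[R]_3) (t : R), is_derive t 1 (fun t => d *m E t) (d *m E t *m A).
Variables (N : 'rV[R]_2 -> R) (cN CN : R).
Hypothesis AN : adapted_norm N cN CN.

(** Derivative of the unperturbed half-return map: the linearized flow up to the
    landing time, the projection along the field at the landing point, and the
    symmetry. *)
Definition half_derivative (v : 'rV[R]_2) : 'rV[R]_2 :=
  fromSigma (canonS (proj_along (X (gam T)) (toSigma v *m E T))).

Variable th0 : R.
Hypotheses (th00 : 0 <= th0) (th01 : th0 < 1).
Hypothesis contr : forall v, N (half_derivative v) <= th0 * N v.

Local Notation C0 := (gconst 3 (L + 1) (T + k)).

Let Tk0 : 0 < T + k.
Proof. have := ab_k0 B; have := ab_kT B; lra. Qed.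

Let plane_near u d : `|u - u0| <= d -> arc_start gam T k d 0 (toSigma u).
Proof.
move=> ud; split; first by rewrite lexx ltW.
  by rewrite gam0 toSigma_dist.
by right; rewrite toSigma_z.
Qed.

Lemma halfmap_linearized : exists2 C, 0 <= C & forall eps F d u v,
  near_field X gam T k r m eps F -> 0 <= d -> C0 * (d + eps) < r ->
  `|u - u0| <= d -> `|v - u0| <= d ->
  `|halfmap gam T k r F u - halfmap gam T k r F v - half_derivative (u - v)| <= C * (d + eps) * `|u - v|.
Proof.
have [C C_0 HC] := landing_linearized B XA E0 dE; exists C => // eps F d u v nF d0 dr ud vd.
have su := plane_near ud; have sv := plane_near vd.
have := HC _ _ _ _ _ _ _ _ _ nF d0 dr sv su (flow_spec B nF dr sv) (flow_spec B nF dr su).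
rewrite -toSigmaB toSigma_norm; apply: le_trans.
rewrite /halfmap /land /half_derivative -fromSigmaB -canonSB -fromSigmaB -canonSB.
by apply: le_trans (fromSigma_norm _) _; rewrite canonS_norm.
Qed.

Lemma land_near : exists2 C, 0 <= C & forall eps F d t0 p,
  near_field X gam T k r m eps F -> C0 * (d + eps) < r -> arc_start gam T k d t0 p -> t0 <= T ->
  `|land gam T k r F t0 p - u0| <= C * (`|p - gam t0| + eps).
Proof.
have [C C_0 HC] := landing_near B; exists C => // eps F d t0 p nF dr st tT.
apply: le_trans (HC _ _ _ _ _ _ _ nF dr st tT (flow_spec B nF dr st)).
have -> : u0 = fromSigma (canonS (gam T)) by rewrite gamT gam0 toSigmaK.
rewrite /land -fromSigmaB -canonSB.
by apply: le_trans (fromSigma_norm _) _; rewrite canonS_norm.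
Qed.

Lemma flow_near : exists2 C, 0 <= C & forall eps F d u t,
  near_field X gam T k r m eps F -> C0 * (d + eps) < r -> `|u - u0| <= d ->
  0 <= t <= hit gam T k r F 0 (toSigma u) ->
  exists2 t0, 0 <= t0 <= T /\ (t = 0 -> t0 = 0) &
    `|flow gam T k r F 0 (toSigma u) t - gam t0| <= C * (`|u - u0| + eps).
Proof.
have [G G0 [_ HG]] := gam_speed B.
have k0 := ab_k0 B; have kT := ab_kT B; have m0 := ab_m0 B.
have C01 : 0 <= C0 by apply: le_trans ler01 (C0_ge1 B).
exists (C0 + G * (C0 / m)); first by rewrite addr_ge0// mulr_ge0// divr_ge0// ltW.
move=> eps F d u t nF dr ud /andP[t0 th].
have su := plane_near ud; have Au := flow_spec B nF dr su.
have /andP[_ hT] := arc_tau Au.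
have tI : 0 <= t <= T + k by rewrite t0 (le_trans th)// ltW.
have h1 := arc_near B nF dr su Au tI.
rewrite gam0 toSigma_dist in h1.
have eps0 := nf_eps0 nF.
have ue : 0 <= `|u - u0| + eps by rewrite addr_ge0.
have [tT|Tt] := leP t T.
  exists t; first by rewrite t0.
  by apply: le_trans h1 _; rewrite ler_wpM2r// lerDl mulr_ge0// divr_ge0// ltW.
exists T; first by split; [rewrite lexx andbT; lra|lra].
have T0 : 0 <= T by lra.
have h2 := arc_hit_near B nF dr su Au T0; rewrite gam0 toSigma_dist in h2.
rewrite -(subrKA (gam t)); apply: le_trans (ler_normD _ _) _.
rewrite mulrDl; apply: lerD h1 _.
apply: le_trans (HG _ _ _ tI) _; first by rewrite T0/=; lra.
rewrite -mulrA ler_wpM2l// mulrAC ler_pdivlMr// mulrC; apply: le_trans h2.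
by rewrite ler_pM2l// gtr0_norm ?subr_gt0//; apply: le_trans (ler_norm _); rewrite lerB.
Qed.

(** The sizes are chosen in the order [d1], [d], [rho], [dU], [eps], each small
    in terms of the preceding ones; [sg] is the multiple of [eps] by which the
    half-return maps move the unperturbed fixed point, divided by [1 - th]. *)
Lemma small_data_exists : exists eps d1 d rho sg dU th, [/\ 0 < eps, eps <= 1, eps <= m &
  small_data X L gam T k r m u0 N eps d1 d rho sg dU th].
Proof.
have [C1 C10 H1] := halfmap_linearized; have [C2 C20 H2] := land_near.
have [C3 C30 H3] := flow_near.
have m0 := ab_m0 B; have r0 := ab_r0 B; have cN0 := an_c0 AN.
have [C CE C_1] : exists2 C, C = C0 & 1 <= C by exists C0 => //; exact: (C0_ge1 B).
rewrite -CE in H1 H2 H3.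
have C_0 : 0 < C by lra.
have [CC CCE] : exists CC : R, CC = `|CN| + 1 by exists (`|CN| + 1).
have CC0 : 0 < CC by rewrite CCE ltr_wpDl.
have NCC v : N v <= CC * `|v|.
  by apply: le_trans (an_upper AN v) _; rewrite ler_wpM2r// CCE; have := ler_norm CN; lra.
have [th thE] : exists th : R, th = (1 + th0) / 2 by exists ((1 + th0) / 2).
have th_1 : 0 < 1 - th by rewrite thE; have := th01; lra.
have [sc scE] : exists x : R, x = CC * C2 / (1 - th) by exists (CC * C2 / (1 - th)).
have sc0 : 0 <= sc by rewrite scE divr_ge0 ?mulr_ge0// ltW.
have [d1 d1E] : exists x : R, x = r / (2 * C) by exists (r / (2 * C)).
have d10 : 0 < d1 by rewrite d1E divr_gt0// mulr_gt0.
have Cd1 : C * d1 = r / 2 by rewrite d1E; field; rewrite gt_eqF.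
have [|d d0 Hd] := @small_scale [:: (C, d1 / 2); (CC * C1 / cN, (1 - th0) / 4)].
  by move=> x; rewrite !inE => /orP[]/eqP-> /=; have := th01; lra.
have d_1 : C * d <= d1 / 2 by apply: (Hd (C, d1 / 2)); rewrite !inE eqxx.
have d_2 : CC * C1 / cN * d <= (1 - th0) / 4.
  by apply: (Hd (CC * C1 / cN, (1 - th0) / 4)); rewrite !inE eqxx orbT.
have [rho rhoE] : exists x : R, x = cN * d by exists (cN * d).
have rho0 : 0 < rho by rewrite rhoE mulr_gt0.
have [|dU dU0 HdU] := @small_scale [:: (1, d); (CC * C2, rho / 2)].
  by move=> x; rewrite !inE => /orP[]/eqP-> /=; lra.
have dU_1 : 1 * dU <= d by apply: (HdU (1, d)); rewrite !inE eqxx.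
have dU_2 : CC * C2 * dU <= rho / 2 by apply: (HdU (CC * C2, rho / 2)); rewrite !inE eqxx orbT.
have [|eps e0 He] := @small_scale [:: (1, 1); (1, m); (C, r / 4); (C, d1 / 4);
   (CC * C1 / cN, (1 - th0) / 4); (sc, rho / 2); (CC * C2, rho / 2); (C3 * (sc / cN + 1), dU)].
  by move=> x; rewrite !inE => /or4P[/eqP->|/eqP->|/eqP->|/or4P[/eqP->|/eqP->|/eqP->|/orP[]/eqP->]] //=;
    by rewrite divr_gt0// subr_gt0.
have get x : x \in [:: (1, 1); (1, m); (C, r / 4); (C, d1 / 4);
   (CC * C1 / cN, (1 - th0) / 4); (sc, rho / 2); (CC * C2, rho / 2); (C3 * (sc / cN + 1), dU)] ->
   x.1 * eps <= x.2 by exact: He.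
have e_1 : 1 * eps <= 1 by apply: (get (1, 1)); rewrite !inE eqxx.
have e_m : 1 * eps <= m by apply: (get (1, m)); rewrite !inE eqxx !orbT.
have e_r : C * eps <= r / 4 by apply: (get (C, r / 4)); rewrite !inE eqxx !orbT.
have e_d : C * eps <= d1 / 4 by apply: (get (C, d1 / 4)); rewrite !inE eqxx !orbT.
have e_c : CC * C1 / cN * eps <= (1 - th0) / 4.
  by apply: (get (CC * C1 / cN, (1 - th0) / 4)); rewrite !inE eqxx !orbT.
have e_s : sc * eps <= rho / 2 by apply: (get (sc, rho / 2)); rewrite !inE eqxx !orbT.
have e_U : CC * C2 * eps <= rho / 2 by apply: (get (CC * C2, rho / 2)); rewrite !inE eqxx !orbT.
have e_o : C3 * (sc / cN + 1) * eps <= dU.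
  by apply: (get (C3 * (sc / cN + 1), dU)); rewrite !inE eqxx !orbT.
clear get He Hd HdU.
have dd1 : C * (d + eps) < d1 by rewrite mulrDr; lra.
have de1 : d + eps <= C * (d + eps) by rewrite ler_peMl// addr_ge0// ltW.
have ded1 : d <= d1 by lra.
have d1r : C * (d1 + eps) < r by rewrite mulrDr; lra.
have dr : C * (d + eps) < r.
  by apply: le_lt_trans d1r; rewrite ler_wpM2l ?lerD2r// ltW.
exists eps, d1, d, rho, (sc * eps), dU, th; split => //; [by rewrite -[eps]mul1r|by rewrite -[eps]mul1r|].
split; rewrite -?CE => //.
- move=> v vr; rewrite -(ler_pM2l cN0) -rhoE; exact: le_trans (an_lower AN v) vr.
- by rewrite thE; have := th00; lra.
- by rewrite -subr_gt0.
- move=> F u v nF ud vd.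
  have := an_tri AN (halfmap gam T k r F u - halfmap gam T k r F v - half_derivative (u - v)) (half_derivative (u - v)).
  rewrite subrK => h; apply: le_trans h _.
  apply: le_trans (lerD (NCC _) (contr _)) _.
  have h1 := H1 _ _ _ _ _ nF (ltW d0) dr ud vd.
  apply: (@le_trans _ _ ((CC * C1 / cN * (d + eps)) * N (u - v) + th0 * N (u - v))).
    rewrite lerD2r; apply: (@le_trans _ _ (CC * (C1 * (d + eps) * `|u - v|))).
      by rewrite ler_pM2l.
    rewrite (_ : CC * C1 / cN * (d + eps) * N (u - v) = CC * (C1 * (d + eps) * (N (u - v) / cN))); last by ring.
    rewrite ler_pM2l// ler_wpM2l//; first by rewrite mulr_ge0// addr_ge0// ltW.
    exact: (an_norm AN).
  rewrite -mulrDl ler_wpM2r ?(an_ge0 AN)// mulrDr thE; lra.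
- by rewrite mulr_ge0// ltW.
- move=> F nF.
  have s0 : arc_start gam T k d 0 (toSigma u0) by apply: plane_near; rewrite subrr normr0 ltW.
  have T0 : 0 <= T by have := ab_k0 B; have := ab_kT B; lra.
  have := H2 _ _ _ _ _ nF dr s0 T0; rewrite -gam0 subrr normr0 add0r => h.
  apply: le_trans (NCC _) _; rewrite (_ : _ * (sc * eps) = CC * (C2 * eps)).
    by rewrite ler_pM2l// /halfmap -gam0.
  by rewrite scE; field; rewrite gt_eqF.
- by rewrite -[dU]mul1r.
- move=> F t0 p nF t0T [h1 h2 h3].
  have s0 : arc_start gam T k d t0 p by split => //; lra.
  have := H2 _ _ _ _ _ nF dr s0 t0T => h; apply: le_trans (NCC _) _.
  apply: (@le_trans _ _ (CC * (C2 * (dU + eps)))).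
    by rewrite ler_pM2l//; apply: le_trans h _; rewrite ler_wpM2l// lerD2r.
  by rewrite mulrA mulrDr; lra.
- move=> F u t nF ur tI.
  have us : `|u - u0| <= sc / cN * eps.
    apply: le_trans (an_norm AN _) _; rewrite mulrAC ler_wpM2r// invr_ge0 ltW//.
  have ud : `|u - u0| <= d.
    apply: le_trans us _; rewrite mulrAC ler_pdivrMr// [d * cN]mulrC -rhoE.
    by apply: le_trans e_s _; rewrite ler_pdivrMr// ler_pMr//; lra.
  have [s sI Hs] := H3 _ _ _ _ _ nF dr ud tI; exists s => //.
  apply: le_trans Hs _; apply: le_trans e_o; rewrite -mulrA ler_wpM2l// mulrDl mul1r lerD2r//.
Qed.

End SmallData.

(** * A norm adapted to the derivative *)

Section AdaptedNorm.
Variable R : realType.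

Definition qform (P Q S x y : R) : R := P * x ^+ 2 + 2 * Q * (x * y) + S * y ^+ 2.

Lemma qform_lower (P Q S : R) : 0 < P -> Q ^+ 2 < P * S ->
  exists2 d, 0 < d & forall x y, d * (x ^+ 2 + y ^+ 2) <= qform P Q S x y.
Proof.
move=> P0 QPS.
have S0 : 0 < S by rewrite -(pmulr_rgt0 _ P0); apply: le_lt_trans QPS; exact: sqr_ge0.
have PS : 0 < P + S by rewrite addr_gt0.
(* determinant over trace: below the smaller eigenvalue *)
have [d dE] : exists d, d = (P * S - Q ^+ 2) / (P + S) by eexists.
have d0 : 0 < d by rewrite dE divr_gt0// subr_gt0.
exists d => // x y; rewrite -subr_ge0.
have Pd : 0 < P - d.
  have -> : P - d = (P ^+ 2 + Q ^+ 2) / (P + S) by rewrite dE; field; rewrite gt_eqF.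
  by rewrite divr_gt0// ltr_pwDl ?sqr_ge0// exprn_gt0.
rewrite -(pmulr_rge0 _ Pd).
have -> : (P - d) * (qform P Q S x y - d * (x ^+ 2 + y ^+ 2)) =
   ((P - d) * x + Q * y) ^+ 2 + d ^+ 2 * y ^+ 2 + (P * S - Q ^+ 2 - d * (P + S)) * y ^+ 2.
  by rewrite /qform; ring.
rewrite [X in _ + X * _](_ : _ = 0); last by rewrite dE divfK ?subrr// gt_eqF.
by rewrite mul0r addr0 addr_ge0 ?sqr_ge0// mulr_ge0 ?sqr_ge0.
Qed.

Lemma qform_upper (P Q S : R) : exists2 C, 0 < C & forall x y, qform P Q S x y <= C * (x ^+ 2 + y ^+ 2).
Proof.
exists (`|P| + `|Q| + `|S| + 1) => [|x y]; first by rewrite ltr_wpDl// !addr_ge0.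
have x0 := sqr_ge0 x; have y0 := sqr_ge0 y.
have h : `|2 * (x * y)| <= x ^+ 2 + y ^+ 2.
  have := sqr_ge0 (x - y); have := sqr_ge0 (x + y); rewrite ler_norml sqrrD sqrrB => h1 h2.
  by apply/andP; split; lra.
have hQ : 2 * Q * (x * y) <= `|Q| * (x ^+ 2 + y ^+ 2).
  have -> : 2 * Q * (x * y) = Q * (2 * (x * y)) by ring.
  by apply: le_trans (ler_norm _) _; rewrite normrM ler_wpM2l.
have hP : P * x ^+ 2 <= `|P| * x ^+ 2 by rewrite ler_wpM2r ?ler_norm.
have hS : S * y ^+ 2 <= `|S| * y ^+ 2 by rewrite ler_wpM2r ?ler_norm.
have h1 : 0 <= `|P| * y ^+ 2 by rewrite mulr_ge0.
have h2 : 0 <= `|S| * x ^+ 2 by rewrite mulr_ge0.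
rewrite /qform; lra.
Qed.

(** Minkowski's inequality; the discriminant condition comes for free from
    positivity, which is tested at the vector [(- Q, P)]. *)
Lemma qform_triangle (P Q S x y x' y' : R) : 0 < P -> (forall x y, 0 <= qform P Q S x y) ->
  Num.sqrt (qform P Q S (x + x') (y + y')) <=
  Num.sqrt (qform P Q S x y) + Num.sqrt (qform P Q S x' y').
Proof.
move=> P0 pos.
have disc : 0 <= P * S - Q ^+ 2.
  rewrite -(pmulr_rge0 _ P0); have := pos (- Q) P; rewrite /qform; congr (0 <= _); ring.
set a := qform P Q S x y; set b := qform P Q S x' y'.
have a0 : 0 <= a by exact: pos.
have b0 : 0 <= b by exact: pos.
pose B := P * (x * x') + Q * (x * y' + x' * y) + S * (y * y').
have BE : B ^+ 2 <= a * b.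
  rewrite -subr_ge0 (_ : _ - _ = (P * S - Q ^+ 2) * (x * y' - y * x') ^+ 2); last first.
    by rewrite /a /b /B /qform; ring.
  by rewrite mulr_ge0// sqr_ge0.
have Bs : B <= Num.sqrt a * Num.sqrt b.
  by rewrite -sqrtrM//; apply: le_trans (ler_norm _) _; rewrite -sqrtr_sqr ler_wsqrtr.
have s0 : 0 <= Num.sqrt a + Num.sqrt b by rewrite addr_ge0 ?sqrtr_ge0.
rewrite -[leRHS](ger0_norm s0) -sqrtr_sqr ler_wsqrtr// sqrrD !sqr_sqrtr//.
have -> : qform P Q S (x + x') (y + y') = a + 2 * B + b by rewrite /a /b /B /qform; ring.
lra.
Qed.

(** With [x] the second coordinate, [y] the first one divided by [f], and
    [d = e f], the map in question is [(x, y) |-> (a x - d y, x)]. As [0 < d < 1]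
    and [|a| < 1 + d], the form [V = (1 + d) (x^2 + y^2) - 2 a x y] is definite and
    decreases by [(1 - d) (a x - (1 + d) y)^2]. The line where it does not
    decrease is not invariant, so that [V + V o M] decreases strictly. *)
Lemma adapted_norm_exists (f a e : R) : 0 < f -> 0 < e -> e * f < 1 -> `|a| < 1 + e * f ->
  exists N cN CN th, [/\ adapted_norm N cN CN, 0 <= th, th < 1 &
    forall v w : 'rV[R]_2, w ord0 (inord 0) = f * v ord0 (inord 1) ->
      w ord0 (inord 1) = a * v ord0 (inord 1) - e * v ord0 (inord 0) -> N w <= th * N v].
Proof.
move=> f0 e0; have [d dE] : exists d, d = e * f by eexists.
rewrite -dE => d1 ad.
have d0 : 0 < d by rewrite dE mulr_gt0.
have ad2 : a ^+ 2 < (1 + d) ^+ 2.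
  by rewrite -real_normK ?num_real// ltr_pXn2r ?nnegrE//; lra.
pose P := (d - 1) * a ^+ 2 + 2 * (1 + d); pose Q := - a * (1 + d ^+ 2); pose S := (1 + d) * (1 + d ^+ 2).
pose W := qform P Q S; pose V := qform (1 + d) (- a) (1 + d).
have WV x y : W x y = V x y + V (a * x - d * y) x by rewrite /W /V /qform /P /Q /S; ring.
have WW x y : W (a * x - d * y) x = W x y - (1 - d) *
    qform (a ^+ 2 + (a ^+ 2 - 1 - d) ^+ 2) (- a * (1 + d) - a * d * (a ^+ 2 - 1 - d))
      ((1 + d) ^+ 2 + a ^+ 2 * d ^+ 2) x y.
  by rewrite /W /qform /P /Q /S; ring.
have [dV dV0 HV] : exists2 c, 0 < c & forall x y, c * (x ^+ 2 + y ^+ 2) <= V x y.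
  by apply: qform_lower; [lra|rewrite sqrrN -expr2].
have [dD dD0 HD] : exists2 c, 0 < c & forall x y, c * (x ^+ 2 + y ^+ 2) <=
   qform (a ^+ 2 + (a ^+ 2 - 1 - d) ^+ 2) (- a * (1 + d) - a * d * (a ^+ 2 - 1 - d))
      ((1 + d) ^+ 2 + a ^+ 2 * d ^+ 2) x y.
  have dt : 0 < ((1 + d) ^+ 2 - a ^+ 2) ^+ 2 by rewrite exprn_gt0// subr_gt0.
  apply: qform_lower; last first.
    by rewrite -subr_gt0; move: dt; congr (0 < _); ring.
  have := sqr_ge0 a; rewrite le_eqVlt => /predU1P[<-|a0].
    by rewrite add0r sub0r; rewrite exprn_even_gt0//=; apply/eqP; lra.
  by rewrite ltr_wpDr// sqr_ge0.
have [CW CW0 HC] : exists2 c, 0 < c & forall x y, W x y <= c * (x ^+ 2 + y ^+ 2) by exact: qform_upper.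
have sq0 (x y : R) : 0 <= x ^+ 2 + y ^+ 2 by rewrite addr_ge0// sqr_ge0.
have V0 x y : 0 <= V x y by apply: le_trans (HV x y); rewrite mulr_ge0// ltW.
have HW x y : dV * (x ^+ 2 + y ^+ 2) <= W x y by rewrite WV; apply: le_trans (HV x y) _; rewrite lerDl.
have W0 x y : 0 <= W x y by apply: le_trans (HW x y); rewrite mulr_ge0// ltW.
have P0 : 0 < P.
  apply: lt_le_trans (_ : dV <= P) => //.
  by have := HW 1 0; rewrite /W /qform !(expr1n, expr0n, mulr0, mulr1, addr0).
have dC : dD * (1 - d) / CW <= 1.
  have h1 := W0 (a * 1 - d * 0) 1; rewrite WW in h1; have h2 := HD 1 0; have h3 := HC 1 0.
  rewrite ler_pdivrMr// mul1r; rewrite !(expr1n, expr0n, addr0, mulr1) in h2 h3.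
  have h4 : (1 - d) * dD <= (1 - d) * qform (a ^+ 2 + (a ^+ 2 - 1 - d) ^+ 2)
     (- a * (1 + d) - a * d * (a ^+ 2 - 1 - d)) ((1 + d) ^+ 2 + a ^+ 2 * d ^+ 2) 1 0.
    by rewrite ler_pM2l// subr_gt0.
  by lra.
have dp : 0 < dD * (1 - d) / CW by rewrite divr_gt0// mulr_gt0// subr_gt0.
have contr x y : W (a * x - d * y) x <= (1 - dD * (1 - d) / CW) * W x y.
  rewrite WW [leRHS]mulrBl mul1r lerB// mulrAC ler_pdivrMr//.
  apply: (@le_trans _ _ (dD * (1 - d) * (CW * (x ^+ 2 + y ^+ 2)))).
    by rewrite ler_wpM2l// mulr_ge0 ?ltW// subr_gt0.
  rewrite (_ : _ * (CW * _) = (1 - d) * CW * (dD * (x ^+ 2 + y ^+ 2))); last by ring.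
  rewrite [leRHS]mulrAC.
  by rewrite ler_pM2l// mulr_gt0// subr_gt0.
pose N (v : 'rV[R]_2) := Num.sqrt (W (v ord0 (inord 1)) (v ord0 (inord 0) / f)).
have x1 : 0 < 1 + f by lra.
exists N, (Num.sqrt dV / (1 + f)), (Num.sqrt (CW * (1 + f ^- 2))), (Num.sqrt (1 - dD * (1 - d) / CW)); split.
- split.
  + move=> v w; rewrite /N !mxE mulrDl; exact: qform_triangle.
  + move=> h v; rewrite /N !mxE -[`|h|]sqrtr_sqr -sqrtrM ?sqr_ge0//; congr Num.sqrt.
    by rewrite /W /qform; ring.
  + by rewrite divr_gt0// sqrtr_gt0.
  + move=> v; rewrite mulrAC ler_pdivrMr// mulrC.
    have h : Num.sqrt dV * Num.sqrt (v ord0 (inord 1) ^+ 2 + (v ord0 (inord 0) / f) ^+ 2) <= N v.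
      by rewrite -sqrtrM ?(ltW dV0)// /N ler_wsqrtr.
    rewrite mulrC; apply: le_trans (ler_wpM2r (ltW x1) h); rewrite -mulrA ler_wpM2l ?sqrtr_ge0//.
    apply: norm2_le.
      have h1 : `|v ord0 (inord 0) / f| <= Num.sqrt (v ord0 (inord 1) ^+ 2 + (v ord0 (inord 0) / f) ^+ 2).
        by rewrite -sqrtr_sqr ler_wsqrtr// lerDr sqr_ge0.
      rewrite normrM normfV (gtr0_norm f0) ler_pdivrMr// in h1; apply: le_trans h1 _.
      by rewrite ler_wpM2l ?sqrtr_ge0// lerDr.
    have h1 : `|v ord0 (inord 1)| <= Num.sqrt (v ord0 (inord 1) ^+ 2 + (v ord0 (inord 0) / f) ^+ 2).
      by rewrite -sqrtr_sqr ler_wsqrtr// lerDl sqr_ge0.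
    by apply: le_trans h1 _; rewrite ler_peMr ?sqrtr_ge0// lerDl ltW.
  + move=> v; rewrite -[`|v|]normr_id -sqrtr_sqr -sqrtrM; last first.
      by rewrite mulr_ge0 ?addr_ge0 ?invr_ge0 ?exprn_ge0// ltW.
    rewrite ler_wsqrtr//; apply: le_trans (HC _ _) _; rewrite -mulrA ler_wpM2l ?(ltW CW0)// mulrDl mul1r.
    rewrite lerD//.
      by rewrite -[leLHS]real_normK ?num_real// lerXn2r ?nnegrE ?coord_le_norm.
    rewrite expr_div_n mulrC ler_wpM2l ?invr_ge0 ?exprn_ge0 ?(ltW f0)//.
    by rewrite -[leLHS]real_normK ?num_real// lerXn2r ?nnegrE ?coord_le_norm.
- by rewrite sqrtr_ge0.
- by rewrite -[ltRHS]sqrtr1 ltr_sqrt// ltrBlDr ltrDl.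
- move=> v w w0 w1; rewrite /N -sqrtrM; last by rewrite subr_ge0.
  rewrite ler_wsqrtr// w0 w1; set x := v _ _; set y := v _ _.
  have -> : f * x / f = x by rewrite mulrAC divff ?mul1r// gt_eqF.
  have -> : a * x - e * y = a * x - d * (y / f) by rewrite dE; field; rewrite gt_eqF.
  exact: contr.
Qed.

End AdaptedNorm.

(** * The explicit flow above the plane *)

Section ExplicitFlow.
Variable R : realType.
Implicit Types (mu H t : R) (p q v w : 'rV[R]_3).

Lemma derive_add (f g : R -> R) t (a b : R) : is_derive t 1 f a -> is_derive t 1 g b ->
  is_derive t 1 (fun s => f s + g s) (a + b).
Proof. exact: is_deriveD. Qed.

Lemma derive_sub (f g : R -> R) t (a b : R) : is_derive t 1 f a -> is_derive t 1 g b ->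
  is_derive t 1 (fun s => f s - g s) (a - b).
Proof. exact: is_deriveB. Qed.

Lemma derive_mul (f g : R -> R) t (a b : R) : is_derive t 1 f a -> is_derive t 1 g b ->
  is_derive t 1 (fun s => f s * g s) (f t * b + g t * a).
Proof. exact: is_deriveM. Qed.

Lemma derive_scale k (f : R -> R) t (a : R) : is_derive t 1 f a -> is_derive t 1 (fun s => k * f s) (k * a).
Proof. exact: is_deriveZ. Qed.

Lemma derive_exp (m t : R) : is_derive t 1 (fun s => expR (m * s)) (expR (m * t) * m).
Proof.
have := derive_scale m (is_derive_id t 1); rewrite mulr1 => d.
exact: (@is_derive1_comp _ expR (fun s => m * s) t (expR (m * t)) m).
Qed.

Lemma is_derive_spiral (m a b t : R) :
  is_derive t 1 (fun s => expR (m * s) * (a * cos s + b * sin s))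
    (expR (m * t) * ((m * a + b) * cos t + (m * b - a) * sin t)).
Proof.
have := derive_mul (derive_exp m t)
  (derive_add (derive_scale a (is_derive_cos t)) (derive_scale b (is_derive_sin t))).
by congr (is_derive _ _ _ _); ring.
Qed.

Definition flow_z mu t (y z : R) := expR (mu * t) * (z * cos t + (y - mu * z) * sin t).
Definition flow_y mu t (y z : R) :=
  expR (mu * t) * (y * cos t + (mu * y - (1 + mu ^+ 2) * z) * sin t).

(** The pair [(y, z)] is an expanding focus of its own, and
    [w = x - H y + 4 mu H z] satisfies [w' = - 2 mu w]. *)
Definition linflow mu H t v := vec3
  (expR (- 2 * mu * t) * (xc v - H * yc v + 4 * mu * H * zc v) +
     H * flow_y mu t (yc v) (zc v) - 4 * mu * H * flow_z mu t (yc v) (zc v))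
  (flow_y mu t (yc v) (zc v)) (flow_z mu t (yc v) (zc v)).

Definition linX mu H v : 'rV[R]_3 :=
  vec3 (- 2 * mu * xc v - H * (9 * mu ^+ 2 + 1) * zc v)
       (2 * mu * yc v - (1 + mu ^+ 2) * zc v) (yc v).

Definition rest mu H : 'rV[R]_3 := vec3 (- 4 * mu * H / (1 + mu ^+ 2)) 0 (1 + mu ^+ 2)^-1.

Definition arcflow mu H p t := rest mu H + linflow mu H t (p - rest mu H).

Lemma mu2_gt0 mu : 0 < 1 + mu ^+ 2.
Proof. by rewrite ltr_pwDl// sqr_ge0. Qed.

Lemma canonX_rest mu H p : canonX mu H p = linX mu H (p - rest mu H).
Proof.
have n0 : 1 + mu ^+ 2 != 0 by rewrite gt_eqF// mu2_gt0.
apply: vec3_inj; rewrite /canonX /linX ?xc_vec3 ?yc_vec3 ?zc_vec3 ?xcB ?ycB ?zcB ?xc_vec3 ?yc_vec3 ?zc_vec3; last by rewrite subr0.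
  by field.
by field.
Qed.

Lemma linX_matrix mu H : exists A : 'M[R]_3, forall v, linX mu H v = v *m A.
Proof.
apply: linear_mx => [v w|h v]; apply: vec3_inj;
  rewrite /linX ?xcD ?ycD ?zcD ?xcZ ?ycZ ?zcZ ?xc_vec3 ?yc_vec3 ?zc_vec3 ?xcD ?ycD ?zcD ?xcZ ?ycZ ?zcZ //; ring.
Qed.

Lemma linflow_matrix mu H : exists E : R -> 'M[R]_3, forall t v, linflow mu H t v = v *m E t.
Proof.
have /choice[E HE] : forall t, exists M : 'M[R]_3, forall v, linflow mu H t v = v *m M; last by exists E.
move=> t; apply: linear_mx => [v w|h v]; apply: vec3_inj;
  rewrite /linflow /flow_y /flow_z ?xcD ?ycD ?zcD ?xcZ ?ycZ ?zcZ ?xc_vec3 ?yc_vec3 ?zc_vec3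
    ?xcD ?ycD ?zcD ?xcZ ?ycZ ?zcZ //; ring.
Qed.

Lemma linflow0 mu H v : linflow mu H 0 v = v.
Proof.
apply: vec3_inj; rewrite /linflow ?xc_vec3 ?yc_vec3 ?zc_vec3 /flow_y /flow_z !mulr0 expR0 cos0 sin0; ring.
Qed.

Lemma is_derive_vec3 (f g h : R -> R) t (a b c : R) : is_derive t 1 f a -> is_derive t 1 g b ->
  is_derive t 1 h c -> is_derive t 1 (fun s => vec3 (f s) (g s) (h s)) (vec3 a b c).
Proof.
move=> df dg dh; apply/is_derive_rV => -[[|[|[|//]]] i]; rewrite mxE.
- have -> : (fun s => vec3 (f s) (g s) (h s) ord0 (Ordinal i)) = f by apply/funext => s; rewrite mxE.
  exact: df.
- have -> : (fun s => vec3 (f s) (g s) (h s) ord0 (Ordinal i)) = g by apply/funext => s; rewrite mxE.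
  exact: dg.
- have -> : (fun s => vec3 (f s) (g s) (h s) ord0 (Ordinal i)) = h by apply/funext => s; rewrite mxE.
  exact: dh.
Qed.

Lemma is_derive_flow_z mu t (y z : R) :
  is_derive t 1 (fun s => flow_z mu s y z) (flow_y mu t y z).
Proof.
have := is_derive_spiral mu z (y - mu * z) t; rewrite /flow_z /flow_y.
by congr (is_derive _ _ _ _); ring.
Qed.

Lemma is_derive_flow_y mu t (y z : R) : is_derive t 1 (fun s => flow_y mu s y z)
  (2 * mu * flow_y mu t y z - (1 + mu ^+ 2) * flow_z mu t y z).
Proof.
have := is_derive_spiral mu y (mu * y - (1 + mu ^+ 2) * z) t; rewrite /flow_z /flow_y.
by congr (is_derive _ _ _ _); ring.
Qed.

Lemma is_derive_linflow mu H t v :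
  is_derive t 1 (fun s => linflow mu H s v) (linX mu H (linflow mu H t v)).
Proof.
have dz := is_derive_flow_z mu t (yc v) (zc v); have dy := is_derive_flow_y mu t (yc v) (zc v).
rewrite /linX {2 3 4 5}/linflow yc_vec3 zc_vec3.
apply: is_derive_vec3 => //.
set w := xc v - _ + _.
have := derive_sub (derive_add (derive_scale w (derive_exp (- 2 * mu) t)) (derive_scale H dy))
  (derive_scale (4 * mu * H) dz).
rewrite /linflow xc_vec3 -/w; under eq_fun do rewrite [w * _]mulrC.
by congr (is_derive _ _ _ _); ring.
Qed.

Lemma is_derive_arcflow mu H p t : is_derive t 1 (arcflow mu H p) (canonX mu H (arcflow mu H p t)).
Proof.
have d := is_derive_linflow mu H t (p - rest mu H).
have := is_deriveD (is_derive_cst (rest mu H) t 1) d.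
by rewrite add0r canonX_rest /arcflow addrAC subrr add0r.
Qed.

Lemma arcflow0 mu H p : arcflow mu H p 0 = p.
Proof. by rewrite /arcflow linflow0 addrC subrK. Qed.

End ExplicitFlow.

(** * Take-off and landing *)

Section HalfArc.
Variable R : realType.
Implicit Types (mu H t : R) (p q : 'rV[R]_3).

Lemma decreasing_of_derive (f df : R -> R) (a b : R) : a < b ->
  (forall x : R, a <= x <= b -> is_derive x 1 f (df x)) ->
  (forall x, a < x < b -> df x < 0) -> f b < f a.
Proof.
move=> ab fd neg.
have cf : {within `[a, b], continuous f}.
  by apply: derivable_within_continuous => x; rewrite in_itv/= => /fd[].
have [c] := MVT ab (fun x (xab : x \in `]a, b[) => fd x (subset_itv_oo_cc xab)) cf.
rewrite in_itv/= => cI fE.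
by rewrite -subr_lt0 fE nmulr_rlt0 ?subr_gt0// neg.
Qed.

Lemma first_zero (f df : R -> R) (a b : R) : a <= b -> (forall x : R, is_derive x 1 f (df x)) ->
  0 < f a -> f b <= 0 -> exists t, [/\ a < t <= b, f t = 0 & forall s, a <= s < t -> 0 < f s].
Proof.
move=> ab fd fa fb.
have cf (x : R) : {for x, continuous f}.
  by apply: differentiable_continuous; apply/derivable1_diffP; case: (fd x).
have pos x : 0 < f x -> exists2 d, 0 < d & forall y, `|y - x| < d -> 0 < f y.
  move=> fx; have /cvgrPdist_lt/(_ _ fx)/nbhs_ballP[d /= d0 Hd] := cf x.
  exists d => // y yx; have := Hd y; rewrite -ball_normE /= distrC => /(_ yx).
  by rewrite ltr_norml => /andP[_]; lra.
apply: contrapT => no.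
suff : 0 < f b by lra.
apply: (@real_induction R (fun t => 0 < f t) a b ab fa) => //; last by rewrite ab lexx.
- move=> t /andP[at1 _] H; have [|d d0 Hd] := pos t; first by apply: H; rewrite at1 lexx.
  exists (d / 2) => [|u ut _]; first by rewrite divr_gt0.
  by apply: Hd; rewrite gtr0_norm; lra.
- move=> t tab H; rewrite ltNge; apply/negP; rewrite le_eqVlt => /predU1P[ft|ft].
    by apply: no; exists t.
  have /cvgrPdist_lt/(_ (- f t)) := cf t; rewrite oppr_gt0 => /(_ ft)/nbhs_ballP[d /= d0 Hd].
  pose u := Num.max a (t - d / 2).
  have d2 : 0 < d / 2 by rewrite divr_gt0.
  have au : a <= u by rewrite le_max lexx.
  have tu : t - d / 2 <= u by rewrite le_max lexx orbT.
  have ut : u < t by rewrite gt_max; apply/andP; split; lra.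
  have := H u; rewrite au ut => /(_ isT) fu.
  have := Hd u; rewrite -ball_normE /= gtr0_norm ?subr_gt0// => h.
  have : `|f t - f u| < - f t by apply: h; lra.
  by rewrite ltr_norml => /andP[]; lra.
Qed.

(** The difference vanishes at time 0 and its derivative is a positive multiple
    of [sin t]; so no arc lands before time [pi]. *)
Lemma rising_gap mu t : 0 < mu -> 0 < t <= pi -> 0 < 1 - expR (mu * t) * (cos t - mu * sin t).
Proof.
move=> mu0 /andP[t0 tpi].
pose f s := expR (mu * s) * (1 * cos s + - mu * sin s).
have : f t < f 0.
  apply: (decreasing_of_derive t0 (fun s _ => is_derive_spiral mu 1 (- mu) s)) => s /andP[s0 st].
  have -> : expR (mu * s) * ((mu * 1 + - mu) * cos s + (mu * - mu - 1) * sin s) =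
    - (expR (mu * s) * ((1 + mu ^+ 2) * sin s)) by ring.
  rewrite oppr_lt0 !mulr_gt0 ?expR_gt0 ?mu2_gt0// sin_gt0_pi// s0/=.
  exact: lt_le_trans st tpi.
by rewrite /f mulr0 expR0 cos0 sin0 !mul1r mulr0 addr0 mulNr; rewrite subr_gt0.
Qed.

Lemma arcflow_z mu H p t : zc p = 0 -> zc (arcflow mu H p t) =
  (1 - expR (mu * t) * (cos t - mu * sin t)) / (1 + mu ^+ 2) + expR (mu * t) * (yc p * sin t).
Proof.
move=> zp; rewrite /arcflow /linflow /rest /flow_z zcD !zc_vec3 ycB zcB yc_vec3 zc_vec3 zp.
ring.
Qed.

Lemma arcflow_y mu H p t : zc p = 0 -> yc (arcflow mu H p t) =
  expR (mu * t) * (yc p * cos t + (mu * yc p + 1) * sin t).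
Proof.
move=> zp; have n0 : 1 + mu ^+ 2 != 0 by rewrite gt_eqF// mu2_gt0.
rewrite /arcflow /linflow /rest /flow_y ycD !yc_vec3 ycB zcB yc_vec3 zc_vec3 zp.
by field.
Qed.

Lemma arcflow_x mu H p t : zc p = 0 -> zc (arcflow mu H p t) = 0 ->
  xc (arcflow mu H p t) - H * yc (arcflow mu H p t) =
  expR (- 2 * mu * t) * (xc p - H * yc p).
Proof.
move=> zp; have n0 : 1 + mu ^+ 2 != 0 by rewrite gt_eqF// mu2_gt0.
have xE : xc (p - rest mu H) = xc p + 4 * mu * H / (1 + mu ^+ 2) by rewrite xcB xc_vec3; ring.
have yE : yc (p - rest mu H) = yc p by rewrite ycB yc_vec3 subr0.
have zE : zc (p - rest mu H) = - (1 + mu ^+ 2)^-1 by rewrite zcB zc_vec3 zp add0r.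
rewrite /arcflow /linflow {}xE {}yE {}zE xcD ycD zcD !xc_vec3 !yc_vec3 !zc_vec3.
set z := flow_z _ _ _ _; set y := flow_y _ _ _ _ => zz.
have -> : z = - (1 + mu ^+ 2)^-1 by rewrite -[RHS]addr0 -zz addKr.
by field.
Qed.

(** Vertical speed at which an arc of time [t] takes off from the plane; by
    reversing time it lands with speed [speed (- mu) t]. *)
Definition speed (m t : R) : R := ((cos t - expR (- m * t)) / sin t - m) / (1 + m ^+ 2).

Section Time.
Variable t : R.
Hypotheses (t1 : pi < t) (t2 : t < 2 * pi).

Lemma sin_neg : sin t < 0.
Proof.
have h : 0 < sin (t - pi) 
  by apply: sin_gt0_pi; rewrite subr_gt0 t1 ltrBlDr -mulr2n -mulr_natl.
by rewrite sinB cospi sinpi in h; lra.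
Qed.

Lemma landing_speed mu H p : zc p = 0 -> zc (arcflow mu H p t) = 0 ->
  yc p = speed mu t /\ yc (arcflow mu H p t) = - speed (- mu) t.
Proof.
move=> zp; rewrite (arcflow_z _ _ _ zp) (arcflow_y _ _ _ zp) => z0.
have n0 : 1 + mu ^+ 2 != 0 by rewrite gt_eqF// mu2_gt0.
have s0 : sin t != 0 by rewrite lt_eqF// sin_neg.
have e0 : expR (mu * t) != 0 by rewrite gt_eqF// expR_gt0.
have yE : yc p = speed mu t.
  apply: (mulfI e0); apply: (mulIf s0); apply: (mulIf n0).
  rewrite /speed mulNr expRN.
  apply/eqP; rewrite -subr_eq0; apply/eqP.
  transitivity ((1 + mu ^+ 2) * ((1 - expR (mu * t) * (cos t - mu * sin t)) / (1 + mu ^+ 2) +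
      expR (mu * t) * (yc p * sin t))); last by rewrite z0 mulr0.
  by field; rewrite n0 e0 s0.
split=> //; rewrite yE /speed opprK sqrrN mulNr expRN.
have cs := cos2Dsin2 t.
apply: (mulIf s0); apply: (mulIf n0).
have -> : expR (mu * t) * (((cos t - (expR (mu * t))^-1) / sin t - mu) / (1 + mu ^+ 2) * cos t +
   (mu * (((cos t - (expR (mu * t))^-1) / sin t - mu) / (1 + mu ^+ 2)) + 1) * sin t) * sin t * (1 + mu ^+ 2) =
   expR (mu * t) * (cos t ^+ 2 + sin t ^+ 2) - cos t - mu * sin t.
  by field; rewrite n0 e0 s0.
rewrite cs mulr1; by field; rewrite n0 s0.
Qed.

Lemma speed_gt0 mu : 0 < mu -> 0 < speed (- mu) t.
Proof.
move=> mu0; have s0 := sin_neg; have pi0 := pi_gt0 R.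
have t0 : 0 < t by exact: lt_trans pi0 t1.
rewrite /speed !opprK sqrrN divr_gt0 ?mu2_gt0// addr_gt0//.
rewrite -mulrNN -invrN divr_gt0 ?oppr_gt0// subr_lt0.
apply: le_lt_trans (cos_le1 _) _; by rewrite expR_gt1 mulr_gt0.
Qed.

Lemma is_derive_speed (m : R) : is_derive t 1 (speed m) (speed (- m) t * expR (- m * t) / sin t).
Proof.
have s0 : sin t != 0 by rewrite lt_eqF// sin_neg.
have n0 : 1 + m ^+ 2 != 0 by rewrite gt_eqF// mu2_gt0.
have e0 : expR (m * t) != 0 by rewrite gt_eqF// expR_gt0.
have di : is_derive t 1 (fun s => (sin s)^-1) (- cos t / sin t ^+ 2).
  have [d ds] := is_derive_sin t; apply: DeriveDef; first exact: derivableV.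
  by rewrite (deriveV s0 d) ds /GRing.scale/=; field.
have := derive_scale (1 + m ^+ 2)^-1 (derive_sub
   (derive_mul (derive_sub (is_derive_cos t) (derive_exp (- m) t)) di) (is_derive_cst m t 1)).
have -> : speed m = fun s => (1 + m ^+ 2)^-1 * ((cos s - expR (- m * s)) * (sin s)^-1 - cst m s).
  by apply/funext => s; rewrite /speed mulrC.
congr (is_derive _ _ _ _).
have cs := cos2Dsin2 t.
rewrite /speed !opprK sqrrN mulNr expRN.
apply: (mulIf n0); apply: (mulIf (mulf_neq0 s0 s0)); apply: (mulIf e0).
transitivity (cos t + m * sin t - expR (m * t) * (cos t ^+ 2 + sin t ^+ 2)).
  by field; rewrite n0 e0 s0.
by rewrite cs; field; rewrite n0 e0 s0.
Qed.

End Time.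
End HalfArc.

(** * Arc times and the contraction *)

Section Cycle.
Variable R : realType.
Implicit Types (mu H t : R) (p q : 'rV[R]_3).

Definition arc_time mu H p T := [/\ pi < T, T < 2 * pi, zc (arcflow mu H p T) = 0 &
  forall t, 0 < t < T -> 0 < zc (arcflow mu H p t)].

Lemma is_derive_arc_z mu H p t :
  is_derive t 1 (fun s => zc (arcflow mu H p s)) (yc (arcflow mu H p t)).
Proof.
have := is_derive_zc (is_derive_arcflow mu H p t).
by rewrite (_ : zc (canonX _ _ _) = yc (arcflow mu H p t))//; exact: zc_vec3.
Qed.

(** The height is positive up to time [pi] and negative at [2 * pi]. *)
Lemma arc_time_exists mu H p : 0 < mu -> zc p = 0 -> 0 < yc p -> exists T, arc_time mu H p T.
Proof.
move=> mu0 zp yp; have pi0 := pi_gt0 R.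
have rise t : 0 < t <= pi -> 0 < zc (arcflow mu H p t).
  move=> tI; have /andP[t0 tpi] := tI; rewrite arcflow_z// ltr_pwDl//.
    by rewrite divr_gt0 ?mu2_gt0// rising_gap.
  by rewrite !mulr_ge0 ?expR_ge0 ?(ltW yp)// sin_ge0_pi// (ltW t0).
have pi2 : pi < 2 * pi :> R by rewrite mulr_natl mulr2n ltrDl.
have fall : zc (arcflow mu H p (2 * pi)) < 0.
  rewrite arcflow_z// [2 * pi]mulr_natl cos2pi sin2pi !mulr0 subr0 addr0 mulr1.
  rewrite pmulr_llt0 ?invr_gt0 ?mu2_gt0// subr_lt0 expR_gt1 mulr_gt0// mulr2n addr_gt0//.
have [|T [/andP[T1 T2] zT pos]] := first_zero (ltW pi2) (is_derive_arc_z mu H p) _ (ltW fall).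
  by apply: rise; rewrite lexx pi0.
exists T; split => //.
  by rewrite lt_neqAle T2 andbT; apply/eqP => e; move: fall; rewrite -e zT ltxx.
move=> t /andP[t0 tT]; have [tp|/ltW pt] := leP t pi; first by apply: rise; rewrite t0.
by apply: pos; rewrite pt.
Qed.

Lemma exp_dominates mu t : 0 < mu -> pi < t -> 2 * mu < expR (mu * t).
Proof.
move=> mu0 t1; apply: lt_le_trans (expR_ge1Dx _).
have : mu * 2 <= mu * t by rewrite ler_pM2l//; apply: le_trans (ltW t1); exact: pi_ge2.
lra.
Qed.

(** Up to positive factors each of the two speeds is minus the derivative of the
    other one. *)
Lemma speed_decreasing mu s t : 0 < mu -> pi < s -> s < t -> t < 2 * pi -> 0 < speed mu t ->
  speed mu t < speed mu s /\ speed (- mu) t < speed (- mu) s.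
Proof.
move=> mu0 s1 st t2 pos.
have I x : s <= x <= t -> pi < x /\ x < 2 * pi.
  by move=> /andP[h1 h2]; split; [exact: lt_le_trans s1 h1|exact: le_lt_trans h2 t2].
have neg (m x : R) : s <= x <= t -> 0 < speed m x -> speed m x * expR (m * x) / sin x < 0.
  by move=> /I[h1 h2] sm; rewrite pmulr_rlt0 ?invr_lt0 ?sin_neg// mulr_gt0 ?expR_gt0.
have dec u : s <= u -> u < t -> speed mu t < speed mu u.
  move=> su ut.
  apply: (decreasing_of_derive ut (df := fun x => speed (- mu) x * expR (- mu * x) / sin x)) => [x /andP[ux xt]|x /andP[ux xt]].
    have [h1 h2] : pi < x /\ x < 2 * pi by apply: I; rewrite xt (le_trans su).
    exact: is_derive_speed.
  have xI : s <= x <= t by rewrite (ltW xt) (le_trans su)// ltW.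
  have [h1 h2] := I x xI.
  by rewrite pmulr_rlt0 ?invr_lt0 ?sin_neg// mulr_gt0 ?expR_gt0// speed_gt0.
split; first exact: dec.
apply: (decreasing_of_derive st (df := fun x => speed mu x * expR (mu * x) / sin x)) => [x xI|x /andP[sx xt]].
  have [h1 h2] := I x xI; have := is_derive_speed h1 h2 (- mu).
  by rewrite !opprK.
by apply: neg; [rewrite !ltW|apply: lt_trans (dec _ (ltW sx) xt)].
Qed.

(** An asymmetric cycle would have two different arc times [s < t]. Eliminating
    [H] from the two half-cycle equations leaves an identity between take-off
    and landing speeds whose two sides differ, because [e^(-2 mu t)] varies more
    slowly than the take-off speed. *)
Lemma times_ordered mu H s t : 0 < mu -> 0 < H -> pi < s -> s < t -> t < 2 * pi ->
  0 < speed mu s -> 0 < speed mu t ->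
  speed mu t + expR (- 2 * mu * s) * speed (- mu) t =
    H * (speed (- mu) s + expR (- 2 * mu * s) * speed mu s) ->
  speed mu s + expR (- 2 * mu * t) * speed (- mu) s =
    H * (speed (- mu) t + expR (- 2 * mu * t) * speed mu t) -> False.
Proof.
move=> mu0 H0 s1 st t2 as0 at0.
have [ab fg] := speed_decreasing mu0 s1 st t2 at0.
have I x : s <= x <= t -> pi < x /\ x < 2 * pi.
  by move=> /andP[h1 h2]; split; [exact: lt_le_trans s1 h1|exact: le_lt_trans h2 t2].
have g0 : 0 < speed (- mu) t by apply: speed_gt0 => //; exact: lt_trans st.
have slow : speed (- mu) t * (expR (- 2 * mu * s) - expR (- 2 * mu * t)) < speed mu s - speed mu t.
  (* along [x] the speed falls faster than [e^(-2 mu x)]: [2 mu e^(-mu x) < 1] *)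
  pose k x := speed mu x - speed (- mu) t * expR (- 2 * mu * x).
  suff : k t < k s by rewrite /k mulrBr; lra.
  apply: (decreasing_of_derive st (df := fun x => speed (- mu) x * expR (- mu * x) / sin x -
     speed (- mu) t * (expR (- 2 * mu * x) * (- 2 * mu)))) => [x xI|x /andP[sx xt]].
    have [h1 h2] := I x xI.
    exact: derive_sub (is_derive_speed h1 h2 mu) (derive_scale _ (derive_exp _ _)).
  have [h1 h2] : pi < x /\ x < 2 * pi by apply: I; rewrite !ltW.
  have sn := sin_neg h1 h2.
  have gx : speed (- mu) t < speed (- mu) x by have [] := speed_decreasing mu0 h1 xt t2 at0.
  have e0 := expR_gt0 (- mu * x).
  have -> : - 2 * mu * x = - mu * x + - mu * x by ring.
  rewrite expRD.
  have h : 2 * mu * expR (- mu * x) < 1.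
    by rewrite mulNr expRN ltr_pdivrMr ?expR_gt0// mul1r exp_dominates.
  have hs : 1 <= (- sin x)^-1.
    by rewrite invf_ge1 ?oppr_gt0// -sinN; exact: sin_le1.
  rewrite -[_ / sin x]opprK -mulrN -invrN.
  have -> : - (speed (- mu) x * expR (- mu * x) / (- sin x)) - speed (- mu) t *
     (expR (- mu * x) * expR (- mu * x) * (- 2 * mu)) =
     - (expR (- mu * x) * (speed (- mu) x / (- sin x) - speed (- mu) t * (2 * mu * expR (- mu * x)))) by ring.
  rewrite oppr_lt0 mulr_gt0// subr_gt0.
  apply: (@lt_le_trans _ _ (speed (- mu) t)); first by rewrite gtr_pMr.
  apply: (@le_trans _ _ (speed (- mu) x)); first exact: ltW.
  by rewrite ler_peMr// ltW// (lt_trans g0).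
have Est : expR (- 2 * mu * t) < expR (- 2 * mu * s).
  by rewrite ltr_expR -subr_gt0 (_ : _ - _ = 2 * mu * (t - s)) ?mulr_gt0 ?subr_gt0//; ring.
have e0 := expR_gt0 (- 2 * mu * t).
move: (speed mu s) (speed mu t) (speed (- mu) s) (speed (- mu) t) (expR (- 2 * mu * s)) (expR (- 2 * mu * t))
  as0 at0 ab fg g0 slow Est e0 => a b f g E1 E2 a0 b0 ab fg g0 slow E12 E20 eq1 eq2.
have cross : (b + E1 * g) * (g + E2 * b) = (a + E2 * f) * (f + E1 * a) by rewrite eq1 eq2; ring.
have a0' : 0 < a by [].
have h1 : g * (g * (E1 - E2)) < g * (a - b) by rewrite ltr_pM2l.
have h2 : 0 < a * (f - g) by rewrite mulr_gt0// subr_gt0.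
have E10 : 0 < E1 by exact: lt_trans E12.
have h7 : 0 < g * (a - b) by rewrite mulr_gt0// subr_gt0.
have h3 : 0 < E1 * E2 * (a * (f - g) + g * (a - b)) by apply: mulr_gt0; [exact: mulr_gt0|exact: addr_gt0].
have h4 : 0 < E2 * ((f - g) * (f + g)).
  by rewrite mulr_gt0// mulr_gt0 ?subr_gt0// addr_gt0//; exact: lt_trans fg.
have h5 : 0 < E2 * ((a - b) * (a + b)) by rewrite mulr_gt0// mulr_gt0 ?subr_gt0// addr_gt0.
have h6 : 0 < (E1 - E2) * a ^+ 2 by rewrite mulr_gt0 ?subr_gt0// exprn_gt0.
have : (a + E2 * f) * (f + E1 * a) - (b + E1 * g) * (g + E2 * b) =
  a * (f - g) + (g * (a - b) - g * (g * (E1 - E2))) + E1 * E2 * (a * (f - g) + g * (a - b)) +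
  E2 * ((f - g) * (f + g)) + E2 * ((a - b) * (a + b)) + (E1 - E2) * a ^+ 2 by ring.
rewrite cross subrr; move: h1 h2 h3 h4 h5 h6.
move: (g * (a - b)) (g * (g * (E1 - E2))) (a * (f - g)) (E2 * _) (E2 * _) (_ * a ^+ 2) => X1 X2 X3 X4 X5 X6.
move: (E1 * E2 * _) => X7; lra.
Qed.

Lemma speed_ratio mu t : 0 < mu -> pi < t -> t < 2 * pi ->
  expR (mu * t) * speed mu t < speed (- mu) t.
Proof.
move=> mu0 t1 t2; have sn := sin_neg t1 t2.
have e0 : expR (mu * t) != 0 by rewrite gt_eqF// expR_gt0.
have n0 : 1 + mu ^+ 2 != 0 by rewrite gt_eqF// mu2_gt0.
have s0 : sin t != 0 by rewrite lt_eqF.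
have e1 : 1 < expR (mu * t) by rewrite expR_gt1 mulr_gt0// (lt_trans (pi_gt0 R)).
rewrite -subr_gt0 /speed !opprK sqrrN mulNr expRN.
rewrite (_ : _ - _ = ((expR (mu * t) - 1) * (1 + cos t) / (- sin t) + mu * (1 + expR (mu * t))) / (1 + mu ^+ 2)); last first.
  by field; rewrite ?oppr_eq0 n0 e0 s0.
rewrite divr_gt0 ?mu2_gt0// ltr_pwDr ?mulr_gt0 ?addr_gt0 ?expR_gt0//.
rewrite divr_ge0 ?oppr_ge0 ?(ltW sn)// mulr_ge0 ?subr_ge0 ?(ltW e1)//.
Qed.

(** Put [E = e^(-2 mu t)] and [D = y / x]. Then [D < 1] because landing is faster
    than take-off, the cycle equation gives [H = (D + E) / (1 + D E) < 1], and
    [speed_ratio] says [D^2 < E]. The upper bound for [A] is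
    [(E - D^2) (1 - E^2) > 0]; the lower one follows from
    [2 mu e^(-mu t) < 1], as the last term of [A] is negative and larger than [-1]. *)
Lemma half_contraction mu H t (x y A : R) : 0 < mu -> 0 < H -> pi < t -> t < 2 * pi -> 0 < y -> 
  y = speed mu t -> x = speed (- mu) t ->
  y + expR (- 2 * mu * t) * x = H * (x + expR (- 2 * mu * t) * y) ->
  A = H * expR (- 2 * mu * t) + H * (y / (expR (- 2 * mu * t) * x)) +
     2 * mu * expR (mu * t) * (sin t / x) * (H * x - y) ->
  0 < y / (expR (- 2 * mu * t) * x) /\ expR (- 2 * mu * t) * (y / (expR (- 2 * mu * t) * x)) < 1 /\
  `|A| < 1 + expR (- 2 * mu * t) * (y / (expR (- 2 * mu * t) * x)).
Proof.
move=> mu0 H0 t1 t2 y0 yE xE.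
have x0 : 0 < x by rewrite xE speed_gt0.
have ratio : expR (mu * t) * y < x by rewrite yE xE speed_ratio.
have e1 : 1 < expR (mu * t) by rewrite expR_gt1 mulr_gt0// (lt_trans (pi_gt0 R)).
have em := exp_dominates mu0 t1.
have sn := sin_neg t1 t2; have sm := sin_geN1 t.
have EE : expR (- 2 * mu * t) = (expR (mu * t)) ^- 2.
  by rewrite -mulrA mulNr expRN mulr_natl mulr2n expRD -expr2.
rewrite EE; move: (expR (mu * t)) (sin t) e1 em sn sm ratio => e s e1 em sn sm ratio.
have e0 : 0 < e by lra.
have [E EP] : exists E, E = e ^- 2 by eexists.
rewrite -EP => eqH AE.
have E0 : 0 < E by rewrite EP invr_gt0 exprn_gt0.
have E1 : E < 1 by rewrite EP invf_lt1 ?exprn_gt0// exprn_egt1.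
have [D DE] : exists D, D = y / x by eexists.
have D0 : 0 < D by rewrite DE divr_gt0.
have yx : y < x by apply: lt_trans ratio; rewrite ltr_pMl.
have D1 : D < 1 by rewrite DE ltr_pdivrMr// mul1r.
have D2 : D ^+ 2 < E.
  have De : D * e < 1 by rewrite DE mulrAC ltr_pdivrMr// mul1r mulrC.
  rewrite EP -[ltRHS]mul1r ltr_pdivlMr ?exprn_gt0// -exprMn exprn_ilt1//.
  by rewrite mulr_ge0// ltW.
have fE : y / (E * x) = D / E by rewrite DE; field; rewrite !gt_eqF.
rewrite fE [E * _]mulrC divfK ?gt_eqF//.
have HD : H * (1 + D * E) = D + E.
  apply: (mulIf (lt0r_neq0 x0)); rewrite -mulrA mulrDl mul1r DE.
  have -> : (y / x) * E * x = E * y by field; rewrite gt_eqF.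
  by rewrite -eqH; field; rewrite gt_eqF.
have H1 : H < 1.
  have DE0 : 0 < D * E by rewrite mulr_gt0.
  have h : 0 < (1 - D) * (1 - E) by rewrite mulr_gt0 ?subr_gt0.
  rewrite -(ltr_pM2r (_ : 0 < 1 + D * E)); last by lra.
  by rewrite HD mul1r; lra.
have HED : H * (D / E + E) < 1 + D.
  rewrite -(ltr_pM2r (_ : 0 < E * (1 + D * E))); last first.
    by rewrite mulr_gt0// addr_gt0// mulr_gt0.
  have -> : H * (D / E + E) * (E * (1 + D * E)) = (D + E) * (D + E ^+ 2).
    by rewrite -HD; field; rewrite gt_eqF.
  rewrite -subr_gt0 (_ : _ - _ = (E - D ^+ 2) * (1 - E ^+ 2)); last by ring.
  by rewrite mulr_gt0 ?subr_gt0// exprn_ilt1// ltW.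
split; first exact: divr_gt0.
split=> //.
have tail : 2 * mu * e * (s / x) * (H * x - y) = - (2 * mu / e * ((- s) * (1 - H * D))).
  have -> : H * x - y = E * (x - H * y) by lra.
  by rewrite EP DE; field; rewrite !gt_eqF.
have HDl : H * D < 1.
  apply: lt_trans D1; by rewrite gtr_pMl.
have HD0 : 0 < H * D by rewrite mulr_gt0.
have me : 2 * mu / e < 1 by rewrite ltr_pdivrMr// mul1r.
have me0 : 0 < 2 * mu / e by rewrite divr_gt0// mulr_gt0.
have p0 : 0 < 2 * mu / e * ((- s) * (1 - H * D)).
  by rewrite mulr_gt0// mulr_gt0 ?oppr_gt0// subr_gt0.
have p1 : 2 * mu / e * ((- s) * (1 - H * D)) < 1.
  apply: le_lt_trans me; rewrite ler_piMr ?(ltW me0)//.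
  by rewrite mulr_ile1 ?oppr_ge0 ?(ltW sn) ?subr_ge0 ?(ltW HDl)//; lra.
have q0 : 0 < H * (D / E + E) by rewrite mulr_gt0// addr_gt0// divr_gt0.
rewrite AE fE tail.
have -> : H * E + H * (D / E) = H * (D / E + E) by ring.
by rewrite ltr_norml; apply/andP; split; lra.
Qed.

End Cycle.

(** * The unperturbed cycle *)

Section Decoding.
Variable R : realType.
Implicit Types (mu H t : R) (p q : 'rV[R]_3).
Local Notation S := (@canonS R).

Lemma lipschitz_gt (f : 'rV[R]_3 -> R) (L c : R) p : 0 <= L ->
  (forall q, `|f q - f p| <= L * `|q - p|) -> c < f p -> \forall q \near p, c < f q.
Proof.
move=> L0 fL cf; apply/nbhs_ballP; exists ((f p - c) / (L + 1)); first by rewrite /= divr_gt0 ?subr_gt0 ?ltr_wpDl.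
have L1 : 0 < L + 1 by rewrite ltr_wpDl.
move=> q; rewrite -ball_normE /= distrC ltr_pdivlMr// => h.
have := fL q; rewrite ler_norml => /andP[h1 _].
have : L * `|q - p| <= `|q - p| * (L + 1) by rewrite mulrC ler_wpM2l// lerDl.
by lra.
Qed.

(** Lebesgue's number lemma along a compact piece of a curve. *)
Lemma uniform_tube (gam : R -> 'rV[R]_3) (a b : R) (O : set 'rV[R]_3) : a <= b ->
  continuous gam -> (forall t, a <= t <= b -> nbhs (gam t) O) ->
  exists2 r, 0 < r & forall t q, a <= t <= b -> `|q - gam t| <= r -> O q.
Proof.
move=> ab cg HO.
have loc t : a <= t <= b -> exists r d : R, [/\ 0 < r, 0 < d &
    forall u q, `|u - t| < d -> `|q - gam u| <= r -> O q].
  move=> /HO /nbhs_ballP[e /= e0 He].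
  have e2 : 0 < e / 2 by rewrite divr_gt0.
  have /cvgrPdist_lt/(_ _ e2)/nbhs_ballP[d /= d0 Hd] := cg t.
  exists (e / 2), d; split => // u q ud qu; apply: He; rewrite -ball_normE /=.
  rewrite -(subrKA (gam u)) [e]splitr; apply: le_lt_trans (ler_normD _ _) _.
  rewrite ltr_leD//; last by rewrite distrC.
  by apply: Hd; rewrite -ball_normE /= distrC.
suff : exists2 r, 0 < r & forall u q, a <= u <= b -> `|q - gam u| <= r -> O q by [].
pose P t := exists2 r, 0 < r & forall u q, a <= u <= t -> `|q - gam u| <= r -> O q.
apply: (@real_induction R P a b ab) => //; last by rewrite ab lexx.
- have [|r [d [r0 d0 Hr]]] := loc a; first by rewrite lexx.
  exists r => // u q /andP[au ua]; apply: Hr.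
  by rewrite (_ : u = a) ?subrr ?normr0//; apply/eqP; rewrite eq_le ua au.
- move=> t /andP[at1 tb] H; have [|r1 r10 H1] := H t; first by rewrite at1 lexx.
  have [|r [d [r0 d0 Hr]]] := loc t; first by rewrite at1 ltW.
  have d2 : 0 < d / 2 by rewrite divr_gt0.
  exists (d / 2) => // u /andP[tu ut] _.
  exists (Num.min r1 r) => [|v q /andP[av vu]]; first by rewrite lt_min r10.
  rewrite le_min => /andP[q1 q2]; have [vt|tv] := leP v t; first by apply: H1 q1; rewrite av.
  by apply: Hr q2; rewrite gtr0_norm; lra.
- move=> t /andP[at1 tb] H; have [|r [d [r0 d0 Hr]]] := loc t; first by rewrite tb ltW.
  pose u := Num.max a (t - d / 2).
  have d2 : 0 < d / 2 by rewrite divr_gt0.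
  have au : a <= u by rewrite le_max lexx.
  have tu : t - d / 2 <= u by rewrite le_max lexx orbT.
  have ut : u < t by rewrite gt_max at1 ltrBlDr ltrDl.
  have [|r1 r10 H1] := H u; first by rewrite au.
  exists (Num.min r1 r) => [|v q /andP[av vt]]; first by rewrite lt_min r10.
  rewrite le_min => /andP[q1 q2]; have [vu|uv] := leP v u; first by apply: H1 q1; rewrite av.
  apply: Hr q2; rewrite distrC ger0_norm ?subr_ge0//; lra.
Qed.

(** Each clause is an open condition that holds along a compact piece of [gam],
    hence in a tube around it; the condition at the end of the tube holds because
    the height decreases after the landing. *)
Lemma arc_base_exists (X : 'rV[R]_3 -> 'rV[R]_3) (L : R) gam T (O : set 'rV[R]_3) : 0 <= L ->
  (forall p q, `|X p - X q| <= L * `|p - q|) -> (forall t, is_derive t 1 gam (X (gam t))) ->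
  0 < T -> zc (gam 0) = 0 -> zc (gam T) = 0 -> (forall t, 0 < t < T -> 0 < zc (gam t)) ->
  0 < zc (X (gam 0)) -> zc (X (gam T)) < 0 -> (forall t, 0 <= t <= T -> nbhs (gam t) O) ->
  exists k r m, arc_base X L gam T k r m /\
    forall t q, 0 <= t <= T + k -> `|q - gam t| <= r -> O q.
Proof.
move=> L0 XL dg T0 z0 zT pos v0 vT HO.
have cg : continuous gam := continuous_is_derive dg.
have zX p q : `|zc (X q) - zc (X p)| <= L * `|q - p| by rewrite -zcB; apply: le_trans (zc_norm _) _.
pose m := Num.min (zc (X (gam 0))) (- zc (X (gam T))) / 4.
have m0 : 0 < m by rewrite divr_gt0// lt_min v0 oppr_gt0.
have m1 : 2 * m < zc (X (gam 0)).
  have : m * 4 <= zc (X (gam 0)) by rewrite divfK ?gt_eqF// ge_min lexx.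
  lra.
have m2 : 2 * m < - zc (X (gam T)).
  have : m * 4 <= - zc (X (gam T)) by rewrite divfK ?gt_eqF// ge_min lexx orbT.
  lra.
clearbody m.
have near_time (a : R) (A : set 'rV[R]_3) : nbhs (gam a) A ->
    exists2 d, 0 < d & forall t, `|t - a| <= d -> nbhs (gam t) A.
  move=> /nbhs_interior/cg/nbhs_ballP[d /= d0 Hd].
  have d2 : 0 < d / 2 by rewrite divr_gt0.
  exists (d / 2) => // t td; apply: Hd; rewrite -ball_normE /= distrC.
  by apply: le_lt_trans td _; lra.
have [k1 k10 H1] := near_time 0 _ (lipschitz_gt L0 (zX _) m1).
have zXN p q : `|- zc (X q) - - zc (X p)| <= L * `|q - p|.
  by rewrite opprK addrC distrC.
have [k2 k20 H2] := near_time T _ (lipschitz_gt (f := fun q => - zc (X q)) L0 (zXN _) m2).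
have [|k3 k30 H3] := near_time T O; first by apply: HO; rewrite lexx ltW.
pose k := Num.min (Num.min k1 k2) (Num.min k3 (T / 4)).
have k0 : 0 < k by rewrite !lt_min k10 k20 k30 divr_gt0.
have kk1 : k <= k1 by rewrite !ge_min lexx.
have kk2 : k <= k2 by rewrite !ge_min lexx !orbT.
have kk3 : k <= k3 by rewrite !ge_min lexx !orbT.
have kT : k <= T / 4 by rewrite !ge_min lexx !orbT.
clearbody k.
have Tk : T - k <= T + k by lra.
have kTk : k <= T - k by lra.
have [|r1 r10 T1] := @uniform_tube gam 0 k [set q | 2 * m < zc (X q)] (ltW k0) cg.
  by move=> t /andP[t0 tk]; apply: H1; rewrite subr0 ger0_norm// (le_trans tk).
have [|r2 r20 T2] := @uniform_tube gam (T - k) (T + k) [set q | 2 * m < - zc (X q)] Tk cg.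
  by move=> t /andP[t0 tk]; apply: H2; rewrite ler_norml; apply/andP; split; lra.
have zcL p q : `|zc q - zc p| <= 1 * `|q - p| by rewrite mul1r -zcB zc_norm.
have [|r3 r30 T3] := @uniform_tube gam k (T - k) [set q | 0 < zc q] kTk cg.
  move=> t /andP[t0 tk]; apply: (lipschitz_gt ler01 (zcL _)).
  by apply: pos; apply/andP; split; lra.
have T0k : 0 <= T + k by lra.
have [|r4 r40 T4] := @uniform_tube gam 0 (T + k) O T0k cg.
  move=> t /andP[t0 tk]; have [tT|Tt] := leP t T; first by apply: HO; rewrite t0.
  by apply: H3; rewrite gtr0_norm; lra.
have zneg : zc (gam (T + k)) < 0.
  rewrite -zT; apply: (@decreasing_of_derive _ (fun t => zc (gam t)) (fun t => zc (X (gam t)))); first by lra.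
    by move=> t _; exact: is_derive_zc.
  move=> t /andP[t1 t2]; have := T2 t (gam t); rewrite subrr normr0 (ltW r20).
  have tI : T - k <= t <= T + k by apply/andP; split; lra.
  by move=> /(_ tI isT) /=; lra.
have e5 : 0 < - zc (gam (T + k)) / 2 by rewrite divr_gt0 ?oppr_gt0.
pose r := Num.min (Num.min r1 r2) (Num.min r3 (Num.min r4 (- zc (gam (T + k)) / 2))).
have rr1 : r <= r1 by rewrite !ge_min lexx.
have rr2 : r <= r2 by rewrite !ge_min lexx !orbT.
have rr3 : r <= r3 by rewrite !ge_min lexx !orbT.
have rr4 : r <= r4 by rewrite !ge_min lexx !orbT.
have rr5 : r <= - zc (gam (T + k)) / 2 by rewrite !ge_min lexx !orbT.
exists k, r, m; split; last by move=> t q tI qr; exact: T4 tI (le_trans qr rr4).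
split=> //.
- lra.
- by rewrite !lt_min r10 r20 r30 r40.
- by move=> t q tI qr; apply/ltW/(T1 t q tI (le_trans qr rr1)).
- by move=> t q tI qr; have := T2 t q tI (le_trans qr rr2) => /=; lra.
- by move=> t q tI qr; apply: (T3 t q tI (le_trans qr rr3)).
- move=> q qr; have := le_trans (zc_norm _) (le_trans qr rr5).
  by rewrite zcB ler_norml => /andP[_]; lra.
Qed.

Lemma canonX_matrix mu H : exists A : 'M[R]_3, forall p q, canonX mu H p - canonX mu H q = (p - q) *m A.
Proof.
have [A HA] := linX_matrix mu H; exists A => p q.
by rewrite !canonX_rest !HA -mulmxBl opprB addrA subrK.
Qed.

Lemma canonX_lipschitz mu H : exists2 L, 0 <= L &
  forall p q, `|canonX mu H p - canonX mu H q| <= L * `|p - q|.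
Proof.
have [A HA] := canonX_matrix mu H; exists (3%:R * `|A|); first by rewrite mulr_ge0.
by move=> p q; rewrite HA norm_mulmx_le.
Qed.

Lemma arcflow_speeds mu H p T : zc p = 0 -> arc_time mu H p T ->
  let q := arcflow mu H p T in
  [/\ zc q = 0, yc p = speed mu T, yc q = - speed (- mu) T &
      xc q - H * yc q = expR (- 2 * mu * T) * (xc p - H * yc p)].
Proof.
move=> zp [T1 T2 zq _] /=; have [h1 h2] := landing_speed T1 T2 zp zq.
by split => //; exact: arcflow_x.
Qed.

Lemma arcflow_base mu H p T (O : set 'rV[R]_3) : 0 < mu -> zc p = 0 -> 0 < yc p -> arc_time mu H p T ->
  (forall t, 0 <= t <= T -> nbhs (arcflow mu H p t) O) ->
  exists L k r m, arc_base (canonX mu H) L (arcflow mu H p) T k r m /\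
    forall t q, 0 <= t <= T + k -> `|q - arcflow mu H p t| <= r -> O q.
Proof.
move=> mu0 zp yp TP HO; have [L L0 HL] := canonX_lipschitz mu H; exists L.
have [zq _ yq _] := arcflow_speeds zp TP.
case: TP => T1 T2 zT pos.
have T0 : 0 < T by exact: lt_trans (pi_gt0 R) T1.
have z0 : zc (arcflow mu H p 0) = 0 by rewrite arcflow0.
have v0 : 0 < zc (canonX mu H (arcflow mu H p 0)) by rewrite arcflow0 zc_vec3.
have vT : zc (canonX mu H (arcflow mu H p T)) < 0.
  by rewrite zc_vec3 yq oppr_lt0; exact: speed_gt0.
exact: (arc_base_exists L0 HL (is_derive_arcflow mu H p) T0 z0 zT pos v0 vT HO).
Qed.

Lemma conjZ_canon mu H : conjZ (canonZ mu H) = canonZ mu H.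
Proof.
rewrite /conjZ /canonZ /canonY /=; congr PwSys.
  by apply/funext => p /=; rewrite !canonSK.
Qed.

Lemma canon_crossing mu H p : crossing (canonZ mu H) p -> zc p = 0 /\ 0 < yc p * xc p.
Proof. by move=> [z0]; rewrite /lief /= {1}/canonX canonYE !zc_vec3. Qed.

Lemma follows_arcflow mu H p T psi : 0 < mu -> zc p = 0 -> 0 < yc p -> arc_time mu H p T ->
  trajectory (canonZ mu H) setT psi -> psi 0 = p ->
  forall t, 0 <= t <= T -> psi t = arcflow mu H p t.
Proof.
move=> mu0 zp yp TP tr p0 t /andP[t0 tT].
have [|L [k [r [m [B _]]]]] := @arcflow_base mu H p T setT mu0 zp yp TP.
  by move=> s _; exact: filterT.
have [L' L'0 HL] := canonX_lipschitz mu H.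
have nF : near_field (canonX mu H) (arcflow mu H p) T k r m 0 (upper (canonZ mu H)).
  split=> //; first exact: ltW (ab_m0 B).
  move=> s sI q qr; split; last 2 first.
  - by rewrite subrr normr0.
  - by move=> q' _; rewrite !subrr normr0 mul0r.
  apply/(@cvgrPdist_lt _ _ _ _ (nbhs_filter q)) => e e0.
  have L1 : 0 < L' + 1 by rewrite ltr_wpDl.
  apply/nbhs_ballP; exists (e / (L' + 1)); first by rewrite /= divr_gt0.
  move=> q'; rewrite -ball_normE /= ltr_pdivlMr// => h.
  apply: le_lt_trans (HL _ _) _; apply: le_lt_trans h; rewrite mulrC ler_wpM2l// lerDl//.
have T0 : 0 < T by have := ab_k0 B; have := ab_kT B; lra.
have k0 := ab_k0 B; have kT := ab_kT B; have r0 := ab_r0 B.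
have A : is_arc (upper (canonZ mu H)) (arcflow mu H p) T k r 0 p (arcflow mu H p) T.
  case: TP => T1 T2 zT pos; split => //.
  - exact: arcflow0.
  - by move=> s _; exact: is_derive_arcflow.
  - by move=> s _; rewrite subrr normr0.
  - by rewrite T0/= ltrDl.
  - by rewrite ltrBlDr ltrDl.
have side : 0 < zc p \/ zc p = 0 /\ 0 < lief (upper (canonZ mu H)) p.
  by right; rewrite /lief /= {1}/canonX zc_vec3.
apply: (trajectory_follows_arc B nF (lexx 0) (ltW T0) A side) => //.
exact: trajectory_sub tr.
Qed.

(** One half of the turn, returned to the upper side by the symmetry. *)
Lemma half_turn mu H p psi : 0 < mu -> zc p = 0 -> 0 < yc p ->
  trajectory (canonZ mu H) setT psi -> psi 0 = p ->
  exists T q, [/\ arc_time mu H p T, q = S (psi T), zc q = 0, 0 < yc q &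
   [/\ yc p = speed mu T, xc q = speed (- mu) T,
      H * xc q - yc q = expR (- 2 * mu * T) * (xc p - H * yc p) &
      trajectory (canonZ mu H) setT (fun t => S (psi (t + T)))]].
Proof.
move=> mu0 zp yp tr p0; have [T TP] := arc_time_exists H mu0 zp yp.
have [zq yp' yq xq] := arcflow_speeds zp TP.
have T0 : 0 <= T by case: TP => T1 _ _ _; apply/ltW/(lt_trans (pi_gt0 R)).
have pT : psi T = arcflow mu H p T by apply: (follows_arcflow mu0 zp yp TP tr p0); rewrite T0 lexx.
exists T, (S (psi T)); rewrite pT canonS_x canonS_y canonS_z zq oppr0; split => //.
  have sp : 0 < speed (- mu) T by case: TP => T1 T2 _ _; exact: speed_gt0.
  have [_ cr _ _] := tr T I; have [] := canon_crossing (cr _); first by rewrite pT.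
  have sn : - speed (- mu) T < 0 by rewrite oppr_lt0.
  by rewrite pT yq => _; rewrite (nmulr_rgt0 _ sn) oppr_gt0.
split=> //.
- by rewrite yq opprK.
- by rewrite -xq; ring.
- have := trajectory_conj (trajectory_shift (c := - T) tr); rewrite conjZ_canon opprK.
  exact: trajectory_sub.
Qed.

End Decoding.

Section Decode.
Variable R : realType.
Implicit Types (mu H t : R) (p q : 'rV[R]_3).
Local Notation S := (@canonS R).

Lemma half_turns mu H p T psi : 0 < mu -> zc p = 0 -> 0 < yc p -> arc_time mu H p T ->
  S (arcflow mu H p T) = p -> trajectory (canonZ mu H) setT psi -> psi 0 = p ->
  forall n t, 0 <= t <= T -> psi (n%:R * T + t) = iter n S (arcflow mu H p t).
Proof.
move=> mu0 zp yp TP ST tr p0 n; elim: n psi tr p0 => [|n IH] psi tr p0 t tI.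
  by rewrite mul0r add0r; exact: (follows_arcflow mu0 zp yp TP tr p0).
have T0 : 0 <= T by case: TP => T1 _ _ _; apply/ltW/(lt_trans (pi_gt0 R)).
have pT : psi T = arcflow mu H p T by apply: (follows_arcflow mu0 zp yp TP tr p0); rewrite T0 lexx.
have tr' : trajectory (canonZ mu H) setT (fun t => S (psi (t + T))).
  have := trajectory_conj (trajectory_shift (c := - T) tr); rewrite conjZ_canon opprK.
  exact: trajectory_sub.
have := IH _ tr' _ t tI; rewrite add0r pT ST => /(_ erefl) h.
by rewrite iterS -h canonSK -natr1; congr psi; ring.
Qed.

(** Two half turns lead back to the starting point, because a cycle of simple
    period has one take-off point only; by the comparison of arc times each
    half turn already does. *)
Lemma cycle_shape mu H g : 0 < mu -> 0 < H -> crossing_periodic_orbit (canonZ mu H) g ->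
  simple_period g -> exists p T, [/\ zc p = 0, 0 < yc p, arc_time mu H p T,
    S (arcflow mu H p T) = p &
    [/\ xc p = speed (- mu) T, yc p = speed mu T,
     yc p + expR (- 2 * mu * T) * xc p = H * (xc p + expR (- 2 * mu * T) * yc p) &
     g = [set x | exists2 t, 0 <= t <= T & x = arcflow mu H p t \/ S x = arcflow mu H p t]]].
Proof.
move=> mu0 H0 [[phi [P [tr P0 per _ gE]]] [x [gx Sx]] _] [p1 [p2 [p12 g2]]].
have shift s : trajectory (canonZ mu H) setT (fun t => phi (t + s)).
  by have := trajectory_shift (c := - s) tr; rewrite opprK; exact: trajectory_sub.
have gphi t : g (phi t) by rewrite gE; exists t.
have [s [zs ys xs]] : exists s, [/\ zc (phi s) = 0, 0 < yc (phi s) & 0 < xc (phi s)].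
  move: gx Sx; rewrite gE => -[s _ <-] zs.
  have [_ cr _ _] := tr s I; have [_ yx] := canon_crossing (cr zs).
  case: (ltgtP (yc (phi s)) 0) => [yn|yp|y0]; last by move: yx; rewrite y0 mul0r ltxx.
    have xn : xc (phi s) < 0 by rewrite -(nmulr_rgt0 _ yn).
    have tr' : trajectory (canonZ mu H) setT (fun t => S (phi (t + s))).
      by have := trajectory_conj (shift s); rewrite conjZ_canon.
    have [||T [q [TP qE zq yq [_ xq _ _]]]] := half_turn mu0 _ _ tr' erefl.
    - by rewrite add0r canonS_z zs oppr0.
    - by rewrite add0r canonS_y oppr_gt0.
    - rewrite canonSK in qE; exists (T + s); rewrite -qE; split => //.
      by rewrite xq; case: TP => T1 T2 _ _; exact: speed_gt0.
  by exists s; split => //; rewrite -(pmulr_rgt0 _ yp).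
set p := phi s in zs ys xs.
have p0 : phi (0 + s) = p by rewrite add0r.
have [T1 [q [T1P qE zq yq [yp1 xq1 eq1 tr1]]]] := half_turn mu0 zs ys (shift s) p0.
have q0 : S (phi (0 + T1 + s)) = q by rewrite add0r.
have [T2 [p' [T2P p'E zp' yp' [yq2 xp2 eq2 _]]]] := half_turn mu0 zq yq tr1 q0.
rewrite canonSK in p'E.
have xq0 : 0 < xc q by rewrite xq1; case: T1P => T1a T1b _ _; exact: speed_gt0.
have gq : g (S q) by rewrite qE canonSK.
have Sq : Sigma (S q) by rewrite /Sigma/= canonS_z zq oppr0.
have ySq : yc (S q) < 0 by rewrite canonS_y oppr_lt0.
have p'p : p' = p.
  have m1 : (g `&` Sigma) p by split => //; exact: gphi.
  have m2 : (g `&` Sigma) p' by split => //; rewrite p'E; exact: gphi.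
  have m3 : (g `&` Sigma) (S q) by [].
  have n1 : p <> S q by move=> e; move: ySq; rewrite -e; lra.
  have n2 : p' <> S q by move=> e; move: ySq; rewrite -e; lra.
  move: m1 m2 m3; rewrite g2 /= => -[a1|a1] [a2|a2] [a3|a3]; congruence.
rewrite {}p'p in xp2 eq2.
have [T1a T1b _ _] := T1P; have [T2a T2b _ _] := T2P.
have E1 : speed mu T2 + expR (- 2 * mu * T1) * speed (- mu) T2 =
    H * (speed (- mu) T1 + expR (- 2 * mu * T1) * speed mu T1).
  by move: eq1; rewrite yp1 xp2 xq1 yq2; lra.
have E2 : speed mu T1 + expR (- 2 * mu * T2) * speed (- mu) T1 =
    H * (speed (- mu) T2 + expR (- 2 * mu * T2) * speed mu T2).
  by move: eq2; rewrite yp1 xp2 xq1 yq2; lra.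
have T12 : T1 = T2.
  case: (ltgtP T1 T2) => // h; exfalso.
    by apply: (times_ordered mu0 H0 T1a h T2b _ _ E1 E2); rewrite -?yp1 -?yq2.
  by apply: (times_ordered mu0 H0 T2a h T1b _ _ E2 E1); rewrite -?yp1 -?yq2.
rewrite -{}T12 in yq2 xp2 E1 *.
have qp : q = p by apply: vec3_inj; rewrite ?xq1 ?xp2 ?yq2 ?yp1// zq zs.
have pT : phi (T1 + s) = arcflow mu H p T1.
  apply: (follows_arcflow mu0 zs ys T1P (shift s) p0).
  by rewrite lexx andbT; apply/ltW/(lt_trans (pi_gt0 R)).
have ST : S (arcflow mu H p T1) = p by rewrite -pT -qE.
exists p, T1; split => //; split => //; first by rewrite xp2 yp1.
have T0 : 0 < T1 by exact: lt_trans (pi_gt0 R) T1a.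
have turns := half_turns mu0 zs ys T1P ST (shift s) p0.
have iterS2 n y : iter n S y = y \/ iter n S y = S y.
  elim: n => [|n [] /= ->]; [by left|by right|by left; rewrite canonSK].
apply/seteqP; split => [y|y].
  rewrite gE => -[u _ <-].
  have perN n v : phi (v + n%:R * P) = phi v.
    elim: n v => [|n IH] v; first by rewrite mul0r addr0.
    by rewrite -natr1 mulrDl mul1r addrA per IH.
  have [v v0 <-] : exists2 v, 0 <= v & phi (v + s) = phi u.
    pose n := Num.bound (`|u - s| / P).
    exists (u - s + n%:R * P); last by rewrite addrAC subrK perN.
    have : `|u - s| < n%:R * P by rewrite -ltr_pdivrMr//; apply/archi_boundP; rewrite divr_ge0// ltW.
    by rewrite ltr_norml => /andP[h _]; lra.
  pose n := Num.truncn (v / T1).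
  have vT0 : 0 <= v / T1 by rewrite divr_ge0// ltW.
  have /andP[n1 n2] := truncn_itv vT0.
  rewrite ler_pdivlMr// in n1; rewrite ltr_pdivrMr// in n2.
  have tI : 0 <= v - n%:R * T1 <= T1.
    by rewrite subr_ge0 n1 lerBlDl -[X in _ + X]mul1r -mulrDl natr1 ltW.
  exists (v - n%:R * T1) => //.
  have := turns n _ tI; rewrite [n%:R * T1 + _]addrC subrK => ->.
  by have [->|->] := iterS2 n (arcflow mu H p (v - n%:R * T1)); [left|right; rewrite canonSK].
move=> [t tI [->|Sy]].
  by have := turns 0%N t tI; rewrite /= mul0r add0r => <-; exact: gphi.
have -> : y = S (arcflow mu H p t) by rewrite -Sy canonSK.
by have := turns 1%N t tI; rewrite /= => <-; exact: gphi.
Qed.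

End Decode.

(** * From C^1 closeness to the tube *)

Section Transfer.
Variable R : realType.
Implicit Types (F G X : 'rV[R]_3 -> 'rV[R]_3) (K : set 'rV[R]_3) (p q v : 'rV[R]_3).
Local Notation S := (@canonS R).

Lemma canonS_linear : linear S.
Proof. by move=> a u v; rewrite canonSD canonSZ. Qed.

HB.instance Definition _ := GRing.isLinear.Build R 'rV[R]_3 'rV[R]_3 *:%R S canonS_linear.

Let MS : 'M[R]_3 := lin1_mx S.
Let MSE v : v *m MS = S v. Proof. exact: mul_rV_lin1. Qed.

Lemma canonS_differentiable p : differentiable S p.
Proof. exact/linear_differentiable/canonS_continuous. Qed.

Lemma diff_conj F p : differentiable F (S p) ->
  differentiable (S \o F \o S) p /\ forall v, 'd (S \o F \o S) p v = S ('d F (S p) (S v)).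
Proof.
move=> dF; have dS := canonS_differentiable.
have d1 : differentiable (S \o F) (S p) by exact: differentiable_comp.
split; first exact: differentiable_comp.
have dSE x : 'd S x = S :> ('rV[R]_3 -> 'rV[R]_3) by exact: diff_lin (@canonS_continuous R).
have e1 := @diff_comp _ _ _ _ S (S \o F) p (dS p) d1.
have e2 := @diff_comp _ _ _ _ F S (S p) dF (dS _).
move=> v; have h1 := congr1 (fun f : 'rV[R]_3 -> 'rV[R]_3 => f v) e1.
have h2 := congr1 (fun f : 'rV[R]_3 -> 'rV[R]_3 => f ('d S p v)) e2.
have h3 := congr1 (fun f : 'rV[R]_3 -> 'rV[R]_3 => f v) (dSE p).
have h4 := congr1 (fun f : 'rV[R]_3 -> 'rV[R]_3 => f ('d F (S p) ('d S p v))) (dSE (F (S p))).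
apply: (etrans h1); apply: (etrans h2); apply: (etrans h4).
by congr (S ('d F (S p) _)); exact: h3.
Qed.

(** [F] is C^1 near [K] and C^1-close there to the affine field [X] with linear
    part [A]; stated with differentials, so as to be invariant under conjugation
    by the symmetry. *)
Definition c1_near K (A : 'M[R]_3) (eps : R) X F := forall p, K p ->
  [/\ \forall q \near p, differentiable F q, {for p, continuous (jacobian F)},
      `|F p - X p| <= eps & forall v, `|'d F p v - v *m A| <= eps * `|v|].

Lemma affine_diff X (A : 'M[R]_3) p : (forall p q, X p - X q = (p - q) *m A) ->
  differentiable X p /\ forall v, 'd X p v = v *m A.
Proof.
move=> XA.
have cA : continuous (mulmxr A : 'rV[R]_3 -> 'rV[R]_3).
  move=> x; apply/(@cvgrPdist_le _ _ _ _ (nbhs_filter x)) => e e0.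
  have C0 : 0 < 3%:R * `|A| + 1 by rewrite ltr_wpDl// mulr_ge0.
  apply/nbhs_ballP; exists (e / (3%:R * `|A| + 1)); first by rewrite /= divr_gt0.
  move=> y; rewrite -ball_normE /= ltr_pdivlMr// => h.
  rewrite -mulmxBl; apply: le_trans (norm_mulmx_le _ _) _; apply: le_trans (ltW h).
  by rewrite mulrC ler_wpM2l// lerDl.
have XE : X = cst (X 0) + (mulmxr A : 'rV[R]_3 -> 'rV[R]_3).
  by apply/funext => x; rewrite !fctE /= -[x in x *m _]subr0 -XA addrC subrK.
have d1 : differentiable (mulmxr A : 'rV[R]_3 -> 'rV[R]_3) p by exact: linear_differentiable.
have d2 : differentiable (cst (X 0) : 'rV[R]_3 -> 'rV[R]_3) p by exact: differentiable_cst.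
rewrite XE; split; first exact: differentiableD.
move=> v; have h1 := congr1 (fun f : 'rV[R]_3 -> 'rV[R]_3 => f v) (diffD d2 d1).
have h2 := congr1 (fun f : 'rV[R]_3 -> 'rV[R]_3 => f v) (diff_cst (X 0) p).
have h3 := congr1 (fun f : 'rV[R]_3 -> 'rV[R]_3 => f v) (diff_lin p cA).
apply: (etrans h1); apply: (etrans (congr2 +%R h2 h3)); exact: add0r.
Qed.

Lemma sub_affine_diff F X (A : 'M[R]_3) p : (forall p q, X p - X q = (p - q) *m A) ->
  differentiable F p ->
  differentiable (F \- X) p /\ forall v, 'd (F \- X) p v = 'd F p v - v *m A.
Proof.
move=> XA dF; have [dX dXE] := affine_diff p XA; split; first exact: differentiableB.
move=> v; rewrite -dXE.
exact: (congr1 (fun f : 'rV[R]_3 -> 'rV[R]_3 => f v) (diffB dF dX)).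
Qed.

Lemma c1_near_of K eps X F (A : 'M[R]_3) : (forall p q, X p - X q = (p - q) *m A) ->
  C1_on K F -> C1_close K eps X F -> c1_near K A (3%:R * eps) X F.
Proof.
move=> XA [W [oW KW HW]] Hc p Kp; have [dF cF] := HW p (KW p Kp).
have [h1 h2] := Hc p Kp.
split => //.
- have : nbhs p W by apply: open_nbhs_nbhs; split => //; exact: KW.
  by apply: filterS => q /HW[].
- apply: le_trans (ltW h1) _; rewrite ler_peMl ?ler1n//.
  by apply: le_trans (ltW h1).
- move=> v; have [_ <-] := sub_affine_diff XA dF; rewrite jacobianE.
  apply: le_trans (norm_mulmx_le _ _) _; rewrite ler_wpM2r// ler_wpM2l// ltW//.
Qed.

Lemma c1_near_conj K eps X F (A : 'M[R]_3) :
  c1_near K (MS *m A *m MS) eps (S \o X \o S) F ->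
  c1_near (S @^-1` K) A eps X (S \o F \o S).
Proof.
move=> H p Kp; have [dF cF h1 h2] := H (S p) Kp.
have dn : \forall q \near p, differentiable F (S q) by exact: canonS_continuous dF.
have jacE q : differentiable F (S q) -> jacobian (S \o F \o S) q = MS *m jacobian F (S q) *m MS.
  move=> d; have [_ dE] := diff_conj d.
  apply/row_matrixP => i; rewrite !rowE -jacobianE dE jacobianE !mulmxA !MSE.
  by [].
split.
- by apply: filterS dn => q /diff_conj[].
- apply/(@cvgrPdist_le _ _ _ _ (nbhs_filter p)) => e e0.
  have C0 : 0 < 3%:R * `|MS| * (3%:R * `|MS|) + 1 by rewrite ltr_wpDl// !mulr_ge0.
  have dp := nbhs_singleton dn; have cJ := continuous_comp (@canonS_continuous R p) cF.
  have /(@cvgrPdist_le _ _ _ _ (nbhs_filter p))/(_ _ (divr_gt0 e0 C0)) Hn := cJ.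
  apply: filterS2 dn Hn => q dq /=; rewrite !jacE//.
  rewrite ler_pdivlMr// => h; rewrite -mulmxBl -mulmxBr.
  apply: le_trans (norm_mulmx_le _ _) _; apply: le_trans h.
  apply: (@le_trans _ _ (3%:R * `|MS| * (3%:R * `|jacobian F (S p) - jacobian F (S q)| * `|MS|))).
    by rewrite ler_wpM2l// ?mulr_ge0// norm_mulmx_le.
  rewrite (_ : _ * (3%:R * _ * _) = `|jacobian F (S p) - jacobian F (S q)| * (3%:R * `|MS| * (3%:R * `|MS|))); last by ring.
  by rewrite ler_wpM2l// lerDl.
- by move: h1; rewrite /= canonSK => h1; rewrite -canonS_dist canonSK.
- have [_ dE] := diff_conj (nbhs_singleton dF).
  move=> v; rewrite dE; have := h2 (S v); rewrite canonS_norm; apply: le_trans.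
  rewrite -canonS_dist canonSK !mulmxA !MSE canonSK.
  by [].
Qed.

(** What the dynamical part asks of a perturbed field follows from closeness on
    a set that contains the tube. *)
Lemma c1_near_field X L gam T k r m K (A : 'M[R]_3) eps F : arc_base X L gam T k r m ->
  (forall p q, X p - X q = (p - q) *m A) -> (forall t q, 0 <= t <= T + k -> `|q - gam t| <= r -> K q) ->
  0 <= eps -> eps <= 1 -> eps <= m -> c1_near K A eps X F ->
  near_field X gam T k r m eps F /\ smooth_field gam T k r L F.
Proof.
move=> B XA tube e0 e1 em H; split.
  split => // t tI p pr; have Kp := tube t p tI pr; have [dF _ h1 _] := H p Kp.
  have dFp : differentiable F p := nbhs_singleton dF.
  split=> //; first exact: differentiable_continuous.
  move=> q qr.
  have near x (xr : `|x - gam t| <= r) := sub_affine_diff XA (nbhs_singleton (let: And4 d _ _ _ := H x (tube t x tI xr) in d)).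
  have H1 x : `|x - gam t| <= r -> differentiable (F \- X) x by move=> /near[].
  have H2 x v : `|x - gam t| <= r -> `|'d (F \- X) x v - v *m 0| <= eps * `|v|.
    by move=> xr; rewrite (near x xr).2 mulmx0 subr0; have [_ _ _] := H x (tube t x tI xr).
  by have := diff_close_ball H1 H2 pr qr; rewrite mulmx0 subr0.
move=> t tI p pr; have [/nbhs_singleton dF cF _ h] := H p (tube t p tI pr).
split=> // v; have := h v => hv.
have LA : `|v *m A| <= L * `|v|.
  have := ab_lip B v 0; rewrite XA !subr0; exact.
rewrite -(subrK (v *m A) ('d F p v)); apply: le_trans (ler_normD _ _) _.
rewrite addrC mulrDl lerD// mul1r; apply: le_trans hv _.
by rewrite ler_piMl.
Qed.

End Transfer.

(** * The derivative at the cycle and the theorem *)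

Section DerivativeAtCycle.
Variable R : realType.
Implicit Types (mu H t : R) (p q : 'rV[R]_3).
Local Notation S := (@canonS R).

(** By the equations [R1] for the landing height and [R2] for the landing speed
    the entries of the derivative reduce to the ratio [f] and to the number [A]
    of [half_contraction]. *)
Lemma half_derivativeE mu H p T (E : R -> 'M[R]_3) : zc p = 0 -> 0 < xc p -> arc_time mu H p T ->
  S (arcflow mu H p T) = p -> (forall t v, linflow mu H t v = v *m E t) ->
  let e := expR (- 2 * mu * T) in let f := yc p / (e * xc p) in
  forall v : 'rV[R]_2, let w := half_derivative (canonX mu H) (arcflow mu H p) T E v in
  w ord0 (inord 0) = f * v ord0 (inord 1) /\
  w ord0 (inord 1) = (H * e + H * f + 2 * mu * expR (mu * T) * (sin T / xc p) * (H * xc p - yc p)) *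
     v ord0 (inord 1) - e * v ord0 (inord 0).
Proof.
move=> zp x0 TP ST HE e f v w.
have [T1 T2 zT _] := TP.
have n0 : 1 + mu ^+ 2 != 0 by rewrite gt_eqF// mu2_gt0.
have xn : xc p != 0 by rewrite gt_eqF.
have qE : arcflow mu H p T = S p by rewrite -[LHS]canonSK ST.
have R1 : 1 - expR (mu * T) * (cos T - mu * sin T) + (1 + mu ^+ 2) * (expR (mu * T) * (yc p * sin T)) = 0.
  have := zT; rewrite arcflow_z// => h; rewrite -(mulr0 (1 + mu ^+ 2)) -h; by field.
have R2 : - xc p = expR (mu * T) * (yc p * cos T + (mu * yc p + 1) * sin T).
  by rewrite -(arcflow_y mu H T zp) qE canonS_y.
have en : expR (mu * T) != 0 by rewrite gt_eqF// expR_gt0.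
have eE : e = expR (mu * T) ^- 2.
  by rewrite /e -mulrA mulNr expRN mulr_natl mulr2n expRD -expr2.
have cs := cos2Dsin2 T.
have K : xc p * (cos T - mu * sin T) + sin T = - (expR (mu * T) * yc p).
  rewrite -[xc p]opprK R2; apply/eqP; rewrite -subr_eq0; apply/eqP.
  (* the landing equation [R1] times [sin T], corrected by cos^2 + sin^2 = 1 *)
  transitivity (sin T * (1 - expR (mu * T) * (cos T - mu * sin T) +
     (1 + mu ^+ 2) * (expR (mu * T) * (yc p * sin T))) -
     expR (mu * T) * yc p * (cos T ^+ 2 + sin T ^+ 2 - 1)); first by ring.
  by rewrite R1 cs; ring.
have fE : f = - expR (mu * T) * (cos T - mu * sin T + sin T / xc p).
  transitivity (- expR (mu * T) * ((xc p * (cos T - mu * sin T) + sin T) / xc p)); last by field.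
  by rewrite K /f eE; field; rewrite en xn.
have wE : w = fromSigma (S (linflow mu H T (toSigma v) +
    (zc (linflow mu H T (toSigma v)) / xc p) *: canonX mu H (S p))).
  rewrite /w /half_derivative /proj_along -HE qE; congr (fromSigma (S (_ + _))).
  rewrite -scaleNr; congr (_ *: _).
  by rewrite [zc (canonX _ _ _)]zc_vec3 canonS_y invrN mulrN opprK.
have [v0 v0E] : exists a, a = v ord0 (inord 0) by eexists.
have [v1 v1E] : exists a, a = v ord0 (inord 1) by eexists.
have xv : xc (toSigma v) = v0 by rewrite xc_vec3.
have yv : yc (toSigma v) = v1 by rewrite yc_vec3.
have lz : zc (linflow mu H T (toSigma v)) = expR (mu * T) * (v1 * sin T).
  by rewrite zc_vec3 /flow_z toSigma_z yv; ring.
have ly : yc (linflow mu H T (toSigma v)) = expR (mu * T) * (v1 * cos T + mu * v1 * sin T).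
  by rewrite yc_vec3 /flow_y toSigma_z yv; ring.
have lx : xc (linflow mu H T (toSigma v)) = e * (v0 - H * v1) +
    H * (expR (mu * T) * (v1 * cos T + mu * v1 * sin T)) - 4 * mu * H * (expR (mu * T) * (v1 * sin T)).
  by rewrite xc_vec3 xv yv toSigma_z /flow_y /flow_z -/e; ring.
have Xy : yc (canonX mu H (S p)) = 1 - 2 * mu * xc p.
  by rewrite yc_vec3 canonS_y canonS_z zp; ring.
have Xx : xc (canonX mu H (S p)) = 2 * mu * yc p + H.
  by rewrite xc_vec3 canonS_x canonS_z zp; ring.
rewrite wE !mxE !inordK//= canonS_x canonS_y xcD ycD xcZ ycZ Xx Xy lx ly lz fE -v0E -v1E.
by split; field.
Qed.

End DerivativeAtCycle.

Theorem corollary3 (R : realType) (mu tg H : R) (g K : set 'rV[R]_3)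
    (mu_gt0 : 0 < mu) (tgP : is_tg mu tg) (HI : Hg mu tg < H < Hcrit mu)
    (gP : crossing_periodic_orbit (canonZ mu H) g) (g_simple : simple_period g)
    (K_compact : compact K) (K_nbhs : set_nbhs g K) :
  exists (eps : R) (U : set 'rV[R]_3), [/\ 0 < eps, set_nbhs g U &
    forall Xt Yt : 'rV[R]_3 -> 'rV[R]_3,
      C1_on K Xt -> C1_on K Yt ->
      C1_close K eps (canonX mu H) Xt -> C1_close K eps (canonY mu H) Yt ->
      let Zt := PwSys K Xt Yt in
      exists gt : set 'rV[R]_3,
        [/\ simple_crossing_limit_cycle Zt gt, gt `<=` U,
            forall g', simple_crossing_limit_cycle Zt g' -> g' `<=` U ->
              g' = gt,
            hyperbolic Zt gt &
            orbitally_asymptotically_stable Zt gt]].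
Proof.
have H0 : 0 < H by have /andP[h _] := HI; apply: lt_trans h; exact: expR_gt0.
have [p [T [zp yp TP ST [xE yE eqH gE]]]] := cycle_shape mu_gt0 H0 gP g_simple.
have [T1 T2 zT pos] := TP.
have xp : 0 < xc p by rewrite xE; exact: speed_gt0.
pose gam := arcflow mu H p.
have gam0 : gam 0 = toSigma (fromSigma p) by rewrite fromSigmaK//; exact: arcflow0.
have gamT : canonS (gam T) = gam 0 by rewrite gam0 fromSigmaK.
have onK t : 0 <= t <= T -> nbhs (gam t) (K `&` @canonS R @^-1` K).
  move=> tI; apply: filterI; first by apply: K_nbhs; rewrite gE; exists t => //; left.
  apply: canonS_continuous; apply: K_nbhs; rewrite gE; exists t => //; right.
  by rewrite canonSK.
have [L [k [r [m [B tube]]]]] := arcflow_base mu_gt0 zp yp TP onK.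
have [E HE] := linflow_matrix mu H.
have [A HA] := linX_matrix mu H.
have XA (q q' : 'rV[R]_3) : canonX mu H q - canonX mu H q' = (q - q') *m A.
  by rewrite !canonX_rest !HA -mulmxBl opprB addrA subrK.
have E0 : E 0 = 1%:M.
  by apply/row_matrixP => i; rewrite !rowE -HE linflow0 mulmx1.
have dE (d : 'rV[R]_3) (t : R) : is_derive t 1 (fun t => d *m E t) (d *m E t *m A).
  have := is_derive_linflow mu H t d; rewrite HA HE.
  by rewrite (_ : (fun s => linflow mu H s d) = (fun t => d *m E t))//; apply/funext => s; rewrite HE.
have [f0 [ef aB]] := half_contraction mu_gt0 H0 T1 T2 yp yE xE eqH erefl.
have [N [cN [CN [th [AN th0 th1 contr]]]]] := adapted_norm_exists f0 (expR_gt0 _) ef aB.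
have hd v := half_derivativeE zp xp TP ST HE v.
have contr' v : N (half_derivative (canonX mu H) gam T E v) <= th * N v.
  by have [h1 h2] := hd v; apply: contr.
have [eps [d1 [d [rho [sg [dU [th' [eps0 eps1 epsm D]]]]]]]] :=
  small_data_exists B gam0 gamT XA E0 dE AN th0 th1 contr'.
exists (eps / 3%:R), (basin gam T k dU); split; first by rewrite divr_gt0.
  rewrite gE; exact: (basin_nbhs B gamT D pos).
move=> Xt Yt C1X C1Y closeX closeY Zt.
have e3 : 3%:R * (eps / 3%:R) = eps by rewrite mulrC divfK.
have nX := c1_near_of XA C1X closeX; rewrite e3 in nX.
have YA (q q' : 'rV[R]_3) : canonY mu H q - canonY mu H q' = (q - q') *m (lin1_mx (@canonS R) *m A *m lin1_mx (@canonS R)).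
  transitivity (canonS (canonS (q - q') *m A)); first by rewrite canonSB -XA canonSB.
  by rewrite !mulmxA !mul_rV_lin1.
have nY := c1_near_of YA C1Y closeY; rewrite e3 in nY.
have nY' := c1_near_conj nY.
have tubeK t q : 0 <= t <= T + k -> `|q - gam t| <= r -> K q by move=> tI /(tube t q tI)[].
have tubeSK t q : 0 <= t <= T + k -> `|q - gam t| <= r -> (@canonS R @^-1` K) q by move=> tI /(tube t q tI)[].
have [nf1 sf1] := c1_near_field B XA tubeK (ltW eps0) eps1 epsm nX.
have [nf2 sf2] := c1_near_field B XA tubeSK (ltW eps0) eps1 epsm nY'.
have nZ : near_system (canonX mu H) L gam T k r m eps Zt.
  apply: NearSystem; [exact: nf1|exact: nf2|exact: sf1|exact: sf2|exact: tubeK|exact: tubeSK].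
exact: (perturbed_cycle B gam0 gamT AN D nZ).
Qed.
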